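(* Let $X$ be the toric Calabi--Yau threefold containing two disjoint copies of $\mathbb P^1\times\mathbb P^1$ connected by a $(-1,-1)$-curve described in the context, with partition function $Z_X$ in the variables $q,Q_0,Q_{F_1},Q_{F_2},Q_{B_1},Q_{B_2}$, and let $Z_X^{\mathrm{inst}}=Z_X/(Z_X|_{Q_{B_1}=Q_{B_2}=0})$. Let $$q=e^{-2R\hbar},\quad Q_{F_1}=e^{-4Ra_1},\quad Q_{F_2}=e^{-4Ra_2},\quad Q_0=e^{2R(a_1+a_2-m)}$$ (with $Q_{F_k}^{1/2}=e^{-2Ra_k}$). Then $$\begin{aligned}Z_X^{\mathrm{inst}}=\sum_{\mu^1_1,\mu^1_2,\mu^2_1,\mu^2_2}\ &\prod_{k=1}^2\left(\frac{Q_{B_k}}{2^4Q_{F_k}}\right)^{|\mu^k_1|+|\mu^k_2|}\prod_{l,n=1}^2\prod_{i,j\ge1}\frac{\sinh R\big(a^{(k)}_{ln}+\hbar(\mu^k_{l,i}-\mu^k_{n,j}+j-i)\big)}{\sinh R\big(a^{(k)}_{ln}+\hbar(j-i)\big)}\\ &\times q^{\frac12(\kappa(\mu^1_1)+\kappa(\mu^1_2)-\kappa(\mu^2_1)-\kappa(\mu^2_2))}\,(2^2Q_0)^{|\mu^1_1|+|\mu^1_2|+|\mu^2_1|+|\mu^2_2|}\\ &\times(Q_{F_1}^{1/2})^{2|\mu^1_1|+|\mu^2_1|+|\mu^2_2|}\,(Q_{F_2}^{1/2})^{|\mu^1_1|+|\mu^1_2|+2|\mu^2_1|}\\ &\times\prod_{l,n=1}^2\prod_{i,j\ge1}\frac{\sinh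 R\big(a^{(1,2)}_{ln}+m+\hbar(j-i)\big)}{\sinh R\big(a^{(1,2)}_{ln}+m+\hbar(\mu^1_{l,i}-\mu^2_{n,j}+j-i)\big)},\end{aligned}$$ where the sum is over all quadruples of partitions, $\mu^k_{l,i}$ is the $i$-th part of $\mu^k_l$, $$a^{(k)}_{11}=a^{(k)}_{22}=0,\qquad a^{(k)}_{12}=-a^{(k)}_{21}=2a_k\qquad(k=1,2),$$ and $$a^{(1,2)}_{11}=a_1+a_2,\quad a^{(1,2)}_{21}=-a_1+a_2,\quad a^{(1,2)}_{12}=a_1-a_2,\quad a^{(1,2)}_{22}=-a_1-a_2.$$
   Context: **Topological vertex.** $\mathcal P$ is the set of partitions, $\mu^t$ the conjugate of $\mu$, $|\mu|=\sum_j\mu_j$, $\kappa(\mu)=|\mu|+\sum_{j}\mu_j(\mu_j-2j)$ (sum over the nonzero parts). For partitions $\lambda,\mu,\nu$, $s_{\lambda/\mu}(q^{\nu+\rho})$ is the skew Schur function specialized at $x_i=q^{\nu_i-i+1/2}$ ($i\ge1$), regarded as an element of $\mathbb Q(q^{1/2})$ (the series converges for $|q|>1$ to a rational function); $q^{\rho}$ is the case $\nu=\emptyset$. Put $$C_{\lambda_1,\lambda_2,\lambda_3}(q)=q^{\frac12\kappa(\lambda_3)}s_{\lambda_2}(q^\rho)\sum_{\mu\in\mathcal P}s_{\lambda_1/\mu}(q^{\lambda_2^t+\rho})\,s_{\lambda_3^t/\mu}(q^{\lambda_2+\rho}).$$ It is invariant under cyclic permutations of $(\lambda_1,\lambda_2,\lambda_3)$.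 **The threefold.** $X$ is the smooth toric threefold whose fan $\Sigma\subset\mathbb R^3$ has as maximal cones the cones over the eight triangles at height $z=1$ with vertices (in $(x,y)$-coordinates): the four triangles with vertex $(0,0)$ and two cyclically adjacent points among $(1,0),(0,1),(-1,0),(0,-1)$; and the four triangles with vertex $(1,1)$ and two cyclically adjacent points among $(2,1),(1,2),(0,1),(1,0)$. Interior 2-cones $\tau$ correspond to segments shared by two triangles; $C_\tau\cong\mathbb P^1$ is the corresponding torus invariant curve, and $D_\rho$ the torus invariant divisor of a 1-cone $\rho$. A $(-1,-1)$-curve is a torus invariant curve with normal bundle $\mathcal O_{\mathbb P^1}(-1)\oplus\mathcal O_{\mathbb P^1}(-1)$; here it is the curve of the segment $(1,0)$–$(0,1)$. **Toric graph and partition function.** $\Gamma_X$ is the planar dual graph of this triangulation: a trivalent vertex for each triangle (set $V_3$), an edge $e_\tau$ for each interior segment joining the two adjacent triangles (set $E_3$), and an outward edge for each boundary segment. Direct the edges arbitrarily. For $e_\tau\in E_3$ the framing is $n(e_\tau)=\frac12(D_{\rho_1}.C_\tau-D_{\rho_2}.C_\tau)$, where $\rho_1$ (resp. $\rho_2$) is the 1-cone of $\tau$ lying to the right (resp. left) of the directed edge $e_\tau$. The edge variables $Q_e$ are: $Q_0$ for the segment $(1,0)$–$(0,1)$; $Q_{B_1}$ for both segments $(0,0)$–$(0,\pm1)$; $Q_{F_1}$ for both segments $(0,0)$–$(\pm1,0)$; $Q_{B_2}$ for both segments $(1,1)$–$(1,1\pm1)$; $Q_{F_2}$ for both segments $(1,1)$–$(1\pm1,1)$.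 Then $$Z_X=\sum_{\vec\lambda:E_3\to\mathcal P}\ \prod_{e\in E_3}(-1)^{|\vec\lambda(e)|(n(e)+1)}q^{\frac{\kappa(\vec\lambda(e))}2 n(e)}Q_e^{|\vec\lambda(e)|}\prod_{v\in V_3}C_{\vec\lambda_v}(q),$$ where $\vec\lambda_v$ is the triple of partitions on the three edges at $v$, listed counterclockwise, using $\vec\lambda(e)$ if $e$ is directed out of $v$ and $\vec\lambda(e)^t$ if it is directed into $v$; $\vec\lambda(e)=\emptyset$ for boundary edges. ($Z_X$ does not depend on the directions.) **Interpretation.** $Z_X^{\mathrm{inst}}$ is regarded as a formal power series in $Q_{B_1},Q_{B_2}$; its coefficients are rational functions of $q^{1/2},Q_0,Q_{F_1},Q_{F_2}$ (expanded as power series in $Q_0,Q_{F_1},Q_{F_2}$), into which the substitution is made. The infinite products of ratios of $\sinh$ are understood, as is standard, after formal cancellation of common factors, i.e. for partitions $\mu,\nu$, $$\prod_{i,j\ge1}\frac{\sinh R(a+\hbar(\mu_i-\nu_j+j-i))}{\sinh R(a+\hbar(j-i))}=\prod_{(i,j)\in\mu}\frac1{\sinh R(a+\hbar(\mu_i-j+\nu^t_j-i+1))}\prod_{(i,j)\in\nu}\frac1{\sinh R(a-\hbar(\nu_i-j+\mu^t_j-i+1))},$$ where $(i,j)\in\mu$ means $1\le j\le\mu_i$; the inverse ratios are read as the reciprocal.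
   Formalization: The printed a^{(2)}_{12}=-a^{(2)}_{21}=2a_2 is replaced by -2a_2 (k=1 unchanged), since the printed identity fails from order Q_{B_2}^2 on (already in the part linear in Q_0); parameters are taken where no sinh in a denominator vanishes. *)

(* Defs.v *)
From HB Require Import structures.
From mathcomp Require Import all_boot all_order all_algebra.
From mathcomp Require Import complex.
From mathcomp Require Import boolp classical_sets functions fsbigop reals.
From mathcomp Require Import topology normedtype sequences exp trigo.
From mathcomp Require Import -(notations) mpoly.

Set Implicit Arguments.
Unset Strict Implicit.
Unset Printing Implicit Defensive.

Import Order.TTheory GRing.Theory Num.Theory.
Import numFieldNormedType.Exports.

Local Open Scope classical_set_scope.
Local Open Scope ring_scope.

(** * Partitions *)

(* Weakly decreasing lists of positive integers.  Parts and coordinates of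
   cells are numbered from 0. *)
Record intpart := IntPart {
  parts :> seq nat;
  _ : sorted geq parts && (0%N \notin parts)
}.

HB.instance Definition _ := [isSub for parts].
HB.instance Definition _ := [Choice of intpart by <:].

Definition part (mu : intpart) (i : nat) : nat := nth 0%N mu i.

Definition empty_intpart : intpart := @IntPart [::] isT.

Definition psize (mu : intpart) : nat := sumn mu.

Definition conj_parts (s : seq nat) : seq nat :=
  mkseq (fun j => count (fun m => j < m)%N s) (head 0%N s).

Lemma conj_parts_subproof (mu : intpart) :
  sorted geq (conj_parts mu) && (0%N \notin conj_parts mu).
Proof.
apply/andP; split.
  rewrite /conj_parts /mkseq; apply: (@homo_sorted _ _ _ ltn geq).
    by move=> i j ij; apply: sub_count => m; apply: leq_ltn_trans (ltnW ij).
  exact: iota_ltn_sorted.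
apply/mapP => -[j]; rewrite mem_iota add0n /= => jlt.
by case: (parts mu) jlt => //= m s ->.
Qed.

Definition conj_intpart (mu : intpart) : intpart :=
  IntPart (conj_parts_subproof mu).

(* With [i] counted from 0, the index j of the definition is [i.+1]. *)
Definition kappa (mu : intpart) : int :=
  (psize mu)%:Z +
  \sum_(i < size mu) (part mu i)%:Z * ((part mu i)%:Z - (2 * i.+1)%:Z).

(** * Skew Schur functions and their specializations *)

Definition sub_intpart (mu la : intpart) : bool :=
  all (fun i => part mu i <= part la i)%N (iota 0 (size mu)).

Definition cell (la mu : intpart) : finType :=
  {c : 'I_(size la) * 'I_(part la 0) | (part mu c.1 <= c.2 < part la c.1)%N}.

Definition semistandard (la mu : intpart) (N : nat)
    (T : {ffun cell la mu -> 'I_N}) : bool :=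
  [forall c : cell la mu, forall d : cell la mu,
     (((val c).1 == (val d).1) && ((val c).2 < (val d).2)%N
        ==> (T c <= T d)%N)
  && (((val c).2 == (val d).2) && ((val c).1 < (val d).1)%N
        ==> (T c < T d)%N)].

(* s_{la/mu}(x_0, ..., x_(N-1)), zero unless mu is contained in la. *)
Definition skew_schur (F : fieldType) (N : nat) (la mu : intpart)
    (x : nat -> F) : F :=
  if sub_intpart mu la then
    \sum_(T : {ffun cell la mu -> 'I_N} | semistandard T)
      \prod_(c : cell la mu) x (T c)
  else 0.

(* The field Q(q^(1/2)): the variable 'X stands for q^(1/2). *)
Definition ratfun : fieldType := {fraction {poly rat}}.

Definition qhalf : ratfun := tofrac ('X : {poly rat}).

Definition has_value (F : numFieldType) (f : ratfun) (z w : F) : Prop :=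
  exists p r : {poly rat},
    [/\ f = tofrac p / tofrac r,
        (map_poly ratr r).[z] != 0 &
        w = (map_poly ratr p).[z] / (map_poly ratr r).[z]].

(* q^(nu_i - i + 1/2) for i = k + 1, where z = q^(1/2). *)
Definition qrho (F : fieldType) (nu : intpart) (z : F) (k : nat) : F :=
  z ^ ((2 * part nu k)%:Z - (2 * k + 1)%:Z).

Definition is_skew_schur_q (R : realType) (la mu nu : intpart) (f : ratfun) :
    Prop :=
  forall z : R[i], 1 < `|z| ->
  exists2 w : R[i], has_value f z w &
    (fun N => skew_schur N la mu (qrho nu z) : R[i]^o) @ \oo --> (w : R[i]^o).

(* s_{la/mu}(q^(nu+rho)): the rational function to which the series converges
   for |q| > 1. *)
Definition skew_schur_q (R : realType) (la mu nu : intpart) : ratfun :=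
  xget 0 [set f | is_skew_schur_q R la mu nu f].

(** * The topological vertex *)

Definition top_vertex (R : realType) (l1 l2 l3 : intpart) : ratfun :=
  qhalf ^ kappa l3 * skew_schur_q R l2 empty_intpart empty_intpart *
  \sum_(mu \in [set: intpart])
     skew_schur_q R l1 mu (conj_intpart l2) *
     skew_schur_q R (conj_intpart l3) mu l2.

(** * The threefold and its toric graph *)

(* The point (x, y) stands for the primitive generator (x, y, 1). *)
Definition lattice_pt : Type := (int * int)%type.

(* The vertices of each triangle are listed counterclockwise; the list starts
   at the vertex opposite to the vertical side of the triangle. *)
Definition triangles : seq (lattice_pt * lattice_pt * lattice_pt) :=
  [:: ((1, 0), (0, 1), (0, 0));
      ((-1, 0), (0, 0), (0, 1));
      ((-1, 0), (0, -1), (0, 0));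
      ((1, 0), (0, 0), (0, -1));
      ((2, 1), (1, 2), (1, 1));
      ((0, 1), (1, 1), (1, 2));
      ((0, 1), (1, 0), (1, 1));
      ((2, 1), (1, 1), (1, 0))].

(* [(a, b)] is a side of a triangle with the triangle on the left of the
   vector from a to b. *)
Definition sides (v : lattice_pt * lattice_pt * lattice_pt) :
    seq (lattice_pt * lattice_pt) :=
  [:: (v.1.1, v.1.2); (v.1.2, v.2); (v.2, v.1.1)].

Definition flip (s : lattice_pt * lattice_pt) : lattice_pt * lattice_pt :=
  (s.2, s.1).

Definition Q0 : 'I_5 := inord 0.
Definition QF1 : 'I_5 := inord 1.
Definition QF2 : 'I_5 := inord 2.
Definition QB1 : 'I_5 := inord 3.
Definition QB2 : 'I_5 := inord 4.

Definition interior_segments : seq ((lattice_pt * lattice_pt) * 'I_5) :=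
  [:: (((1, 0), (0, 1)), Q0);
      (((0, 0), (0, 1)), QB1); (((0, 0), (0, -1)), QB1);
      (((0, 0), (1, 0)), QF1); (((0, 0), (-1, 0)), QF1);
      (((1, 1), (1, 2)), QB2); (((1, 1), (1, 0)), QB2);
      (((1, 1), (2, 1)), QF2); (((1, 1), (0, 1)), QF2)].

Lemma interior_segmentsP (s := unzip1 interior_segments)
    (t := flatten (map sides triangles)) :
  perm_eq (s ++ map flip s) [seq a <- t | flip a \in t].
Proof. by []. Qed.

Definition edge : finType := 'I_(size interior_segments).

Definition segment (e : edge) : lattice_pt * lattice_pt :=
  (tnth (in_tuple interior_segments) e).1.

Definition edge_var (e : edge) : 'I_5 :=
  (tnth (in_tuple interior_segments) e).2.

(* A direction of the edge e is encoded by the ordered pair (right, left) of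
   the endpoints of its segment lying to the right and to the left of the
   directed edge.  The edge then leaves the triangle having (right, left) among
   its [sides] and enters the one having (left, right) among them. *)
Definition right_left (dir : edge -> bool) (e : edge) :
    lattice_pt * lattice_pt :=
  if dir e then segment e else flip (segment e).

(* The third vertex of the triangle having [s] among its [sides]. *)
Definition apex (s : lattice_pt * lattice_pt) : lattice_pt :=
  let v := nth ((0, 0), (0, 0), (0, 0)) triangles
             (find (fun v => s \in sides v) triangles) in
  nth (0, 0) [:: v.2; v.1.1; v.1.2] (index s (sides v)).

(* The determinant of the generators (a, 1), (b, 1), (c, 1). *)
Definition det3 (a b c : lattice_pt) : int :=
  (b.1 - a.1) * (c.2 - a.2) - (b.2 - a.2) * (c.1 - a.1).

(* Let u1, u2 be the generators of the 2-cone tau of the segment [s], and w, w'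
   those completing it to the two adjacent maximal cones.  The wall relation
     w + w' + (D_1 . C_tau) u1 + (D_2 . C_tau) u2 = 0
   and det (u1, u2, w) = 1 give D_1 . C_tau = - det (w', u2, w) and
   D_2 . C_tau = - det (u1, w', w). *)
Definition intersection1 (s : lattice_pt * lattice_pt) : int :=
  - det3 (apex (flip s)) s.2 (apex s).

Definition intersection2 (s : lattice_pt * lattice_pt) : int :=
  - det3 s.1 (apex (flip s)) (apex s).

Lemma wall_relation (s := unzip1 interior_segments) :
  all (fun a =>
    [&& det3 a.1 a.2 (apex a) == 1,
        (apex a).1 + (apex (flip a)).1
          + intersection1 a * a.1.1 + intersection2 a * a.2.1 == 0,
        (apex a).2 + (apex (flip a)).2
          + intersection1 a * a.1.2 + intersection2 a * a.2.2 == 0 &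
        2 + intersection1 a + intersection2 a == 0]) (s ++ map flip s).
Proof. by []. Qed.

(* The difference is even, since the two intersection numbers sum to -2. *)
Definition framing (dir : edge -> bool) (e : edge) : int :=
  let s := right_left dir e in
  ((intersection1 s - intersection2 s) %/ 2)%Z.

Definition labelling : Type := {ffun edge -> intpart}.

(* The partition seen at the triangle having [s] among its [sides] on the edge
   crossing s: the empty one on boundary edges. *)
Definition side_intpart (dir : edge -> bool) (lam : labelling)
    (s : lattice_pt * lattice_pt) : intpart :=
  if [pick e | right_left dir e == s] is Some e then lam e
  else if [pick e | right_left dir e == flip s] is Some e
  then conj_intpart (lam e)
  else empty_intpart.

(* As the edges around a vertex of the dual graph cross the sides of a triangle
   in the same cyclic order, they are listed counterclockwise here, the edge
   crossing the vertical side being in second position. *)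
Definition triangle_vertex (R : realType) (dir : edge -> bool)
    (lam : labelling) (v : lattice_pt * lattice_pt * lattice_pt) : ratfun :=
  top_vertex R (side_intpart dir lam (v.1.1, v.1.2))
               (side_intpart dir lam (v.1.2, v.2))
               (side_intpart dir lam (v.2, v.1.1)).

Definition amplitude (R : realType) (dir : edge -> bool) (lam : labelling) :
    ratfun :=
  (\prod_(e : edge)
     ((-1) ^ ((psize (lam e))%:Z * (framing dir e + 1)) *
      qhalf ^ (kappa (lam e) * framing dir e))) *
  \prod_(v <- triangles) triangle_vertex R dir lam v.

(** * Formal power series *)

(* Formal power series in n variables, as families of coefficients. *)
Definition mseries (n : nat) (K : Type) : Type := multinom n -> K.

Definition mseries_mul n (K : fieldType) (f g : mseries n K) : mseries n K :=
  fun d =>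
    \sum_(p \in [set p : multinom n * multinom n | mnm_add p.1 p.2 = d])
       f p.1 * g p.2.

(* The quotient f / g, for g with nonzero constant term. *)
Definition mseries_div n (K : fieldType) (f g : mseries n K) : mseries n K :=
  xget (fun=> 0) [set h | mseries_mul h g = f].

(** * The partition function *)

Definition edge_degree (lam : labelling) (i : 'I_5) : nat :=
  (\sum_(e : edge | edge_var e == i) psize (lam e))%N.

Definition edge_monomial (lam : labelling) : multinom 5 :=
  @Multinom 5 (mktuple (edge_degree lam)).

Definition Z_X (R : realType) (dir : edge -> bool) : mseries 5 ratfun :=
  fun d =>
    \sum_(lam \in [set lam : labelling | edge_monomial lam = d])
       amplitude R dir lam.

(* Setting Q_{B_1} = Q_{B_2} = 0. *)
Definition at_QB0 (f : mseries 5 ratfun) : mseries 5 ratfun :=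
  fun d => if (d QB1 == 0%N) && (d QB2 == 0%N) then f d else 0.

Definition Z_X_inst (R : realType) (dir : edge -> bool) : mseries 5 ratfun :=
  mseries_div (Z_X R dir) (at_QB0 (Z_X R dir)).

(* The coefficient of Q_{B_1}^b1 Q_{B_2}^b2, a power series in Q_0, Q_{F_1},
   Q_{F_2}. *)
Definition coef_QB (b1 b2 : nat) (f : mseries 5 ratfun) : mseries 3 ratfun :=
  fun d => f (@Multinom 5 [tuple of rcons (rcons (multinom_val d) b1) b2]).

(** * Rational functions of q^(1/2), Q_0, Q_{F_1}, Q_{F_2} *)

(* Polynomials in Q_0, Q_{F_1}, Q_{F_2} over Q[q^(1/2)]. *)
Definition tpoly : Type := mpoly 3 {poly rat}.

Definition mseries_of_tpoly (P : tpoly) : mseries 3 ratfun :=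
  fun d => tofrac (mcoeff d P).

(* The series f is the expansion of the rational function P / D. *)
Definition is_expansion (f : mseries 3 ratfun) (P D : tpoly) : Prop :=
  D != 0 /\ mseries_mul (mseries_of_tpoly D) f = mseries_of_tpoly P.

Definition eval_tpoly (F : numFieldType) (t x0 x1 x2 : F) (P : tpoly) : F :=
  mmap (fun c : {poly rat} => (map_poly ratr c).[t])
       (fun i : 'I_3 => nth 0 [:: x0; x1; x2] i) P.

(** * The right-hand side *)

Section RightHandSide.

Variable R : realType.
Implicit Types (z a : R[i]) (mu nu : intpart).

Definition cexp z : R[i] :=
  Complex (expR (complex.Re z) * cos (complex.Im z))
          (expR (complex.Re z) * sin (complex.Im z)).

Definition csinh z : R[i] := (cexp z - cexp (- z)) / 2.

(* [Rad] is the parameter R of the substitution. *)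
Variables Rad hbar : R[i].

(* The product over i, j >= 1 of
     sinh R(a + hbar (mu_i - nu_j + j - i)) / sinh R(a + hbar (j - i))
   after cancellation of the common factors. *)
Definition sinh_ratio a mu nu : R[i] :=
  (\prod_(i < size mu) \prod_(j < part mu i)
     (csinh (Rad * (a + hbar *
        ((part mu i)%:Z - j.+1%:Z + (part (conj_intpart nu) j)%:Z
           - i.+1%:Z + 1)%:~R)))^-1) *
  (\prod_(i < size nu) \prod_(j < part nu i)
     (csinh (Rad * (a - hbar *
        ((part nu i)%:Z - j.+1%:Z + (part (conj_intpart mu) j)%:Z
           - i.+1%:Z + 1)%:~R)))^-1).

Variables a1 a2 m : R[i].

(* The values 1, 2 of the indices k, l, n. *)
Definition i1 : 'I_2 := ord0.
Definition i2 : 'I_2 := ord_max.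

Definition param (k : 'I_2) : R[i] := if k == i1 then a1 else a2.

(* a^(k)_{ln}, with a^(1)_12 = - a^(1)_21 = 2 a_1 and
   a^(2)_12 = - a^(2)_21 = - 2 a_2.  The opposite sign for k = 2 matches
   [bifundamental_weight], in which mu^2_1 goes with -a_2 and mu^2_2 with a_2.
   With a^(2)_12 = 2 a_2 instead, the right-hand side would not be invariant
   under the exchange of the two surfaces (which is a symmetry of the threefold)
   and the identity would fail from Q_{B_2}^2 on. *)
Definition adjoint_weight (k l n : 'I_2) : R[i] :=
  let a := if k == i1 then 2 * a1 else - (2 * a2) in
  if l == n then 0 else if l == i1 then a else - a.

(* a^(1,2)_{ln}. *)
Definition bifundamental_weight (l n : 'I_2) : R[i] :=
  (-1) ^+ l * a1 + (-1) ^+ n * a2.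

(* Q_{F_k}^(1/2), Q_{F_k}, Q_0 and q^(1/2). *)
Definition vQFhalf (k : 'I_2) : R[i] := cexp (- (2 * Rad * param k)).
Definition vQF (k : 'I_2) : R[i] := cexp (- (4 * Rad * param k)).
Definition vQ0 : R[i] := cexp (2 * Rad * (a1 + a2 - m)).
Definition vqhalf : R[i] := cexp (- (Rad * hbar)).

(* None of the factors sinh in the denominators vanishes. *)
Definition generic_parameters : Prop :=
  (forall N : int, N != 0 -> csinh (Rad * (hbar * N%:~R)) != 0) /\
  (forall (k : 'I_2) (N : int),
     csinh (Rad * (2 * param k + hbar * N%:~R)) != 0).

(* [M (k, l)] is mu^k_l. *)
Definition quadruple : Type := {ffun 'I_2 * 'I_2 -> intpart}.

(* The summand of M without the factors Q_{B_k}. *)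
Definition summand (M : quadruple) : R[i] :=
  let mu k l := M (k, l) in
  let sz k l := psize (M (k, l)) in
  (\prod_(k < 2)
     ((2 ^+ 4 * vQF k)^-1 ^+ (sz k i1 + sz k i2) *
      \prod_(l < 2) \prod_(n < 2)
         sinh_ratio (adjoint_weight k l n) (mu k l) (mu k n))) *
  vqhalf ^ (kappa (mu i1 i1) + kappa (mu i1 i2)
              - kappa (mu i2 i1) - kappa (mu i2 i2)) *
  (2 ^+ 2 * vQ0) ^+ (sz i1 i1 + sz i1 i2 + sz i2 i1 + sz i2 i2) *
  vQFhalf i1 ^+ (2 * sz i1 i1 + sz i2 i1 + sz i2 i2) *
  vQFhalf i2 ^+ (sz i1 i1 + sz i1 i2 + 2 * sz i2 i1) *
  \prod_(l < 2) \prod_(n < 2)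
     (sinh_ratio (bifundamental_weight l n + m) (mu i1 l) (mu i2 n))^-1.

(* The coefficient of Q_{B_1}^b1 Q_{B_2}^b2. *)
Definition rhs_coef (b1 b2 : nat) : R[i] :=
  \sum_(M \in [set M : quadruple |
                 (psize (M (i1, i1)) + psize (M (i1, i2)))%N = b1 /\
                 (psize (M (i2, i1)) + psize (M (i2, i2)))%N = b2])
     summand M.

End RightHandSide.

(* Main.v *)
(** Fix the labels of the four edges carrying [Q_(B_1)] and [Q_(B_2)].  Every
    remaining sum is a Cauchy sum: a fibre edge gives the inverse of a product of
    factors [1 - Q_F q^(al_i + ga_j - i - j + 1)], and the edge of [Q_0], together
    with the two fibre edges at its ends, gives four such products (dual Cauchy
    identity with two gradings) besides two of the former.  Relative to the
    empty labels each infinite product telescopes to a finite one over the cells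
    of the two partitions, while [s_la(q^rho) s_(la^t)(q^rho)] is a product over
    hooks.  Hence a coefficient of [Z_X^inst] is a finite sum of explicit rational
    functions, in which every factor [1 - x q^e] becomes a [sinh] up to a
    monomial; the monomials and signs cancel.  Identities between values at
    [q^(nu + rho)] are limits, for [|q| > 1], of identities between symmetric
    polynomials. *)

Require Import Defs.
From HB Require Import structures.
From mathcomp Require Import all_boot all_order all_algebra.
From mathcomp Require Import complex.
From mathcomp Require Import boolp classical_sets functions fsbigop reals.
From mathcomp Require Import topology normedtype sequences exp trigo.
From mathcomp Require Import -(notations) mpoly.
From mathcomp Require Import perm.
From mathcomp Require Import ring lra zify.

Set Implicit Arguments.
Unset Strict Implicit.
Unset Printing Implicit Defensive.

Import Order.TTheory GRing.Theory Num.Theory.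
Import numFieldNormedType.Exports.

Local Open Scope ring_scope.

(** * Partitions *)

Implicit Types la mu nu : intpart.

(** [skew_schur_q] is a chosen limit, so even the existence of the rational function has to be
    proved; it follows from the self-similarity of [q^rho] under multiplication by [q^-1]. The
    products over pairs of variables are compared on the first N variables of each alphabet, where
    the telescoping leaves boundary factors [1 - q^(e-N) X]; these tend to 1 because [|q| > 1].

    The vertex hides skew functions in its sum over [m]. The fibre edge at such a vertex removes one
    of them by a Cauchy sum with one skew factor; what remains, [\sum_m s_m(x) s_(l/m)(y)] with
    [|m|] fixed, is a coefficient of [s_l] in the alphabet [y] followed by [c x]. The power of [c]
    is recorded by a fibre variable, which is why the edge of [Q_0] produces factors in the four
    monomials [Q_0], [Q_0 Q_(F_1)], [Q_0 Q_(F_2)] and [Q_0 Q_(F_1) Q_(F_2)].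

    Schur functions are handled as recursions on lists over an arbitrary commutative ring, so that
    [c] can be a polynomial variable. Their Cauchy sums rest on two rules for exchanging an added
    strip with a removed one. *)

Lemma part_nonincreasing mu i j : (i <= j)%N -> (part mu j <= part mu i)%N.
Proof.
case: mu => s /= sP ij; have /andP[ss _] := sP; rewrite /part /=.
have [js|js] := ltnP j (size s); last by rewrite [X in (X <= _)%N]nth_default.
apply: (@sorted_leq_nth _ geq _ _ 0%N s ss) => //; last by rewrite inE (leq_ltn_trans ij).
  by move=> a b c /= ba ac; apply: leq_trans ac ba.
by move=> a /=.
Qed.

Lemma part_pos mu i : (0 < part mu i)%N = (i < size mu)%N.
Proof.
rewrite /part; have [js|js] := ltnP i (size mu); last by rewrite nth_default.
have := mem_nth 0%N js; case: mu js => s /= sP _ ns.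
have /andP[_] := sP; rewrite lt0n; apply: contraNneq => <-; exact: ns.
Qed.

Lemma part_default mu i : (size mu <= i)%N -> part mu i = 0%N.
Proof. exact: nth_default. Qed.

Lemma size_leqE mu n : (size mu <= n)%N = (part mu n == 0%N).
Proof. by rewrite leqNgt -part_pos -leqNgt leqn0. Qed.

Lemma eq_intpart mu nu : part mu =1 part nu -> mu = nu.
Proof.
move=> e; apply: val_inj => /=.
have es : size mu = size nu.
  apply/eqP; rewrite eqn_leq; apply/andP; split; rewrite leqNgt -part_pos.
    by rewrite e part_pos ltnn.
  by rewrite -e part_pos ltnn.
by apply: (@eq_from_nth _ 0%N) => // i _; apply: e.
Qed.

Lemma part_empty i : part empty_intpart i = 0%N.
Proof. by rewrite /part nth_nil. Qed.

Lemma psizeE mu L : (size mu <= L)%N -> psize mu = (\sum_(i < L) part mu i)%N.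
Proof.
move=> sL; rewrite /psize sumnE (big_nth 0%N) big_mkord.
rewrite -(big_mkord xpredT (part mu)) (big_cat_nat (n := size mu)) //=.
rewrite [X in (_ + X)%N]big_nat_cond [X in (_ + X)%N]big1 ?addn0 ?big_mkord //.
by move=> i /andP[/andP[]] /part_default ->.
Qed.

Lemma size_le_psize mu : (size mu <= psize mu)%N.
Proof.
rewrite (psizeE (leqnn _)) -[X in (X <= _)%N]card_ord -sum1_card.
by apply: leq_sum => i _; rewrite part_pos.
Qed.

Lemma part_le_psize mu i : (part mu i <= psize mu)%N.
Proof.
rewrite (@psizeE _ (maxn (size mu) i.+1)) ?leq_maxl //.
have ilt : (i < maxn (size mu) i.+1)%N by rewrite leq_max ltnSn orbT.
by rewrite (bigD1 (Ordinal ilt)) //= leq_addr.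
Qed.

Lemma psize_eq0 mu : (psize mu == 0%N) = (mu == empty_intpart).
Proof.
apply/eqP/eqP => [e|->//]; apply: eq_intpart => i; rewrite part_empty.
by apply/eqP; rewrite -leqn0 -e part_le_psize.
Qed.

Lemma psize_empty : psize empty_intpart = 0%N. Proof. by []. Qed.

Definition sub_part mu la := forall i, (part mu i <= part la i)%N.

Lemma sub_intpartP mu la : reflect (sub_part mu la) (sub_intpart mu la).
Proof.
apply: (iffP allP) => [h i|h i _]; last exact: h.
have [js|js] := ltnP i (size mu); last by rewrite part_default.
by apply: h; rewrite mem_iota.
Qed.

Lemma sub_part_psize mu la : sub_part mu la -> (psize mu <= psize la)%N.
Proof.
move=> h; rewrite (@psizeE mu (maxn (size mu) (size la))) ?leq_maxl //.
by rewrite (@psizeE la (maxn (size mu) (size la))) ?leq_maxr // leq_sum.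
Qed.

Lemma sub_part_eq mu la : sub_part mu la -> psize mu = psize la -> mu = la.
Proof.
move=> h e; apply: eq_intpart => i; apply/eqP; rewrite eqn_leq h /=.
rewrite leqNgt; apply/negP => lt.
pose L := (maxn (size mu) (size la) + i.+1)%N.
have ilt : (i < L)%N by rewrite /L; lia.
have: (psize mu < psize la)%N; last by rewrite e ltnn.
rewrite (@psizeE mu L) ?(@psizeE la L); [|rewrite /L; lia..].
rewrite (bigD1 (Ordinal ilt)) //= [X in (_ < X)%N](bigD1 (Ordinal ilt)) //=.
by rewrite -addSn leq_add // leq_sum.
Qed.

(** Membership of the cell [(i, j)] is symmetric in rows and columns. Together with [eq_part_ltn],
    this reduces equalities between parts to equivalences between cells. *)
Lemma part_conj mu i j : (j < part mu i)%N = (i < part (conj_intpart mu) j)%N.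
Proof.
have -> : part (conj_intpart mu) j = count (fun m => j < m)%N mu.
  rewrite /part /= /conj_parts.
  have [jl|jl] := ltnP j (head 0%N mu); first by rewrite nth_mkseq.
  rewrite nth_default ?size_mkseq //; apply/esym/eqP; rewrite -leqn0 leqNgt -has_count.
  apply/hasPn => m /(nthP 0%N)[k _ <-]; rewrite -leqNgt.
  apply: leq_trans jl; rewrite -nth0; exact: (@part_nonincreasing mu 0 k).
have := part_nonincreasing mu; rewrite /part; case: mu => s _ /=.
elim: s i => [|m s IH] i dec /=; first by rewrite nth_nil ltn0.
have dec' k l : (k <= l)%N -> (nth 0%N s l <= nth 0%N s k)%N by apply: (dec k.+1 l.+1).
case: i => [|i] /=.
  case: (ltnP j m) => jm //=; rewrite add0n; apply/esym/negbTE; rewrite -has_count.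
  apply/hasPn => x /(nthP 0%N)[k _ <-]; rewrite -leqNgt.
  by apply: leq_trans jm; apply: (dec 0 k.+1).
rewrite IH //; case: (ltnP j m) => jm /=; rewrite ?add1n ?ltnS ?add0n //.
have -> : count (fun m => (j < m)%N) s = 0%N; last by rewrite !ltn0.
apply/eqP; rewrite -leqn0 leqNgt -has_count.
apply/hasPn => x /(nthP 0%N)[k _ <-]; rewrite -leqNgt.
by apply: leq_trans jm; apply: (dec 0 k.+1).
Qed.

Lemma eq_part_ltn (a b : nat) : (forall j, (j < a)%N = (j < b)%N) -> a = b.
Proof. by move=> h; apply/eqP; rewrite eqn_leq leqNgt h ltnn leqNgt -h ltnn. Qed.

Lemma conj_intpartK : involutive conj_intpart.
Proof.
by move=> mu; apply: eq_intpart => i; apply: eq_part_ltn => j; rewrite -!part_conj.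
Qed.

Lemma size_conj mu : size (conj_intpart mu) = part mu 0.
Proof. by apply: eq_part_ltn => j; rewrite part_conj part_pos. Qed.

Lemma conj_empty : conj_intpart empty_intpart = empty_intpart.
Proof. exact: val_inj. Qed.

(** * Sums and products over the cells of a diagram *)

Section BigCells.

Variables (A : Type) (idx : A) (op : Monoid.com_law idx).

(** Enclosing the diagram in a rectangle makes the inner range independent of the row, so that the
    two products can be exchanged. *)
Lemma big_cells mu L M (F : nat -> nat -> A) :
    (size mu <= L)%N -> (part mu 0 <= M)%N ->
  \big[op/idx]_(i < size mu) \big[op/idx]_(j < part mu i) F i j =
  \big[op/idx]_(i < L) \big[op/idx]_(j < M | (j < part mu i)%N) F i j.
Proof.
move=> sL pM.
rewrite (big_ord_widen L (fun i => \big[op/idx]_(j < part mu i) F i j)) // big_mkcond.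
apply: eq_bigr => i _ /=; case: ifP => [_|/negbT]; last first.
  by rewrite -leqNgt => /part_default ->; rewrite big_pred0.
by rewrite (big_ord_widen M (F i)) // (leq_trans _ pM) // part_nonincreasing.
Qed.

Lemma big_cells_conj mu (F : nat -> nat -> A) :
  \big[op/idx]_(i < size mu) \big[op/idx]_(j < part mu i) F i j =
  \big[op/idx]_(j < size (conj_intpart mu))
     \big[op/idx]_(i < part (conj_intpart mu) j) F i j.
Proof.
rewrite (big_cells _ (leqnn _) (leqnn _)).
rewrite (@big_cells _ (part mu 0) (size mu) (fun j i => F i j)); first last.
- by rewrite -size_conj conj_intpartK.
- by rewrite size_conj.
rewrite (exchange_big_dep xpredT) //=; apply: eq_bigr => j _.
by apply: eq_bigl => i; rewrite part_conj.
Qed.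

End BigCells.

Lemma psize_cells mu : psize mu = (\sum_(i < size mu) \sum_(j < part mu i) 1)%N.
Proof.
by rewrite (psizeE (leqnn _)); apply: eq_bigr => i _; rewrite sum1_card card_ord.
Qed.

Lemma psize_conj mu : psize (conj_intpart mu) = psize mu.
Proof. by rewrite !psize_cells [RHS](big_cells_conj _ mu (fun _ _ => 1%N)). Qed.

Lemma sum_ord_int (n : nat) : \sum_(j < n) (2 * j%:Z) = n%:Z * (n%:Z - 1).
Proof.
elim: n => [|n IH]; first by rewrite big_ord0 mul0r.
by rewrite big_ord_recr /= IH; lia.
Qed.

(** A row [i] of length [m] contributes [m + m (m - 2 (i + 1)) = m (m - 1) - 2 i m], twice the sum
    of its contents. In this form conjugation merely exchanges the coordinates. *)
Lemma kappa_cells mu :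
  kappa mu = \sum_(i < size mu) \sum_(j < part mu i) 2 * (j%:Z - i%:Z).
Proof.
rewrite /kappa (psizeE (leqnn _)).
rewrite (big_morph Posz PoszD (erefl 0%:Z)) -big_split /=; apply: eq_bigr => i _.
under [RHS]eq_bigr do rewrite mulrBr.
rewrite big_split /= sum_ord_int sumrN sumr_const card_ord -mulr_natr.
rewrite natz; lia.
Qed.

Lemma kappa_conj mu : kappa (conj_intpart mu) = - kappa mu.
Proof.
rewrite !kappa_cells (big_cells_conj _ mu (fun i j => 2 * (j%:Z - i%:Z))) -sumrN; apply: eq_bigr => j _.
by rewrite -sumrN; apply: eq_bigr => i _; rewrite -mulrN opprB.
Qed.

(** * Finite lists of partitions *)

Definition mkpart (L : nat) (f : nat -> nat) : intpart :=
  insubd empty_intpart [seq x <- mkseq f L | x != 0%N].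

Lemma part_mkpart L f i : (forall i, (i.+1 < L)%N -> (f i.+1 <= f i)%N) ->
  part (mkpart L f) i = if (i < L)%N then f i else 0%N.
Proof.
move=> dec; set s := mkseq f L.
have ss : sorted geq s.
  apply/(sortedP 0%N) => k; rewrite size_mkseq => kL.
  by rewrite !nth_mkseq ?(ltnW kL) //=; apply: dec.
(* In a nonincreasing list the zeros form a tail, so removing them changes no [nth] with default
   0. *)
have e (t : seq nat) k : sorted geq t -> nth 0%N [seq x <- t | x != 0%N] k = nth 0%N t k.
  elim: t k => [//|x t IH] k /= st; have stt := path_sorted st.
  case: eqP => [x0|_] /=; last by case: k => //= k; apply: IH.
  have /allP z : all (geq x) t.
    by apply: order_path_min st => a b c /= ba ac; apply: leq_trans ac ba.
  have {}z y : y \in t -> y = 0%N by move=> /z /=; rewrite x0 leqn0 => /eqP.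
  have -> : [seq x <- t | x != 0%N] = [::].
    by rewrite -[RHS](filter_pred0 t); apply: eq_in_filter => y /z ->.
  rewrite nth_nil x0; case: k => //= k; have [kt|kt] := ltnP k (size t).
    by apply/esym/z/mem_nth.
  by rewrite nth_default.
rewrite /part /mkpart val_insubd ifT ?e //.
  case: ltnP => iL; first by rewrite nth_mkseq.
  by rewrite nth_default // size_mkseq.
rewrite mem_filter /= andbT; apply: sorted_filter ss.
by move=> a b c /= ba ac; apply: leq_trans ac ba.
Qed.

(** A partition of size at most [n] has at most [n] parts, each at most [n], hence comes from an
    [n]-tuple over ['I_n.+1]. Tuples that do not list a partition may collide with those that do,
    whence [undup]. *)
Definition ple (n : nat) : seq intpart :=
  [seq mu <- undup [seq mkpart n (nth 0%N (map val (val t))) | t : n.-tuple 'I_n.+1]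
     | (psize mu <= n)%N].

Lemma mem_ple n mu : (mu \in ple n) = (psize mu <= n)%N.
Proof.
rewrite mem_filter mem_undup; case: (leqP (psize mu) n) => //= le.
pose t : n.-tuple 'I_n.+1 := mktuple (fun i : 'I_n => inord (part mu i)).
apply/mapP; exists t; first by rewrite mem_enum.
have nt i : (i < n)%N -> nth 0%N [seq \val i | i <- val t] i = part mu i.
  move=> il; rewrite (nth_map ord0) ?size_tuple //.
  have -> : nth ord0 (val t) i = tnth t (Ordinal il) by rewrite (tnth_nth ord0).
  by rewrite tnth_mktuple /= inordK // ltnS (leq_trans (part_le_psize _ _)).
apply: eq_intpart => i; rewrite part_mkpart => [|k kl].
  case: ltnP => il; first by rewrite nt.
  by rewrite part_default // (leq_trans (size_le_psize _)) // (leq_trans le).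
by rewrite !nt ?(ltnW kl) // part_nonincreasing.
Qed.

Lemma uniq_ple n : uniq (ple n).
Proof. by rewrite filter_uniq ?undup_uniq. Qed.

Definition peq (n : nat) : seq intpart := [seq mu <- ple n | psize mu == n].

Lemma mem_peq n mu : (mu \in peq n) = (psize mu == n).
Proof. by rewrite mem_filter mem_ple andb_idr // => /eqP ->. Qed.

Lemma uniq_peq n : uniq (peq n).
Proof. by rewrite filter_uniq ?uniq_ple. Qed.

Lemma peq0 : peq 0 = [:: empty_intpart].
Proof.
apply/perm_small_eq => //; apply: uniq_perm; rewrite ?uniq_peq // => mu.
by rewrite mem_peq inE psize_eq0.
Qed.

Section BigPle.

Variables (A : Type) (idx : A) (op : Monoid.com_law idx).

Lemma big_seq_widen (T : eqType) (s t : seq T) (P : pred T) (F : T -> A) :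
    uniq s -> uniq t -> (forall x, P x -> (x \in s) = (x \in t)) ->
  \big[op/idx]_(x <- s | P x) F x = \big[op/idx]_(x <- t | P x) F x.
Proof.
move=> us ut e; rewrite -big_filter -[RHS]big_filter; apply: perm_big.
apply: uniq_perm; rewrite ?filter_uniq // => x; rewrite !mem_filter.
by case: (boolP (P x)) => //= /e.
Qed.

Lemma big_ple_widen m n (P : pred intpart) (F : intpart -> A) :
    (forall mu, P mu -> (psize mu <= m)%N && (psize mu <= n)%N) ->
  \big[op/idx]_(mu <- ple m | P mu) F mu = \big[op/idx]_(mu <- ple n | P mu) F mu.
Proof.
move=> h; apply: big_seq_widen; rewrite ?uniq_ple // => mu /h /andP[h1 h2].
by rewrite !mem_ple h1 h2.
Qed.

Lemma big_peq_ple k n (P : pred intpart) (F : intpart -> A) : (k <= n)%N ->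
  \big[op/idx]_(mu <- peq k | P mu) F mu =
  \big[op/idx]_(mu <- ple n | P mu && (psize mu == k)) F mu.
Proof.
move=> kn; rewrite big_filter_cond; under eq_bigl do rewrite andbC.
by apply: big_ple_widen => mu /andP[_ /eqP ->]; rewrite leqnn kn.
Qed.

Lemma big_ple_conj n (F : intpart -> A) :
  \big[op/idx]_(mu <- ple n) F mu = \big[op/idx]_(mu <- ple n) F (conj_intpart mu).
Proof.
rewrite -(big_map conj_intpart xpredT F); apply: perm_big; apply: uniq_perm.
- exact: uniq_ple.
- by rewrite map_inj_uniq ?uniq_ple //; apply: inv_inj conj_intpartK.
move=> mu; rewrite mem_ple; apply/idP/mapP => [h|[nu]].
  by exists (conj_intpart mu); rewrite ?conj_intpartK // mem_ple psize_conj.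
by rewrite mem_ple => h ->; rewrite psize_conj.
Qed.

Lemma big_ple_peq n (F : intpart -> A) :
  \big[op/idx]_(mu <- ple n) F mu =
  \big[op/idx]_(k < n.+1) \big[op/idx]_(mu <- peq k) F mu.
Proof.
transitivity (\big[op/idx]_(mu <- ple n | (psize mu < n.+1)%N) F mu).
  by rewrite big_seq_cond [RHS]big_seq_cond; apply: eq_bigl => mu;
     rewrite mem_ple ltnS !andbT andbb.
rewrite (partition_big (fun mu => inord (psize mu) : 'I_n.+1) xpredT) //=.
apply: eq_bigr => k _; have kn : (k <= n)%N by rewrite -ltnS.
rewrite (big_peq_ple _ _ kn); apply: eq_bigl => mu /=.
case: (ltnP (psize mu) n.+1) => h /=; first by rewrite -val_eqE /= inordK.
by apply/esym/negbTE; apply: contraTneq h => ->; rewrite -ltnNge ltn_ord.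
Qed.

End BigPle.

(** * Horizontal and vertical strips *)

Definition hstrip la mu : bool :=
  all (fun i => (part mu i <= part la i)%N && (part la i.+1 <= part mu i)%N)
      (iota 0 (size la + size mu)).

Lemma hstripP la mu :
  reflect (forall i, (part mu i <= part la i)%N /\ (part la i.+1 <= part mu i)%N)
          (hstrip la mu).
Proof.
apply: (iffP allP) => [h i|h i _]; last by apply/andP; apply: h.
have [il|il] := ltnP i (size la + size mu).
  by apply/andP; apply: h; rewrite mem_iota.
by rewrite !part_default //; lia.
Qed.

Definition vstrip la mu : bool := hstrip (conj_intpart la) (conj_intpart mu).

Lemma vstripP la mu :
  reflect (forall i, (part mu i <= part la i <= (part mu i).+1)%N) (vstrip la mu).
Proof.
apply: (iffP (hstripP _ _)) => [h i|h j]; last first.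
  split; rewrite leqNgt; apply/negP.
    rewrite -part_conj => h1; have /andP[h2 _] := h (part (conj_intpart la) j).
    by have := leq_trans h1 h2; rewrite part_conj ltnn.
  rewrite -part_conj => h1; have /andP[_ h2] := h (part (conj_intpart mu) j).
  by have := leq_trans h1 h2; rewrite ltnS part_conj ltnn.
apply/andP; split; rewrite leqNgt; apply/negP; rewrite part_conj => h1.
  have [h2 _] := h (part la i).
  by have := leq_trans h1 h2; rewrite -part_conj ltnn.
have [_ h2] := h (part mu i).
by have := leq_trans h1 h2; rewrite -part_conj ltnn.
Qed.

Lemma hstrip_sub la mu : hstrip la mu -> sub_part mu la.
Proof. by move=> /hstripP h i; case: (h i). Qed.

Lemma vstrip_sub la mu : vstrip la mu -> sub_part mu la.
Proof. by move=> /vstripP h i; case/andP: (h i). Qed.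

Lemma hstrip_psize la mu : hstrip la mu -> (psize mu <= psize la)%N.
Proof. by move=> /hstrip_sub /sub_part_psize. Qed.

Lemma vstrip_psize la mu : vstrip la mu -> (psize mu <= psize la)%N.
Proof. by move=> /vstrip_sub /sub_part_psize. Qed.

Lemma hstrip_refl la : hstrip la la.
Proof. by apply/hstripP => i; rewrite leqnn part_nonincreasing. Qed.

Lemma vstrip_refl la : vstrip la la.
Proof. exact: hstrip_refl. Qed.

(** Distributivity turns the product into a sum over choices of one value per row, and the
    hypothesis forces such a choice to be nonincreasing, hence a partition. Interlacing is a
    condition row by row, so generating functions of strips factor over the rows. *)
Lemma prod_sum_part (A : comNzRingType) (L B : nat) (Q : nat -> nat -> bool)
    (F : nat -> nat -> A) :
    (forall i v w, (i.+1 < L)%N -> Q i v -> Q i.+1 w -> (w <= v)%N) ->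
  \prod_(i < L) \sum_(v < B.+1 | Q i v) F i v =
  \sum_(a <- ple (L * B) | (size a <= L)%N &&
           [forall i : 'I_L, (part a i <= B)%N && Q i (part a i)])
     \prod_(i < L) F i (part a i).
Proof.
move=> dec.
rewrite (bigA_distr_big_dep (fun (i : 'I_L) (v : 'I_B.+1) => Q i v)) /=.
pose g (f : {ffun 'I_L -> 'I_B.+1}) i := nth 0%N [seq (f j : nat) | j <- enum 'I_L] i.
have gE f (i : 'I_L) : g f i = f i.
  by rewrite /g (nth_map i) ?size_enum_ord // nth_ord_enum.
have pg (f : {ffun 'I_L -> 'I_B.+1}) (i : 'I_L) : (forall i : 'I_L, Q i (f i)) -> part (mkpart L (g f)) i = f i.
  move=> fQ; rewrite part_mkpart => [|k kL]; first by rewrite ltn_ord gE.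
  have := gE f (Ordinal (ltnW kL)); have := gE f (Ordinal kL) => /= -> ->.
  exact: (dec _ _ _ kL (fQ (Ordinal (ltnW kL))) (fQ (Ordinal kL))).
transitivity (\sum_(a <- [seq mkpart L (g f) | f in
    [pred f : {ffun 'I_L -> 'I_B.+1} | [forall i : 'I_L, Q i (f i)]]]) \prod_(i < L) F i (part a i)).
  rewrite big_map big_enum_cond /=; apply: eq_big => [f|f /familyP fQ].
    by rewrite andbT inE; apply/familyP/forallP.
  by apply: eq_bigr => i _; rewrite pg.
rewrite -[RHS]big_filter; apply: perm_big; apply: uniq_perm.
- rewrite map_inj_in_uniq ?enum_uniq // => f1 f2; rewrite !mem_enum !inE => /forallP h1 /forallP h2 e.
  by apply/ffunP => i; apply/val_inj; rewrite /= -(pg f1) // -(pg f2) // e.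
- by rewrite filter_uniq ?uniq_ple.
move=> a; rewrite mem_filter mem_ple; apply/mapP/andP => [[f]|[/andP[sa /forallP h] _]].
  rewrite mem_enum inE => /forallP fQ ->.
  have sL : (size (mkpart L (g f)) <= L)%N.
    rewrite size_leqE part_mkpart ?ltnn // => k kL.
    have := gE f (Ordinal (ltnW kL)); have := gE f (Ordinal kL) => /= -> ->.
    exact: (dec _ _ _ kL (fQ (Ordinal (ltnW kL))) (fQ (Ordinal kL))).
  split; first by rewrite sL; apply/forallP => i; rewrite pg // fQ -ltnS ltn_ord.
  rewrite (psizeE sL); apply: (@leq_trans (\sum_(i < L) B)).
    by apply: leq_sum => i _; rewrite pg // -ltnS.
  by rewrite sum_nat_const card_ord.
have fE (i : 'I_L) : ((inord (part a i) : 'I_B.+1) : nat) = part a i.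
  by rewrite inordK // ltnS; case/andP: (h i).
exists [ffun i : 'I_L => inord (part a i)].
  by rewrite mem_enum inE; apply/forallP => i; rewrite ffunE fE; case/andP: (h i).
apply: eq_intpart => i; have [il|il] := ltnP i L.
  have /= -> := pg [ffun i : 'I_L => inord (part a i)] (Ordinal il).
    by rewrite ffunE fE.
  by move=> j; rewrite ffunE fE; case/andP: (h j).
rewrite part_default ?(leq_trans sa) // part_mkpart ?ltnNge ?il // => k kL.
have := gE [ffun i : 'I_L => inord (part a i)] (Ordinal (ltnW kL)).
have := gE [ffun i : 'I_L => inord (part a i)] (Ordinal kL) => /= -> ->.
by rewrite !ffunE !fE /= part_nonincreasing.
Qed.

Lemma sum1_bij (T : eqType) (s t : seq T) (P Q : pred T) (f g : T -> T) :
    uniq s -> uniq t ->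
    (forall x, x \in s -> P x -> [/\ f x \in t, Q (f x) & g (f x) = x]) ->
    (forall y, y \in t -> Q y -> [/\ g y \in s, P (g y) & f (g y) = y]) ->
  (\sum_(x <- s | P x) 1 = \sum_(y <- t | Q y) 1)%N.
Proof.
move=> us ut hf hg; rewrite -big_filter -[RHS]big_filter.
transitivity (\sum_(y <- map f [seq x <- s | P x]) 1)%N; first by rewrite big_map.
apply: perm_big; apply: uniq_perm.
- rewrite map_inj_in_uniq ?filter_uniq // => x y; rewrite !mem_filter.
  by move=> /andP[Px xs] /andP[Py ys] /(congr1 g); have [_ _ ->] := hf x xs Px; have [_ _ ->] := hf y ys Py.
- exact: filter_uniq.
move=> y; rewrite mem_filter; apply/mapP/andP => [[x]|[Qy yt]].
  by rewrite mem_filter => /andP[Px xs] ->; have [] := hf x xs Px.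
by have [gs Pg fg] := hg y yt Qy; exists (g y); rewrite // mem_filter Pg.
Qed.

(** * Exchange of two horizontal strips *)

Section LocalRules.

Variables eta kap : intpart.

Let rmax i := maxn (part eta i) (part kap i).
Let rmin i := minn (part eta i) (part kap i).

Let rmin_max i : (rmin i <= rmax i)%N.
Proof. by rewrite /rmin /rmax; lia. Qed.

Let above a := hstrip a eta && hstrip a kap.
Let below z := hstrip eta z && hstrip kap z.

Let aboveP a : reflect (forall i, (rmax i <= part a i)%N /\ (part a i.+1 <= rmin i)%N)
  (above a).
Proof.
apply: (iffP andP) => [[/hstripP h1 /hstripP h2] i|h].
  by have := h1 i; have := h2 i; rewrite /rmax /rmin; lia.
by split; apply/hstripP => i; have := h i; rewrite /rmax /rmin; lia.
Qed.

Let belowP z : reflect (forall i, (rmax i.+1 <= part z i)%N /\ (part z i <= rmin i)%N)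
  (below z).
Proof.
apply: (iffP andP) => [[/hstripP h1 /hstripP h2] i|h].
  by have := h1 i; have := h2 i; rewrite /rmax /rmin; lia.
by split; apply/hstripP => i; have := h i; rewrite /rmax /rmin; lia.
Qed.

Let L := (size eta + size kap).+1.

Let reta i : (L <= i.+1)%N -> part eta i = 0%N.
Proof. by rewrite /L => h; rewrite part_default; lia. Qed.
Let rkap i : (L <= i.+1)%N -> part kap i = 0%N.
Proof. by rewrite /L => h; rewrite part_default; lia. Qed.

Let sum_rmax_rmin : (\sum_(i < L) (rmin i + rmax i) = psize eta + psize kap)%N.
Proof.
rewrite (@psizeE eta L) ?(@psizeE kap L) -?big_split /=; [|rewrite /L; lia..].
by apply: eq_bigr => i _; rewrite /rmin /rmax; lia.
Qed.

(** This exchange rule is the source of the factors [1 / (1 - x y)] in Cauchy's identity. If the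
    first row of [a] exceeds both [eta] and [kap], one of its cells can be removed. Otherwise the
    first row is fixed, row [i.+1] of [a] ranges freely over the interval from [rmax i.+1] to
    [rmin i], and row [i] of [z] ranges over the same interval. *)
Lemma hstrip_hstrip_count k :
  (\sum_(a <- peq (psize eta + k.+1) | hstrip a eta && hstrip a kap) 1 =
   \sum_(a <- peq (psize eta + k) | hstrip a eta && hstrip a kap) 1 +
   \sum_(z <- ple (psize eta) | [&& hstrip kap z, hstrip eta z &
                                   (psize z + k.+1 == psize kap)%N]) 1)%N.
Proof.
rewrite (bigID (fun a => rmax 0 < part a 0)%N) /=; congr (_ + _)%N.
  (* One map serves both directions: [s = 0] takes a cell from the first row and [s = 2] adds one.
     The bound [(size a).+1] leaves room for a first row when [a] is empty. *)
  pose f (s : nat) (a : intpart) := mkpart (size a).+1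
    (fun i => if i is 0 then (part a 0 + s - 1)%N else part a i).
  have pf s a i : (part a 1 <= part a 0 + s - 1)%N ->
      part (f s a) i = if i is 0 then (part a 0 + s - 1)%N else part a i.
    move=> h; rewrite part_mkpart => [|[|j] _] //; last exact: part_nonincreasing.
    case: ltnP => // il; case: i il => // i il.
    by rewrite part_default // ltnW.
  have sf s a : (part a 1 <= part a 0 + s - 1)%N ->
      (psize (f s a) + part a 0 = psize a + (part a 0 + s - 1))%N.
    move=> h; have sz (b : intpart) : (size b <= (size a + size (f s a)).+1)%N ->
       psize b = (part b 0 + \sum_(i < size a + size (f s a)) part b i.+1)%N.
      by move=> /psizeE ->; rewrite big_ord_recl.
    rewrite (sz a) ?(sz (f s a)); [|lia..].
    rewrite pf // (eq_bigr (fun i => part a (nat_of_ord i).+1)) => [|i _]; last by rewrite pf.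
    by rewrite addnC -[RHS]addnA [X in _ = (_ + X)%N]addnC.
  have r01 a : above a -> (part a 1 <= rmax 0)%N.
    by move=> /aboveP h; have := h 0%N; rewrite /rmax /rmin; lia.
  apply: (@sum1_bij _ _ _ _ _ (f 0%N) (f 2%N)); rewrite ?uniq_peq // => a;
    rewrite !mem_peq => /eqP sa; [move=> /andP[ab lt]|move=> ab]; have r1 := r01 _ ab.
    have h : (part a 1 <= part a 0 + 0 - 1)%N by lia.
    have := sf _ _ h => sfa; split; first by apply/eqP; lia.
      apply/aboveP => i; rewrite !pf //; case: i => [|i]; last exact: (aboveP _ ab).
      by have := aboveP _ ab 0%N; lia.
    apply: eq_intpart => i; rewrite pf; last by rewrite !pf //; lia.
    by case: i => [|i]; rewrite !pf //; lia.
  have a0 := (aboveP _ ab 0%N).1.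
  have h : (part a 1 <= part a 0 + 2%N - 1)%N by lia.
  have := sf _ _ h => sfa; split; first by apply/eqP; lia.
    apply/andP; split; last by rewrite pf //; lia.
    apply/aboveP => i; rewrite !pf //; case: i => [|i]; last exact: (aboveP _ ab).
    by have := aboveP _ ab 0%N; lia.
  apply: eq_intpart => i; rewrite pf; last by rewrite !pf //; lia.
  by case: i => [|i]; rewrite !pf //; lia.
(* Reflection of row [i.+1] in its interval. Unlike a plain shift of rows it gives the sizes of [a]
   and [z] the right sum; [g] restores the first row at its least value. *)
pose f a := mkpart L (fun i => rmin i + rmax i.+1 - part a i.+1)%N.
pose g z := mkpart L.+1
  (fun i => if i is j.+1 then (rmin j + rmax i - part z j)%N else rmax 0).
have pf a i : above a -> part (f a) i = (rmin i + rmax i.+1 - part a i.+1)%N.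
  move=> /aboveP ab; rewrite part_mkpart => [|j _].
    case: ltnP => // il; rewrite /rmin /rmax !reta ?rkap //; lia.
  by have := ab j; have := ab j.+1; have := ab j.+2; have := rmin_max j.+1; lia.
have pg z i : below z ->
    part (g z) i = if i is j.+1 then (rmin j + rmax i - part z j)%N else rmax 0.
  move=> /belowP be; rewrite part_mkpart => [|[|j] _]; first last.
  - by have := be j; have := be j.+1; have := rmin_max j.+1; lia.
  - by have := be 0%N; have := rmin_max 0; lia.
  case: ltnP => // il; case: i il => // i il.
  by rewrite /rmin /rmax !reta ?rkap //; lia.
have sumL a z : (forall i, part a i.+1 + part z i = rmin i + rmax i.+1)%N ->
    part a 0 = rmax 0 -> (psize a + psize z = psize eta + psize kap)%N.
  move=> h h0.
  have zL : (size z <= L)%N.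
    rewrite size_leqE; have := h L.
    by rewrite /rmin /rmax !reta ?rkap //; lia.
  have aL : (size a <= L.+1)%N.
    rewrite size_leqE; have := h L.
    by rewrite /rmin /rmax !reta ?rkap //; lia.
  rewrite (psizeE zL) (psizeE aL) big_ord_recl h0 /= -addnA -big_split /=.
  rewrite (eq_bigr (fun i : 'I_L => rmin i + rmax i.+1)%N) => [|i _]; last exact: h.
  rewrite big_split /= addnCA -(big_ord_recl L (fun i => rmax i)).
  have rL : rmax L = 0%N by rewrite /rmax reta ?rkap.
  by rewrite [X in (_ + X)%N]big_ord_recr /= rL addn0 -sum_rmax_rmin big_split.
apply: (@sum1_bij _ _ _ _ _ f g); rewrite ?uniq_peq ?uniq_ple // => a.
  rewrite mem_peq => /eqP sa /andP[ab]; rewrite -leqNgt => le0.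
  have e0 : part a 0 = rmax 0 by have := aboveP _ ab 0%N; lia.
  have be : below (f a).
    by apply/belowP => i; rewrite pf //; have := aboveP _ ab i; have := aboveP _ ab i.+1; lia.
  have := sumL a (f a) => /(_ _ e0) s; split.
  - by rewrite mem_ple; case/andP: be => /hstrip_psize.
  - case/andP: (be) => -> -> /=; apply/eqP.
    have : (psize a + psize (f a) = psize eta + psize kap)%N; last lia.
    by apply: s => i; rewrite pf //; have := aboveP _ ab i; have := aboveP _ ab i.+1; lia.
  apply: eq_intpart => -[|i]; rewrite pg // pf //.
  by have := aboveP _ ab i; have := aboveP _ ab i.+1; lia.
rewrite mem_ple => sz /and3P[h2 h1 /eqP s]; have be : below a by rewrite /below h1.
have ab : above (g a).
  by apply/aboveP => -[|i]; rewrite !pg //; have := belowP _ be 0%N;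
     [|have := belowP _ be i; have := belowP _ be i.+1]; lia.
have := sumL (g a) a => /(_ _ (pg a 0%N be)) s2; split.
- rewrite mem_peq; apply/eqP.
  have : (psize (g a) + psize a = psize eta + psize kap)%N; last lia.
  by apply: s2 => i; rewrite pg //; have := belowP _ be i; lia.
- by rewrite -/(above (g a)) ab /= pg // ltnn.
apply: eq_intpart => i; rewrite pf // pg //.
by have := belowP _ be i; lia.
Qed.

End LocalRules.

Lemma sum_two_points (A : nmodType) B m (C : pred nat) (F : nat -> A) :
    (m < B)%N ->
  \sum_(v < B.+1 | (m <= v <= m.+1)%N && C v) F v = F m *+ C m + F m.+1 *+ C m.+1.
Proof.
move=> mB; have mB1 : (m < B.+1)%N by exact: ltnW.
rewrite big_mkcond (bigD1 (Ordinal mB1)) //= leqnn leqnSn /= mulrb; congr (_ + _).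
rewrite (bigD1 (Ordinal (mB : (m.+1 < B.+1)%N))) /=; last by rewrite -val_eqE /=; lia.
rewrite leqnn leqnSn /= mulrb big1 ?addr0 // => v /andP[].
by rewrite -!val_eqE /= => h1 h2; case: ifP => // /andP[]; lia.
Qed.

(** The weight of a row in a strip depends jointly on comparisons with two neighbouring rows;
    multiplied by [1 + x] it splits into one factor for each comparison. *)
Lemma bool_factor (A : comNzRingType) (x : A) (a a' b b' : bool) :
    (a ==> a') -> (b ==> b') -> a || b ->
  (1 *+ (a && b') + x *+ (a' && b)) * (1 + x) = (1 *+ a + x *+ a') * (1 *+ b' + x *+ b).
Proof. by case: a; case: a'; case: b; case: b' => //= _ _ _; rewrite ?mulr1n ?mulr0n; ring. Qed.

(** * Exchange of a vertical and a horizontal strip *)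

Section DualRule.

Variables eta kap : intpart.

Let up a := vstrip a eta && hstrip a kap.
Let down z := vstrip kap z && hstrip eta z.

Let L := (size eta + size kap)%N.
Let B := (psize eta + psize kap).+1.

Let Qup i v := (part eta i <= v <= (part eta i).+1)%N &&
  ((part kap i <= v)%N && (if i is j.+1 then v <= part kap j else true)%N).
Let Qdown i v := [&& v <= part kap i, part kap i <= v.+1,
  part eta i.+1 <= v & v <= part eta i]%N.

Let wa i : {poly int} :=
  1 *+ (part kap i <= part eta i)%N + 'X *+ (part kap i <= (part eta i).+1)%N.
Let wb i : {poly int} :=
  1 *+ (part eta i.+1 <= part kap i)%N + 'X *+ (part eta i.+1 < part kap i)%N.

Let bnd i : (part eta i < B)%N /\ (part kap i < B)%N.
Proof.
by have := part_le_psize eta i; have := part_le_psize kap i; rewrite /B; lia.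
Qed.

Let wup i : \sum_(v < B.+1 | Qup i v) 'X^(v - part eta i) =
  if i is j.+1 then
    1 *+ ((part kap i <= part eta i) && (part eta i <= part kap j))%N +
   'X *+ ((part kap i <= (part eta i).+1) && (part eta i < part kap j))%N
  else wa 0 :> {poly int}.
Proof.
have [h _] := bnd i.
rewrite (sum_two_points (fun v => (part kap i <= v)%N &&
  (if i is j.+1 then v <= part kap j else true)%N) (fun v => 'X^(v - part eta i)) h).
by rewrite subnn subSnn expr0 expr1; case: i {h} => [|i] //; rewrite !andbT.
Qed.

Let wdown i : \sum_(v < B.+1 | Qdown i v) 'X^(part kap i - v) =
    1 *+ ((part eta i.+1 <= part kap i) && (part kap i <= part eta i))%N +
   'X *+ ((part eta i.+1 < part kap i) && (part kap i <= (part eta i).+1))%N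
    :> {poly int}.
Proof.
have [_ h] := bnd i; rewrite /Qdown.
case e : (part kap i) h => [|m] h.
  rewrite big_mkcond (bigD1 ord0) //= big1 ?addr0 => [|v]; last first.
    by rewrite -val_eqE /=; case: ifP => // /and3P[]; lia.
  by rewrite mulrb subnn expr0.
rewrite (eq_bigl (fun v : 'I_B.+1 => (m <= v <= m.+1)%N &&
  (part eta i.+1 <= v <= part eta i)%N)); last first.
  by move=> v; apply/and4P/and3P => [[? ? ? ?]|[? ? ?]]; split; lia.
rewrite (sum_two_points (fun v => part eta i.+1 <= v <= part eta i)%N
  (fun v => 'X^(m.+1 - v)) (ltnW h)).
by rewrite subnn subSnn expr0 expr1 addrC !ltnS.
Qed.

Let w_step i :
  (\sum_(v < B.+1 | Qup i.+1 v) 'X^(v - part eta i.+1)) * (1 + 'X) = wa i.+1 * wb i.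
Proof.
rewrite wup /wa /wb; have := part_nonincreasing kap (leqnSn i) => h.
by apply: bool_factor; lia.
Qed.

Let w_down i :
  (\sum_(v < B.+1 | Qdown i v) 'X^(part kap i - v)) * (1 + 'X) = wa i * wb i.
Proof.
rewrite wdown /wa /wb; have := part_nonincreasing eta (leqnSn i) => h.
rewrite -bool_factor; [by congr ((_ *+ nat_of_bool _ + _ *+ nat_of_bool _) * _); rewrite andbC|lia..].
Qed.

(** After multiplication by [(1 + 'X)^L] both products consist of the factors [wa] and [wb]. The
    left side has one more row, hence the extra factor [wa L], and this is [1 + 'X] because [kap]
    has no row [L]. *)
Let prod_rule : \prod_(i < L.+1) \sum_(v < B.+1 | Qup i v) 'X^(v - part eta i) =
  (1 + 'X) * \prod_(i < L) \sum_(v < B.+1 | Qdown i v) 'X^(part kap i - v) :> {poly int}.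
Proof.
have X1 : (1 + 'X : {poly int}) ^+ L != 0.
  rewrite expf_neq0 //; apply/eqP => /(congr1 (fun p => p.[0])) /eqP.
  by rewrite !hornerE.
apply: (mulIf X1); have p1 : (1 + 'X : {poly int}) ^+ L = \prod_(i < L) (1 + 'X).
  by rewrite prodr_const card_ord.
rewrite {1}p1 big_ord_recl -mulrA -big_split /=.
rewrite (eq_bigr (fun i : 'I_L => wa i.+1 * wb i)) => [|i _]; last exact: w_step.
rewrite -mulrA {1}p1 -big_split /=.
rewrite [in RHS](eq_bigr (fun i : 'I_L => wa i * wb i)) => [|i _]; last exact: w_down.
rewrite !big_split /= wup mulrA -(big_ord_recl L wa) big_ord_recr /= -mulrA mulrCA mulrA.
rewrite -mulrA; congr (_ * _).
by rewrite /wa [part kap L]part_default // /L leq_addl.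
Qed.

Let upP a : up a -> (size a <= L.+1)%N /\ (psize a <= L.+1 * B)%N.
Proof.
case/andP => /vstripP h1 /hstripP h2.
have sa : (size a <= L.+1)%N.
  rewrite size_leqE; have [_] := h2 L; rewrite [part kap L]part_default ?leqn0 //.
  exact: leq_addl.
split=> //; rewrite (psizeE sa); apply: (@leq_trans (\sum_(i < L.+1) B)).
  by apply: leq_sum => i _; have := h1 i; have := bnd i; lia.
by rewrite sum_nat_const card_ord.
Qed.

Let downP z : down z -> (size z <= L)%N /\ (psize z <= L * B)%N.
Proof.
case/andP => /vstrip_sub h1 /hstrip_psize h2.
have sa : (size z <= L)%N.
  rewrite size_leqE; have := h1 L; rewrite [part kap L]part_default ?leqn0 //.
  exact: leq_addl.
split=> //; rewrite (psizeE sa); apply: (@leq_trans (\sum_(i < L) B)).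
  by apply: leq_sum => i _; have := h1 i; have := bnd i; lia.
by rewrite sum_nat_const card_ord.
Qed.

Let up_rule : \sum_(a <- ple (L.+1 * B) | up a) 'X^(psize a - psize eta) =
  (1 + 'X) * \sum_(z <- ple (L * B) | down z) 'X^(psize kap - psize z) :> {poly int}.
Proof.
have := prod_rule.
rewrite (@prod_sum_part _ L.+1 B Qup (fun i v => 'X^(v - part eta i))); last first.
  by move=> i v w _ /and3P[_ h _] /and3P[_ _ h']; apply: leq_trans h' h.
rewrite (@prod_sum_part _ L B Qdown (fun i v => 'X^(part kap i - v))); last first.
  by move=> i v w _ /and4P[_ _ h1 h2] /and4P[_ _ h3 h4]; apply: leq_trans h4 h1.
have e1 (a : intpart) : (size a <= L.+1)%N &&
    [forall i : 'I_L.+1, (part a i <= B)%N && Qup i (part a i)] = up a.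
  apply/andP/idP => [[sa /forallP h]|ua].
    have hQ i : Qup i (part a i).
      have [il|il] := ltnP i L.+1; first by have /andP[] := h (Ordinal il).
      rewrite /Qup !(part_default (i := i)) ?(leq_trans sa) //; [|rewrite /L in il; lia..].
      by case: i {il}.
    apply/andP; split; first by apply/vstripP => i; have /and3P[] := hQ i.
    apply/hstripP => i; split; first by have /and3P[] := hQ i.
    by have /and3P[] := hQ i.+1.
  have [sa _] := upP ua; split=> //; apply/forallP => i.
  have /andP[/vstripP h1 /hstripP h2] := ua.
  apply/andP; split; first by have := h1 i; have := bnd i; lia.
  by rewrite /Qup h1 (h2 i).1 /=; case: (i : nat) => // j; apply: (h2 j).2.
have e2 (z : intpart) : (size z <= L)%N &&
    [forall i : 'I_L, (part z i <= B)%N && Qdown i (part z i)] = down z.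
  apply/andP/idP => [[sa /forallP h]|ua].
    have hQ i : Qdown i (part z i).
      have [il|il] := ltnP i L; first by have /andP[] := h (Ordinal il).
      by rewrite /Qdown !part_default ?(leq_trans sa) //; rewrite /L in il; lia.
    apply/andP; split.
      by apply/vstripP => i; have /and4P[-> ->] := hQ i.
    by apply/hstripP => i; have /and4P[] := hQ i.
  have [sa _] := downP ua; split=> //; apply/forallP => i.
  have /andP[/vstripP h1 /hstripP h2] := ua.
  apply/andP; split; first by have := h1 i; have := bnd i; lia.
  by rewrite /Qdown; have := h1 i; have := h2 i; lia.
rewrite (eq_bigl _ _ e1) (eq_bigl _ _ e2) => h.
rewrite (eq_bigr (fun a => \prod_(i < L.+1) 'X^(part a i - part eta i))) => [|a ua].
  rewrite h; congr (_ * _); apply: eq_bigr => z dz.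
  have [sz _] := downP dz; rewrite prodrXr; congr ('X^_).
  have sk : (size kap <= L)%N by rewrite leq_addl.
  rewrite (psizeE sz) (psizeE sk) sumnB // => i _.
  by case/andP: dz => /vstrip_sub.
have [sa _] := upP ua; rewrite prodrXr; congr ('X^_).
have se : (size eta <= L.+1)%N by rewrite ltnW // ltnS leq_addr.
rewrite (psizeE sa) (psizeE se) sumnB // => i _.
by case/andP: ua => /vstrip_sub.
Qed.

(** The coefficient of ['X^k] in [up_rule]: the factor [1 + 'X], the source of the factors [1 + x y]
    in the dual Cauchy identity, gives the two terms. *)
Lemma vstrip_hstrip_count k :
  (\sum_(a <- peq (psize eta + k) | vstrip a eta && hstrip a kap) 1 =
   \sum_(z <- ple (psize eta) | [&& vstrip kap z, hstrip eta z &
                                   (psize z + k == psize kap)%N]) 1 +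
   \sum_(z <- ple (psize eta) | [&& vstrip kap z, hstrip eta z &
                                   (psize z + k == (psize kap).+1)%N]) 1)%N.
Proof.
have := congr1 (fun p : {poly int} => p`_k) up_rule.
rewrite mulrDl mul1r coefD ['X * _]mulrC coefMX !coef_sum.
have s1 (n m N : nat) (P Q : pred intpart) (f : intpart -> nat) :
    (forall z, P z -> (m == f z) = Q z) -> (forall z, P z -> (psize z <= n)%N) ->
    (forall z, P z && Q z -> (psize z <= N)%N) ->
  \sum_(z <- ple n | P z) ('X^(f z) : {poly int})`_m =
    (\sum_(z <- ple N | P z && Q z) 1)%N%:Z.
  move=> h1 h2 h3.
  transitivity (\sum_(z <- ple n | P z && Q z) 1%N%:Z); last first.
    rewrite (big_morph Posz PoszD (erefl 0%:Z)).
    by apply: big_ple_widen => z zP; rewrite h3 // andbT h2 //; case/andP: zP.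
  rewrite big_mkcondr /=; apply: eq_bigr => z Pz.
  by rewrite coefXn h1 //; case: (Q z).
rewrite (s1 _ _ (psize eta + k)%N _ (fun a => psize a == psize eta + k)%N); first last.
- by move=> z /andP[_ /eqP ->].
- by move=> z /upP[].
- by move=> z /andP[/vstrip_psize h _]; lia.
rewrite (s1 _ _ (psize eta) _ (fun z => psize z + k == psize kap)%N); first last.
- by move=> z /andP[/andP[_ /hstrip_psize h] _].
- by move=> z /downP[].
- by move=> z /andP[/vstrip_psize h _]; lia.
rewrite (@big_peq_ple _ _ _ (psize eta + k) (psize eta + k)) //; case: k => [|k] /=; last first.
  rewrite (s1 _ _ (psize eta) _ (fun z => psize z + k.+1 == (psize kap).+1)%N); first last.
  - by move=> z /andP[/andP[_ /hstrip_psize h] _].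
  - by move=> z /downP[].
  - by move=> z /andP[/vstrip_psize h _]; lia.
  by rewrite -PoszD => -[->]; congr (_ + _)%N; apply: eq_bigl => z; rewrite /down andbA.
rewrite addr0 => -[->]; rewrite [X in (_ = _ + X)%N]big1 ?addn0; last first.
  by move=> z /and3P[/vstrip_psize h _ /eqP]; lia.
by apply: eq_bigl => z; rewrite /down andbA.
Qed.

End DualRule.

(** * Skew Schur functions of a list of variables *)

Section Convolution.

Variable A : comNzRingType.
Implicit Types (f g h : nat -> A) (p q : {poly A}).

(** Multiplication of power series on coefficient sequences. Its laws are inherited from polynomials
    truncated above degree [n], which have the same coefficient [n]. *)
Definition conv f g n : A := \sum_(i < n.+1) f i * g (n - i)%N.

Lemma conv_coef f g n p q :
    (forall i, (i <= n)%N -> p`_i = f i) -> (forall i, (i <= n)%N -> q`_i = g i) ->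
  (p * q)`_n = conv f g n.
Proof.
move=> hp hq; rewrite coefM; apply: eq_bigr => i _.
by rewrite hp ?hq ?leq_subr // -ltnS.
Qed.

Let trunc n f : {poly A} := \poly_(i < n.+1) f i.

Let coef_trunc n f i : (i <= n)%N -> (trunc n f)`_i = f i.
Proof. by move=> h; rewrite coef_poly ltnS h. Qed.

Lemma conv_trunc n f g : conv f g n = (trunc n f * trunc n g)`_n.
Proof. by rewrite (@conv_coef f g) => //; apply: coef_trunc. Qed.

Lemma eq_conv f f' g g' : f =1 f' -> g =1 g' -> conv f g =1 conv f' g'.
Proof. by move=> h h' n; apply: eq_bigr => i _; rewrite h h'. Qed.

Lemma convC f g : conv f g =1 conv g f.
Proof. by move=> n; rewrite !conv_trunc mulrC. Qed.

Lemma convA f g h : conv f (conv g h) =1 conv (conv f g) h.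
Proof.
move=> n; transitivity ((trunc n f * (trunc n g * trunc n h))`_n).
  apply/esym/conv_coef => i ile; first exact: coef_trunc.
  by apply: conv_coef => j ji; rewrite coef_trunc // (leq_trans ji).
rewrite mulrA; apply: conv_coef => i ile; last exact: coef_trunc.
by apply: conv_coef => j ji; rewrite coef_trunc // (leq_trans ji).
Qed.

Lemma convACA (f1 f2 f3 f4 : nat -> A) :
  conv (conv f1 f2) (conv f3 f4) =1 conv (conv f1 f3) (conv f2 f4).
Proof.
move=> n; rewrite -!convA; apply: eq_conv => // i; rewrite !convA.
by apply: eq_conv => // j; apply: convC.
Qed.

Definition conv1 n : A := (n == 0%N)%:R.

Lemma conv1f f : conv conv1 f =1 f.
Proof.
move=> n; rewrite /conv big_ord_recl /conv1 eqxx mul1r subn0 big1 ?addr0 // => i _.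
by rewrite mul0r.
Qed.

Lemma coefM_conv p q n : (p * q)`_n = conv (fun i => p`_i) (fun i => q`_i) n.
Proof. exact: conv_coef. Qed.

End Convolution.

Section SkewSchurList.

Variable A : comNzRingType.
Implicit Types (x y c : A) (xs ys : seq A).

(** The branching rule taken as a definition: the head of the list fills the outer horizontal strip.
    Agreement with semistandard tableaux is [skew_schurE]. *)
Fixpoint sk xs la mu : A :=
  if xs is x :: xs' then
    \sum_(k <- ple (psize la) | hstrip la k) x ^+ (psize la - psize k) * sk xs' k mu
  else (la == mu)%:R.

Lemma sk_sub xs la mu : ~~ sub_intpart mu la -> sk xs la mu = 0.
Proof.
elim: xs la => [|x xs IH] la /= h.
  case: eqP h => // <- /negP[]; apply/sub_intpartP => i; exact: leqnn.
rewrite big1 // => k /hstrip_sub hk; rewrite IH ?mulr0 //.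
apply: contra h => /sub_intpartP h; apply/sub_intpartP => i.
exact: leq_trans (h i) (hk i).
Qed.

Lemma sk_psize xs la mu : (psize la < psize mu)%N -> sk xs la mu = 0.
Proof.
move=> h; apply: sk_sub; apply: contraL h => /sub_intpartP /sub_part_psize.
by rewrite -leqNgt.
Qed.

Lemma sk_widen n xs x la mu : (psize la <= n)%N -> sk (x :: xs) la mu =
  \sum_(k <- ple n | hstrip la k) x ^+ (psize la - psize k) * sk xs k mu.
Proof.
move=> h; apply: big_ple_widen => k /hstrip_psize hk.
by rewrite hk (leq_trans hk).
Qed.

Lemma sk_cat n xs ys la mu : (psize la <= n)%N ->
  sk (xs ++ ys) la mu = \sum_(k <- ple n) sk xs la k * sk ys k mu.
Proof.
elim: xs la => [|x xs IH] la h.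
  rewrite /= (bigD1_seq la) ?mem_ple ?uniq_ple //= eqxx mul1r big1 ?addr0 // => k kl.
  by rewrite eq_sym (negbTE kl) mul0r.
rewrite cat_cons (sk_widen _ _ _ h).
rewrite [RHS](eq_bigr (fun k => \sum_(j <- ple n | hstrip la j)
    x ^+ (psize la - psize j) * (sk xs j k * sk ys k mu))); last first.
  move=> k _; rewrite (sk_widen _ _ _ h) mulr_suml.
  by apply: eq_bigr => j _; rewrite mulrA.
rewrite exchange_big /=; apply: eq_bigr => j /hstrip_psize hj.
by rewrite IH ?(leq_trans hj) // mulr_sumr.
Qed.

Lemma sk_refl xs la : sk xs la la = 1.
Proof.
elim: xs => [|x xs IH] /=; first by rewrite eqxx.
rewrite big_mkcond (bigD1_seq la) ?mem_ple ?uniq_ple //= hstrip_refl subnn mul1r IH.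
rewrite big1 ?addr0 // => k kl; case: ifP => // hk.
rewrite sk_sub ?mulr0 //; apply: contra kl => /sub_intpartP h.
apply/eqP/sub_part_eq; first exact: hstrip_sub.
by apply/eqP; rewrite eqn_leq (hstrip_psize hk) sub_part_psize.
Qed.

Lemma sk_scale c xs la mu :
  sk [seq c * x | x <- xs] la mu = c ^+ (psize la - psize mu) * sk xs la mu.
Proof.
elim: xs la => [|x xs IH] la /=.
  by case: eqP => [->|_]; rewrite ?subnn ?mul1r ?mulr0.
rewrite mulr_sumr; apply: eq_bigr => k hk; rewrite IH.
have [h|h] := ltnP (psize k) (psize mu); first by rewrite !(sk_psize _ h) !mulr0.
have -> : (psize la - psize mu = (psize la - psize k) + (psize k - psize mu))%N.
  by have := hstrip_psize hk; lia.
by rewrite exprMn exprD; ring.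
Qed.

(** The complete homogeneous symmetric functions, as coefficients of a product of geometric
    series. *)
Fixpoint hs xs : nat -> A :=
  if xs is x :: xs' then conv (fun i => x ^+ i) (hs xs') else conv1 A.

Lemma hs0 xs : hs xs 0 = 1.
Proof. by elim: xs => //= x xs IH; rewrite /conv big_ord1 IH mul1r. Qed.

Lemma hs_cons x xs k : hs (x :: xs) k.+1 = hs xs k.+1 + x * hs (x :: xs) k.
Proof.
rewrite /= /conv big_ord_recl mul1r subn0; congr (_ + _).
rewrite mulr_sumr; apply: eq_bigr => i _.
by rewrite lift0 subSS exprS mulrA.
Qed.

Lemma hs_cat xs ys : hs (xs ++ ys) =1 conv (hs xs) (hs ys).
Proof.
elim: xs => [|x xs IH] n /=; first by rewrite conv1f.
by rewrite -convA; apply: eq_conv.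
Qed.

Lemma hs_scale c xs k : hs [seq c * x | x <- xs] k = c ^+ k * hs xs k.
Proof.
elim: xs k => [|x xs IH] k /=; first by case: k => [|k]; rewrite /conv1 ?mul1r ?mulr0.
rewrite /conv mulr_sumr; apply: eq_bigr => i _; rewrite IH exprMn.
have -> : c ^+ k = c ^+ i * c ^+ (k - i) by rewrite -exprD subnKC // -ltnS.
by ring.
Qed.

(** The generating polynomial of the elementary symmetric functions. *)
Definition es_poly xs : {poly A} := \prod_(x <- xs) (1 + x *: 'X).

Lemma hs_es xs : conv (hs xs) (fun i => (\prod_(x <- xs) (1 - x *: 'X))`_i) =1 conv1 A.
Proof.
elim: xs => [|x xs IH] n /=.
  rewrite conv1f big_nil coef1 /conv1; by [].
transitivity (conv (conv (fun i => x ^+ i) (fun i => (1 - x *: 'X : {poly A})`_i))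
  (conv (hs xs) (fun i => (\prod_(x <- xs) (1 - x *: 'X))`_i)) n).
  by rewrite -convACA; apply: eq_conv => // j; rewrite big_cons coefM_conv.
rewrite (eq_conv (frefl _) IH) convC conv1f.
case: n => [|n]; first by rewrite /conv big_ord1 coefB coef1 coefZ coefX mulr0 subr0 mul1r.
rewrite /conv big_ord_recr big_ord_recr /= big1 => [|i _]; last first.
  rewrite coefB coef1 coefZ coefX; have := ltn_ord i => h.
  have -> : (n.+1 - i == 0)%N = false by lia.
  have -> : (n.+1 - i == 1)%N = false by lia.
  by rewrite mulr0 subr0 mulr0.
rewrite subnn subSnn !coefB !coef1 !coefZ !coefX /= !mulr0 mulr1 subr0 mulr1 add0r sub0r.
by rewrite mulrN exprSr addNr.
Qed.

Lemma es_poly_cons x xs k : (es_poly (x :: xs))`_k.+1 = (es_poly xs)`_k.+1 + x * (es_poly xs)`_k.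
Proof. by rewrite /es_poly big_cons mulrDl mul1r coefD -scalerAl coefZ coefXM. Qed.

Lemma es_poly0 xs : (es_poly xs)`_0 = 1.
Proof.
elim: xs => [|x xs IH]; first by rewrite /es_poly big_nil coef1.
by rewrite /es_poly big_cons mulrDl mul1r coefD -scalerAl coefZ coefXM mulr0 addr0.
Qed.

Lemma es_poly_scale c xs k : (es_poly [seq c * x | x <- xs])`_k = c ^+ k * (es_poly xs)`_k.
Proof.
elim: xs k => [|x xs IH] [|k]; rewrite ?es_poly0 ?mul1r //.
  by rewrite /= /es_poly big_nil coef1 mulr0.
by rewrite /= !es_poly_cons !IH exprS mulrDr; ring.
Qed.

(** * Pieri rules and Cauchy identities *)

Section StripSums.

Variable F : intpart -> A.

Lemma big_strip0 (R : intpart -> intpart -> bool) eta :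
    R eta eta -> (forall a, R a eta -> sub_part eta a) ->
  \sum_(a <- peq (psize eta) | R a eta) F a = F eta.
Proof.
move=> r0 rs; rewrite big_mkcond (bigD1_seq eta) ?mem_peq ?uniq_peq //= r0.
rewrite big_seq_cond big1 ?addr0 // => a /andP[]; rewrite mem_peq => /eqP sa ne.
case: ifP => // ra; case/eqP: ne; apply/esym/sub_part_eq => //; exact: rs.
Qed.

(** Once the order of summation is changed, the only remnant of [a] is the number of partitions of
    size [N] above [k] and satisfying [P]; this is the number evaluated by the exchange rules, and
    [strip_unswap] returns to nested sums. *)
Lemma strip_swap (P : pred intpart) N M x : (N <= M)%N ->
  \sum_(a <- peq N | P a)
     \sum_(k <- ple (psize a) | hstrip a k) x ^+ (psize a - psize k) * F k =
  \sum_(k <- ple M) x ^+ (N - psize k) * F k *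
     (\sum_(a <- peq N | P a && hstrip a k) 1)%N%:R.
Proof.
move=> NM; transitivity (\sum_(a <- peq N | P a)
     \sum_(k <- ple M | hstrip a k) x ^+ (N - psize k) * F k).
  rewrite big_seq_cond [RHS]big_seq_cond; apply: eq_bigr => a /andP[].
  rewrite mem_peq => /eqP sa _; rewrite sa.
  apply: big_ple_widen => k /hstrip_psize; rewrite sa => h.
  by rewrite h (leq_trans h).
rewrite (exchange_big_dep xpredT) //=; apply: eq_bigr => k _.
by rewrite natr_sum mulr_sumr; apply: eq_bigr => a _; rewrite mulr1.
Qed.

Lemma strip_unswap (R : intpart -> intpart -> bool) eta k N M x :
    (psize eta + k <= M)%N ->
  \sum_(j <- ple M) x ^+ (N - psize j) * F j *
     (\sum_(z <- ple (psize eta) | [&& R j z, hstrip eta z &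
        (psize z + k == psize j)%N]) 1)%N%:R =
  \sum_(z <- ple (psize eta) | hstrip eta z)
     x ^+ (N - (psize z + k)) * \sum_(j <- peq (psize z + k) | R j z) F j.
Proof.
move=> hM; transitivity (\sum_(z <- ple (psize eta) | hstrip eta z)
  \sum_(j <- ple M | R j z && (psize j == psize z + k)%N) x ^+ (N - psize j) * F j).
  rewrite [RHS](exchange_big_dep xpredT) //=; apply: eq_bigr => j _.
  rewrite natr_sum mulr_sumr; apply: eq_big => [z|z _]; last by rewrite mulr1.
  by rewrite [(psize j == _)]eq_sym andbCA.
apply: eq_bigr => z hz; rewrite (@big_peq_ple _ _ _ _ M); last first.
  by rewrite (leq_trans _ hM) // leq_add2r hstrip_psize.
by rewrite mulr_sumr; apply: eq_bigr => j /andP[_ /eqP ->].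
Qed.

End StripSums.

(** When one variable [x] is peeled off, the exchange rule gives two terms: the count for [k], which
    yields [x h_k], and the strips in the other order, to which the induction on the variables
    applies and yields [h_(k+1)] of the rest. This is the recursion [hs_cons]. *)
Lemma pieri xs eta k :
  \sum_(a <- peq (psize eta + k) | hstrip a eta) sk xs a empty_intpart =
  hs xs k * sk xs eta empty_intpart.
Proof.
have r0 F : \sum_(a <- peq (psize eta) | hstrip a eta) F a = F eta :> A.
  by apply: big_strip0 => [|a]; [apply: hstrip_refl|apply: hstrip_sub].
elim: xs eta k r0 => [|x xs IH] eta k r0.
  case: k => [|k]; first by rewrite addn0 r0 /= /conv1 mul1r.
  rewrite /= /conv1 mul0r big_seq_cond big1 // => a /andP[]; rewrite mem_peq => /eqP sa _.
  by case: eqP => // e; move: sa; rewrite e psize_empty; lia.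
elim: k => [|k IHk]; first by rewrite addn0 hs0 mul1r r0.
have sw N := @strip_swap (fun j => sk xs j empty_intpart) (fun a => hstrip a eta) N (psize eta + k.+1)%N x.
rewrite hs_cons mulrDl -mulrA -IHk.
transitivity (\sum_(j <- ple (psize eta + k.+1))
  x ^+ (psize eta + k.+1 - psize j) * sk xs j empty_intpart *
  (\sum_(a <- peq (psize eta + k.+1) | hstrip a eta && hstrip a j) 1)%N%:R).
  exact: sw.
under eq_bigr do rewrite hstrip_hstrip_count natrD mulrDr.
rewrite big_split /= addrC; congr (_ + _).
  rewrite strip_unswap // mulr_sumr; apply: eq_bigr => z hz.
  rewrite subnDr IH; first by ring.
  by move=> F; apply: big_strip0 => [|a]; [apply: hstrip_refl|apply: hstrip_sub].
rewrite (sw (psize eta + k)%N); last by rewrite leq_add2l.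
rewrite mulr_sumr; apply: eq_bigr => j _.
(* For larger [j] the truncated exponent would be wrong, but then no [a] of size [psize eta + k]
   contains [j] and the count vanishes. *)
have [jk|jk] := leqP (psize j) (psize eta + k).
  by rewrite addnS subSn // exprS !mulrA.
rewrite big_seq_cond big1 ?mulr0 // => a /and3P[]; rewrite mem_peq => /eqP sa _ /hstrip_psize.
by rewrite sa leqNgt jk.
Qed.

(** The two terms of [vstrip_hstrip_count] correspond to the two terms of [es_poly_cons], so an
    induction on the variables suffices. *)
Lemma dual_pieri xs eta k :
  \sum_(a <- peq (psize eta + k) | vstrip a eta) sk xs a empty_intpart =
  (es_poly xs)`_k * sk xs eta empty_intpart.
Proof.
have r0 F e : \sum_(a <- peq (psize e) | vstrip a e) F a = F e :> A.
  by apply: big_strip0 => [|a]; [apply: vstrip_refl|apply: vstrip_sub].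
elim: xs eta k => [|x xs IH] eta [|k]; rewrite ?addn0 ?r0 ?es_poly0 ?mul1r //.
  rewrite /es_poly big_nil coef1 mul0r big_seq_cond big1 // => a /andP[].
  rewrite mem_peq /= => /eqP sa _.
  by case: eqP => // e; move: sa; rewrite e psize_empty; lia.
transitivity (\sum_(j <- ple (psize eta + k.+1))
  x ^+ (psize eta + k.+1 - psize j) * sk xs j empty_intpart *
  (\sum_(a <- peq (psize eta + k.+1) | vstrip a eta && hstrip a j) 1)%N%:R).
  exact: (@strip_swap (fun j => sk xs j empty_intpart) (fun a => vstrip a eta)).
under eq_bigr do rewrite vstrip_hstrip_count natrD mulrDr.
rewrite big_split /= es_poly_cons mulrDl; congr (_ + _).
  rewrite strip_unswap // mulr_sumr; apply: eq_bigr => z hz.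
  by rewrite subnDr IH; ring.
under eq_bigr do under eq_bigl do rewrite addnS eqSS.
rewrite strip_unswap ?leq_add2l // mulr_sumr; apply: eq_bigr => z hz.
have -> : (psize eta + k.+1 - (psize z + k) = (psize eta - psize z).+1)%N.
  by have := hstrip_psize hz; lia.
by rewrite IH exprS; ring.
Qed.

(** Grouping by the number [i] of cells filled with [y] isolates, for fixed [j], the sum over all
    [a] above [j], which is the left side of a Pieri rule. *)
Lemma strip_group (R : intpart -> intpart -> bool) (F G : intpart -> A) n y :
    (forall a j, R a j -> (psize j <= psize a)%N) ->
  \sum_(a <- peq n) F a *
     (\sum_(j <- ple (psize a) | R a j) y ^+ (psize a - psize j) * G j) =
  \sum_(i < n.+1) y ^+ i * \sum_(j <- peq (n - i)) G j *
     \sum_(a <- peq (psize j + i) | R a j) F a.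
Proof.
move=> Rle.
transitivity (\sum_(j <- ple n) y ^+ (n - psize j) * G j * \sum_(a <- peq n | R a j) F a).
  transitivity (\sum_(a <- peq n) \sum_(j <- ple n | R a j) y ^+ (n - psize j) * G j * F a).
    apply: eq_big_seq => a; rewrite mem_peq => /eqP sa; rewrite mulr_sumr sa.
    by apply: eq_bigr => j _; rewrite mulrC.
  rewrite (exchange_big_dep xpredT) //=; apply: eq_bigr => j _.
  by rewrite mulr_sumr.
rewrite big_ple_peq (reindex_inj rev_ord_inj) /=; apply: eq_bigr => i _.
rewrite subSS mulr_sumr; apply: eq_big_seq => j; rewrite mem_peq => /eqP ->.
have ile : (i <= n)%N by rewrite -ltnS.
by rewrite subKn // subnK // mulrA.
Qed.

(** Induction on [ys]: the variable [y] adds a strip, whose sum by [pieri] multiplies by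
    [y^i h_i(xs)], the contribution of the products [x y]. One factor is skew because the fibre edge
    next to the edge of [Q_0] meets one skew function of its vertex. *)
Lemma cauchy_sum xs ys mu k :
  \sum_(a <- peq (psize mu + k)) sk xs a empty_intpart * sk ys a mu =
  hs [seq x * y | y <- ys, x <- xs] k * sk xs mu empty_intpart.
Proof.
elim: ys k => [|y ys IH] k.
  rewrite /= /conv1; case: k => [|k].
    rewrite addn0 (bigD1_seq mu) ?mem_peq ?uniq_peq //= eqxx mulr1 mul1r big1 ?addr0 //.
    by move=> a /negbTE ->; rewrite mulr0.
  rewrite mul0r; apply: big1_seq => a /=; rewrite mem_peq => /eqP sa.
  by case: eqP => [e|]; [move: sa; rewrite e; lia|rewrite mulr0].
rewrite [LHS](@strip_group hstrip _ (fun j => sk ys j mu)); last first.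
  by move=> a j; apply: hstrip_psize.
rewrite allpairs_cons hs_cat /conv mulr_suml.
(* Removing more than [k] cells would leave less than [mu], so only the first [k.+1] terms
   survive. *)
rewrite (_ : (psize mu + k).+1 = (k.+1 + psize mu)%N); last by rewrite addnC addSn.
rewrite big_split_ord /= [X in _ + X]big1 ?addr0 => [|i _]; last first.
  rewrite big1_seq ?mulr0 // => j /=; rewrite mem_peq => /eqP sj.
  by rewrite sk_psize ?mul0r // sj; have := ltn_ord i; lia.
apply: eq_bigr => i _; have ile : (i <= k)%N by rewrite -ltnS.
have -> : [seq x * y | x <- xs] = [seq y * x | x <- xs].
  by apply: eq_map => x; rewrite mulrC.
rewrite hs_scale; under eq_bigr do rewrite pieri.
rewrite -addnBA // -mulrA -[in RHS]mulrA -IH; congr (_ * _).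
by rewrite mulr_sumr; apply: eq_bigr => j _; ring.
Qed.

(** The same induction with [dual_pieri]: a horizontal strip of [conj_intpart a] is a vertical strip
    of [a]. *)
Lemma dual_cauchy_sum xs ys n :
  \sum_(a <- peq n) sk xs a empty_intpart * sk ys (conj_intpart a) empty_intpart =
  (es_poly [seq x * y | y <- ys, x <- xs])`_n.
Proof.
elim: ys n => [|y ys IH] n.
  rewrite /= /es_poly big_nil coef1; case: n => [|n].
    by rewrite peq0 big_seq1 sk_refl conj_empty eqxx mulr1.
  apply: big1_seq => a /=; rewrite mem_peq => /eqP sa.
  case: eqP => [e|]; last by rewrite mulr0.
  by move: sa; rewrite -psize_conj e.
transitivity (\sum_(a <- peq n) sk xs a empty_intpart *
  (\sum_(j <- ple (psize a) | vstrip a j)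
     y ^+ (psize a - psize j) * sk ys (conj_intpart j) empty_intpart)).
  apply: eq_bigr => a _; congr (_ * _); rewrite (sk_widen _ _ _ (leqnn _)) psize_conj.
  rewrite big_mkcond big_ple_conj [RHS]big_mkcond; apply: eq_bigr => j _.
  by rewrite psize_conj.
rewrite strip_group; last by move=> a j; apply: vstrip_psize.
rewrite allpairs_cons /es_poly big_cat coefM; apply: eq_bigr => i _.
have -> : [seq x * y | x <- xs] = [seq y * x | x <- xs].
  by apply: eq_map => x; rewrite mulrC.
rewrite -!/(es_poly _) es_poly_scale -IH.
under eq_bigr do rewrite dual_pieri.
by rewrite -[RHS]mulrA [X in _ = _ * X]mulr_sumr; congr (_ * _); apply: eq_bigr => j _; ring.
Qed.

End SkewSchurList.

Lemma sk_map (A B : comNzRingType) (f : {rmorphism A -> B}) xs la mu :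
  sk (map f xs) la mu = f (sk xs la mu).
Proof.
elim: xs la => [|x xs IH] la /=; first by rewrite rmorph_nat.
by rewrite rmorph_sum; apply: eq_bigr => k _; rewrite rmorphM rmorphXn IH.
Qed.

(** * Semistandard tableaux *)

Section Tableaux.

Variables (F : fieldType) (x : nat -> F).

Section Fillings.

Variables (C : finType) (pos : C -> nat * nat).

(** Cells are an abstract finite type with positions, because the cells left after removal of the
    largest entry form a subtype, which is not again of the form [cell la mu]. *)
Definition ssfilling N (T : {ffun C -> 'I_N}) : bool :=
  [forall c, forall d,
     (((pos c).1 == (pos d).1) && ((pos c).2 < (pos d).2)%N ==> (T c <= T d)%N)
  && (((pos c).2 == (pos d).2) && ((pos c).1 < (pos d).1)%N ==> (T c < T d)%N)].

Definition ssfilling_sum N : F :=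
  \sum_(T : {ffun C -> 'I_N} | ssfilling T) \prod_(c : C) x (T c).

Definition realizes la mu : Prop :=
  injective pos /\
  forall i j, (exists c, pos c = (i, j)) <-> (part mu i <= j < part la i)%N.

Lemma ssfillingP N (T : {ffun C -> 'I_N}) :
  reflect (forall c d,
    ((pos c).1 = (pos d).1 -> ((pos c).2 < (pos d).2)%N -> (T c <= T d)%N) /\
    ((pos c).2 = (pos d).2 -> ((pos c).1 < (pos d).1)%N -> (T c < T d)%N))
    (ssfilling T).
Proof.
apply: (iffP forallP) => [h c d|h c].
  have /forallP /(_ d) /andP[/implyP h1 /implyP h2] := h c.
  by split=> e l; [apply: h1|apply: h2]; rewrite e eqxx.
apply/forallP => d; have [h1 h2] := h c d.
by apply/andP; split; apply/implyP => /andP[/eqP]; [apply: h1|apply: h2].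
Qed.

Lemma realizes_cell la mu c : realizes la mu ->
  (part mu (pos c).1 <= (pos c).2 < part la (pos c).1)%N.
Proof. by case=> _ h; apply/h; exists c; case: (pos c). Qed.

Lemma realizes_card la mu : realizes la mu -> sub_part mu la ->
  (#|C| + psize mu = psize la)%N.
Proof.
move=> [inj h] sub; pose L := maxn (size la) (size mu); pose M := part la 0.
have e (i : 'I_L) (j : 'I_M) :
    (\sum_(c : C) (pos c == (i : nat, j : nat)) = (part mu i <= j < part la i))%N.
  case: (boolP (part mu i <= j < part la i)%N) => [/h [c pc]|/negP n].
    rewrite (bigD1 c) //= pc eqxx big1 // => d dc; case: eqP => // pd.
    by case/eqP: dc; apply: inj; rewrite pd pc.
  by rewrite big1 // => c _; case: eqP => // pc; case: n; apply/h; exists c.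
have -> : (#|C| = \sum_(i < L) \sum_(j < M) \sum_(c : C) (pos c == (i : nat, j : nat)))%N.
  under eq_bigr do rewrite exchange_big; rewrite exchange_big -sum1_card /=.
  apply: eq_bigr => c _; have /andP[_ hc] := realizes_cell c (conj inj h).
  have hi : ((pos c).1 < L)%N by rewrite /L leq_max -part_pos (leq_trans _ hc).
  have hj : ((pos c).2 < M)%N by rewrite (leq_trans hc) // part_nonincreasing.
  rewrite (bigD1 (Ordinal hi)) //= (bigD1 (Ordinal hj)) //= -surjective_pairing eqxx.
  rewrite !big1 // => [i ni|j nj].
    rewrite big1 // => j _; case: eqP => // pc; case/eqP: ni.
    by apply: val_inj; rewrite /= pc.
  by case: eqP => // pc; case/eqP: nj; apply: val_inj; rewrite /= pc.
rewrite (@psizeE mu L) ?leq_maxr // (@psizeE la L) ?leq_maxl // -big_split /=.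
apply: eq_bigr => i _; under eq_bigr do rewrite e.
rewrite (_ : (\sum_(j < M) _)%N = (part la i - part mu i)%N) ?subnK //.
rewrite -(big_mkord xpredT (fun j => (part mu i <= j < part la i)%N : nat)).
rewrite (big_cat_nat (n := part mu i)) //=; last first.
  by rewrite (leq_trans (sub i)) // part_nonincreasing.
rewrite big_nat_cond big1 ?add0n => [|j /andP[/andP[_ hj] _]]; last by lia.
rewrite (big_cat_nat (n := part la i)) //=; last exact: part_nonincreasing.
rewrite addnC big_nat_cond big1 ?add0n => [|j /andP[/andP[hj _] _]]; last by lia.
rewrite big_nat_cond (eq_bigr (fun=> 1%N)) => [|j /andP[-> _] //].
by rewrite -big_nat_cond sum_nat_const_nat muln1.
Qed.

End Fillings.

Lemma ssfilling_sum0 (C : finType) (pos : C -> nat * nat) la mu :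
    realizes pos la mu -> sub_part mu la ->
  ssfilling_sum pos 0 = (la == mu)%:R.
Proof.
move=> re sub; have cC := realizes_card re sub; rewrite /ssfilling_sum.
case: eqP => [e|ne].
  have c0 (c : C) : False.
    by have : (#|C| = 0)%N by [rewrite e in cC; lia]; move/card0_eq/(_ c).
  rewrite (bigD1 [ffun c => False_rect _ (c0 c)]) /=; last first.
    by apply/ssfillingP => c; case: (c0 c).
  rewrite big1 => [|c _]; last by case: (c0 c).
  rewrite big1 ?addr0 // => T /andP[_ /eqP].
  by case; apply/ffunP => c; case: (c0 c).
rewrite big1 // => T _; case: (pickP (xpredT : pred C)) => [c _|h]; first by case: (T c).
case: ne; apply/esym/sub_part_eq => //; rewrite -cC.
by rewrite (eq_card0 h).
Qed.

Section Peel.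

Variables (C : finType) (pos : C -> nat * nat) (la mu : intpart) (N : nat).
Hypotheses (re : realizes pos la mu) (sub : sub_part mu la).

Let inner (eta : intpart) (c : C) : bool := ((pos c).2 < part eta (pos c).1)%N.

Let shape (T : {ffun C -> 'I_N.+1}) eta : bool :=
  [&& sub_intpart mu eta, sub_intpart eta la & [forall c, (T c < N)%N == inner eta c]].

Let shape_uniq T eta eta' : shape T eta -> shape T eta' -> eta = eta'.
Proof.
move=> /and3P[/sub_intpartP h1 /sub_intpartP h2 /forallP h3].
move=> /and3P[/sub_intpartP h4 /sub_intpartP h5 /forallP h6].
apply: eq_intpart => i; apply: eq_part_ltn => j.
have [ji|ij] := ltnP j (part mu i); first by rewrite !(leq_trans ji) ?h1 ?h4.
have [jl|lj] := ltnP j (part la i); last first.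
  by have := h2 i; have := h5 i; lia.
have [c pc] : exists c, pos c = (i, j) by apply/re.2; rewrite ij.
by have := h3 c; have := h6 c; rewrite /inner pc /= => /eqP <- /eqP <-.
Qed.

Let shape_ex T : ssfilling pos T -> exists2 eta, shape T eta & hstrip la eta.
Proof.
move=> /ssfillingP ss.
(* Row [i] of the inner shape ends after its last entry below [N]; the maximum with [part mu i]
   covers rows without such an entry. *)
pose f i := maxn (part mu i) (\max_(c | ((pos c).1 == i) && (T c < N)%N) (pos c).2.+1).
have fP i j : (j < f i)%N <->
    (j < part mu i)%N \/ exists c, [/\ (pos c).1 = i, (T c < N)%N & (j <= (pos c).2)%N].
  rewrite /f leq_max; split=> [/orP[->|]|]; first by left.
    move=> h; right.
    have : ~~ [forall c, ((pos c).1 == i) && (T c < N)%N ==> ((pos c).2 < j)%N].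
      apply: contraL h => /forallP h; rewrite -leqNgt; apply/bigmax_leqP => c hc.
      by have := h c; rewrite hc.
    by rewrite negb_forall => /existsP[c]; rewrite negb_imply -leqNgt => /andP[/andP[/eqP a b] d]; exists c.
  case=> [->//|[c [ci Tc jc]]]; apply/orP; right.
  have := @leq_bigmax_cond C (fun c => ((pos c).1 == i) && (T c < N)%N)
    (fun c => (pos c).2.+1) c.
  by rewrite ci eqxx Tc => /(_ isT); apply: leq_trans.
have fla i : (f i <= part la i)%N.
  rewrite geq_max sub; apply/bigmax_leqP => c /andP[/eqP <- _].
  by have /andP[] := realizes_cell c re.
have fdec i : (f i.+1 <= f i)%N.
  rewrite leqNgt; apply/negP => /fP[h|[c [ci Tc jc]]].
    by have := part_nonincreasing mu (leqnSn i); rewrite leqNgt (leq_trans _ h) // ltnS leq_maxl.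
  have /andP[c1 c2] := realizes_cell c re.
  have [d pd] : exists d, pos d = (i, (pos c).2).
    apply/re.2; rewrite (leq_trans (leq_maxl _ _) jc) /=.
    by rewrite (leq_trans c2) // ci part_nonincreasing.
  have : (f i < f i)%N; last by rewrite ltnn.
  apply/fP; right; exists d; rewrite pd /=; split=> //.
  have [_ h] := ss d c; rewrite (leq_trans (h _ _)) ?pd ?ci //; exact: ltnW.
pose eta := mkpart (size la) f.
have pE i : part eta i = f i.
  rewrite part_mkpart => [|j _]; last exact: fdec.
  case: ltnP => // h; apply/esym/eqP; rewrite -leqn0 (leq_trans (fla i)) //.
  by rewrite part_default.
have sh c : (T c < N)%N = inner eta c.
  rewrite /inner pE; apply/idP/idP => [h|/fP[]].
  - by apply/fP; right; exists c.
  - by have /andP[] := realizes_cell c re; lia.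
  case=> d [di Td jd]; move: jd; rewrite leq_eqVlt => /orP[/eqP e|l].
    suff -> : c = d by [].
    by apply: re.1; rewrite [LHS]surjective_pairing [RHS]surjective_pairing di e.
  by have [h _] := ss c d; apply: leq_ltn_trans Td; apply: h.
exists eta.
  apply/and3P; split; last by apply/forallP => c; apply/eqP/sh.
    by apply/sub_intpartP => i; rewrite pE leq_maxl.
  by apply/sub_intpartP => i; rewrite pE.
(* Two vertically adjacent cells outside [eta] would both have to carry the largest entry, against
   strictness along columns. *)
apply/hstripP => i; rewrite pE; split=> //; rewrite leqNgt; apply/negP => h.
have [c pc] : exists c, pos c = (i, f i).
  by apply/re.2; rewrite leq_maxl (leq_trans h) // part_nonincreasing.
have [d pd] : exists d, pos d = (i.+1, f i).
  apply/re.2; rewrite h (leq_trans (part_nonincreasing mu (leqnSn i))) ?leq_maxl //.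
have := sh c; rewrite /inner pc pE /= ltnn => /negbT; rewrite -leqNgt => NT.
have [_ hcd] := ss c d; rewrite pc pd /= in hcd.
by have := hcd erefl (ltnSn i); have := ltn_ord (T d); lia.
Qed.

Let Cin eta : finType := {c : C | inner eta c}.

Let posin eta (d : Cin eta) : nat * nat := pos (val d).

Lemma realizes_inner eta : sub_part mu eta -> sub_part eta la ->
  realizes (@posin eta) eta mu.
Proof.
move=> h1 h2; split=> [c d /re.1 /val_inj //|i j].
split=> [[[c ic] /= pc]|/andP[a b]]; last first.
  have [c pc] : exists c, pos c = (i, j) by apply/re.2; rewrite a (leq_trans b).
  have ic : inner eta c by rewrite /inner pc.
  by exists (exist _ c ic).
have := ic; rewrite /inner; have := realizes_cell c re.
by move: pc; rewrite /posin /= => -> /= /andP[-> _] ->.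
Qed.

Let ext eta (S : {ffun Cin eta -> 'I_N}) : {ffun C -> 'I_N.+1} :=
  [ffun c => if insub c is Some d then widen_ord (leqnSn N) (S d) else ord_max].

Let ext_in eta S (d : Cin eta) : ext S (val d) = widen_ord (leqnSn N) (S d).
Proof. by rewrite ffunE valK. Qed.

Let ext_out eta (S : {ffun Cin eta -> 'I_N}) c : ~~ inner eta c -> ext S c = ord_max.
Proof. by move=> h; rewrite ffunE insubN. Qed.

Let sum_shape eta : hstrip la eta ->
  \sum_(T | ssfilling pos T && shape T eta) \prod_c x (T c) =
  if sub_intpart mu eta then
    x N ^+ (psize la - psize eta) * ssfilling_sum (@posin eta) N else 0.
Proof.
move=> hs; case: (boolP (sub_intpart mu eta)) => sm; last first.
  by rewrite big1 // => T /andP[_]; rewrite /shape (negbTE sm).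
have /sub_intpartP sm' := sm; have sl := hstrip_sub hs.
have prodE (S : {ffun Cin eta -> 'I_N}) :
    \prod_c x (ext S c) = x N ^+ (psize la - psize eta) * \prod_d x (S d).
  rewrite (bigID (inner eta)) /= mulrC; congr (_ * _).
    rewrite (eq_bigr (fun=> x N)) => [|c h]; last by rewrite ext_out.
    rewrite prodr_const; congr (_ ^+ _).
    have := realizes_card re sub; have := realizes_card (realizes_inner sm' sl) sm'.
    have -> : #|Cin eta| = #|inner eta| by rewrite card_sig; apply: eq_card.
    move=> <- <-; rewrite subnDr -(cardC (inner eta)) addKn.
    exact: eq_card.
  rewrite (reindex_omap (val : Cin eta -> C) insub) => [|c ic]; last by rewrite insubT.
  apply: eq_big => [d|d _]; last by rewrite ext_in.
  by rewrite (valP d) valK eqxx.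
pose h' (T : {ffun C -> 'I_N.+1}) := [pick S : {ffun Cin eta -> 'I_N} | ext S == T].
have ext_inj : injective (@ext eta).
  move=> S1 S2 e; apply/ffunP => d; apply: val_inj.
  by have := congr1 (fun T : {ffun C -> 'I_N.+1} => val (T (val d))) e; rewrite !ext_in.
rewrite (reindex_omap (@ext eta) h'); last first.
  move=> T /andP[_ /and3P[_ _ /forallP h]]; rewrite /h'; case: pickP => [S /eqP /= -> //|no].
  have lt (d : Cin eta) : (T (val d) < N)%N by rewrite (eqP (h _)) (valP d).
  have := no [ffun d => Ordinal (lt d)]; case/eqP; apply/ffunP => c.
  case: (boolP (inner eta c)) => ic.
    rewrite (_ : c = val (exist _ c ic : Cin eta)) // ext_in ffunE.
    exact: val_inj.
  rewrite ext_out //; apply: val_inj => /=.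
  by apply/eqP; rewrite eqn_leq leqNgt (eqP (h c)) ic -ltnS ltn_ord.
rewrite /ssfilling_sum mulr_sumr; apply: eq_big => [S|S _]; last exact: prodE.
have -> : h' (ext S) = Some S.
  rewrite /h'; case: pickP => [S' /eqP /ext_inj -> //|/(_ S)]; by rewrite eqxx.
rewrite eqxx andbT.
have -> : shape (ext S) eta.
  apply/and3P; split=> //; first exact/sub_intpartP.
  apply/forallP => c; case: (boolP (inner eta c)) => ic.
    by rewrite (_ : c = val (exist _ c ic : Cin eta)) // ext_in /= ltn_ord.
  by rewrite ext_out //= ltnn.
rewrite andbT; apply/ssfillingP/ssfillingP => ss c d.
  by have := ss (val c) (val d); rewrite !ext_in.
have /hstripP hst := hs.
(* Interlacing, in the converse direction: below a cell outside [eta] there is no cell of [la], so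
   filling the outer cells with one entry keeps columns strict. *)
have dec i j : (i < j)%N -> (part la j <= part eta i)%N.
  by move=> ij; rewrite (leq_trans (part_nonincreasing la ij)) // (hst i).2.
case: (boolP (inner eta c)) => ic; case: (boolP (inner eta d)) => id.
- rewrite (_ : c = val (exist _ c ic : Cin eta)) // (_ : d = val (exist _ d id : Cin eta)) //.
  by rewrite !ext_in; apply: ss.
- rewrite (ext_out _ id) (_ : c = val (exist _ c ic : Cin eta)) // ext_in /=.
  by split=> _ _; [apply: ltnW|]; apply: ltn_ord.
- move: ic id; rewrite /inner -!leqNgt => ic id.
  split=> e l; first by move: ic id l; rewrite e; lia.
  by have := dec _ _ l; have := realizes_cell d re; move: ic; rewrite e;
     have := (hst (pos d).1).1; lia.
rewrite !ext_out //; split=> // e l.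
move: ic; rewrite /inner -leqNgt e => ic.
by have := dec _ _ l; have := realizes_cell d re; lia.
Qed.

(** The entries below [N] of a semistandard filling occupy exactly one shape [eta], and [la / eta]
    is a horizontal strip; the fillings are partitioned by [eta]. *)
Lemma ssfilling_peel :
  ssfilling_sum pos N.+1 =
  \sum_(eta <- ple (psize la) | hstrip la eta)
    if sub_intpart mu eta then
      x N ^+ (psize la - psize eta) * ssfilling_sum (@posin eta) N else 0.
Proof.
rewrite [RHS](eq_bigr (fun eta => \sum_(T | ssfilling pos T && shape T eta)
  \prod_c x (T c))) => [|eta h]; last by rewrite sum_shape.
rewrite (exchange_big_dep (fun T => ssfilling pos T)) /=; last by move=> ? ? _ /andP[].
apply: eq_bigr => T ss; have [eta sh hs] := shape_ex ss.
rewrite [RHS]big_mkcond [RHS](bigD1_seq eta) ?mem_ple ?uniq_ple ?hstrip_psize //= hs ss sh /=.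
rewrite [X in _ + X]big1 ?addr0 // => eta' ne; case: ifP => // /andP[_ /= sh'].
by case/eqP: ne; apply: (shape_uniq sh' sh).
Qed.

End Peel.

(** The list is reversed because the largest entry, hence the last variable, is peeled off first,
    whereas [sk] consumes the head of its list. *)
Lemma ssfilling_sumE N (C : finType) (pos : C -> nat * nat) la mu :
    realizes pos la mu -> sub_part mu la ->
  ssfilling_sum pos N = sk (rev (mkseq x N)) la mu.
Proof.
elim: N C pos la => [|N IH] C pos la re sub; first by rewrite (ssfilling_sum0 re sub).
rewrite (ssfilling_peel _ re sub) mkseqS rev_rcons /=; apply: eq_bigr => eta hs.
case: ifP => [/sub_intpartP sm|/negbT sm]; last by rewrite sk_sub ?mulr0.
by congr (_ * _); apply: IH => //; apply: (realizes_inner re) => //; apply: hstrip_sub.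
Qed.

End Tableaux.

Lemma skew_schurE (F : fieldType) N la mu (x : nat -> F) :
  skew_schur N la mu x = sk (rev (mkseq x N)) la mu.
Proof.
rewrite /skew_schur; case: ifP => [/sub_intpartP sub|/negbT h]; last by rewrite sk_sub.
pose pos (c : cell la mu) : nat * nat := ((val c).1 : nat, (val c).2 : nat).
rewrite -(@ssfilling_sumE _ _ _ _ pos) //; split=> [[[c1 c2] hc] [[d1 d2] hd] [/= e1 e2]|i j].
  by apply: val_inj => /=; congr pair; apply: val_inj.
split=> [[[c /= hc] [<- <-]] //|/andP[a b]].
have hi : (i < size la)%N by rewrite -part_pos (leq_trans _ b).
have hj : (j < part la 0)%N by rewrite (leq_trans b) // part_nonincreasing.
have h : (part mu (Ordinal hi) <= Ordinal hj < part la (Ordinal hi))%N by rewrite /= a.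
by exists (exist (fun c : 'I_(size la) * 'I_(part la 0) =>
  part mu c.1 <= c.2 < part la c.1)%N (Ordinal hi, Ordinal hj) h).
Qed.

(** * Rational functions as limits *)

Local Open Scope classical_set_scope.

Section Sequences.

Variable K : numFieldType.
Implicit Types (u v : nat -> K^o) (a b c l : K).

Lemma cvgM_regular u v a b : u @ \oo --> (a : K^o) -> v @ \oo --> (b : K^o) ->
  (fun n => u n * v n : K^o) @ \oo --> (a * b : K^o).
Proof. by move=> h1 h2; exact: (@cvgM K nat _ _ u v a b). Qed.

Lemma cvgD_regular u v a b : u @ \oo --> (a : K^o) -> v @ \oo --> (b : K^o) ->
  (fun n => u n + v n : K^o) @ \oo --> (a + b : K^o).
Proof. by move=> h1 h2; exact: (@cvgD K K^o nat _ _ u v a b). Qed.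

Lemma cvg_unique_regular u a b : u @ \oo --> (a : K^o) -> u @ \oo --> (b : K^o) -> a = b.
Proof. by move=> h1 h2; apply: (cvg_unique _ h1 h2); exact: norm_hausdorff. Qed.

Lemma cvg_regularP u l : u @ \oo --> (l : K^o) <->
  (forall e : K, 0 < e -> exists N, forall n, (N <= n)%N -> `|l - u n| < e).
Proof.
split=> [/cvgrPdist_lt h e e0|h].
  by have [N _ hN] := h e e0; exists N => n /hN.
by apply/cvgrPdist_lt => e /h [N hN]; exists N => // n /hN.
Qed.

(** The limit is the fixed point of [w -> c w + l]; the distance to it is contracted by [|c|] up to
    an error that tends to 0. *)
Lemma cvg_affine_rec c u v l :
    `|c| < 1 -> (fun n => c ^+ n : K^o) @ \oo --> (0 : K^o) ->
    (forall n, u n.+1 = c * u n + v n) -> v @ \oo --> (l : K^o) ->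
  u @ \oo --> (l / (1 - c) : K^o).
Proof.
move=> c1 /cvg_regularP hc rec /cvg_regularP hv; apply/cvg_regularP => e e0.
have c1' : 0 < 1 - `|c| by rewrite subr_gt0.
have c0 : 1 - c != 0.
  by apply: contraTneq c1 => /subr0_eq <-; rewrite normr1 ltxx.
have e2 : 0 < e / 2 by rewrite divr_gt0.
pose d n := u n - l / (1 - c).
have dS n : d n.+1 = c * d n - (l - v n) by rewrite /d rec; field.
(* The factor [1 - |c|] compensates the geometric accumulation of the errors, whose total stays
   below [e / 2]. *)
have [N hN] := hv (e / 2 * (1 - `|c|)) (mulr_gt0 e2 c1').
have bound m : `|d (N + m)%N| <= `|c| ^+ m * `|d N| + e / 2.
  elim: m => [|m IH]; first by rewrite addn0 mul1r lerDl ltW.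
  rewrite addnS dS (le_trans (ler_normB _ _)) // normrM.
  have -> : `|c| ^+ m.+1 * `|d N| + e / 2 =
    `|c| * (`|c| ^+ m * `|d N| + e / 2) + e / 2 * (1 - `|c|) by rewrite exprS; ring.
  by rewrite lerD ?ler_wpM2l // ltW // hN // leq_addr.
have p1 : 0 < `|d N| + 1 by rewrite ltr_wpDl.
have [M hM] := hc (e / 2 / (`|d N| + 1)) (divr_gt0 e2 p1).
exists (N + M)%N => n le; rewrite distrC -/(d n) -(subnKC (leq_trans (leq_addr M N) le)).
apply: le_lt_trans (bound _) _; rewrite [X in _ < X](splitr e) ltrD2r.
have := hM (n - N)%N; rewrite leq_subRL ?(leq_trans (leq_addr M N) le) // => /(_ le).
rewrite sub0r normrN normrX ltr_pdivlMr //; apply: le_lt_trans.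
by rewrite ler_wpM2l ?exprn_ge0 // lerDl.
Qed.

End Sequences.

Lemma morph_addf_div (A : comNzRingType) (E : fieldType) (t : {rmorphism A -> E}) a b c d :
  t b != 0 -> t d != 0 -> t a / t b + t c / t d = t (a * d + c * b) / t (b * d).
Proof. by move=> b0 d0; rewrite rmorphD !rmorphM /= addf_div. Qed.

(** * Values of elements of the field of rational functions *)

Section Evaluation.

Variable F : numFieldType.
Implicit Types (f g : ratfun) (z w : F) (p r : {poly rat}).

Definition peval z p : F := (map_poly ratr p).[z].

Lemma pevalD z : {morph peval z : p r / p + r}.
Proof. by move=> p r; rewrite /peval rmorphD hornerD. Qed.

Lemma pevalM z : {morph peval z : p r / p * r}.
Proof. by move=> p r; rewrite /peval rmorphM hornerM. Qed.

Lemma peval1 z : peval z 1 = 1. Proof. by rewrite /peval rmorph1 hornerC. Qed.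
Lemma peval0 z : peval z 0 = 0. Proof. by rewrite /peval rmorph0 hornerC. Qed.
Lemma pevalN z p : peval z (- p) = - peval z p.
Proof. by rewrite /peval rmorphN hornerN. Qed.
Lemma pevalX z : peval z 'X = z. Proof. by rewrite /peval map_polyX hornerX. Qed.

Lemma peval_neq0 z p : peval z p != 0 -> tofrac p != 0.
Proof. by apply: contraNneq => /eqP; rewrite tofrac_eq0 => /eqP ->; rewrite peval0. Qed.

Lemma has_valueD f g z w w' :
  has_value f z w -> has_value g z w' -> has_value (f + g) z (w + w').
Proof.
move=> [p [r [-> r0 ->]]] [p' [r' [-> r0' ->]]].
exists (p * r' + p' * r), (r * r').
have t0 := peval_neq0 r0; have t0' := peval_neq0 r0'.
rewrite -!/(peval _ _) in r0 r0' *.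
split; last by rewrite pevalD !pevalM addf_div.
  have h := @morph_addf_div {poly rat} ratfun
    (@tofrac {poly rat} : {rmorphism {poly rat} -> ratfun}) p r p' r' t0 t0'.
  exact h.
by rewrite pevalM mulf_neq0.
Qed.

Lemma has_valueM f g z w w' :
  has_value f z w -> has_value g z w' -> has_value (f * g) z (w * w').
Proof.
move=> [p [r [-> r0 ->]]] [p' [r' [-> r0' ->]]].
exists (p * p'), (r * r').
rewrite -!/(peval _ _) in r0 r0' *.
by rewrite !pevalM mulf_neq0 // !tofracM; split=> //; rewrite mulf_div.
Qed.

Lemma has_valueV f z w : has_value f z w -> w != 0 -> has_value f^-1 z w^-1.
Proof.
move=> [p [r [-> r0 ->]]]; rewrite -!/(peval _ _) => w0; exists r, p.
rewrite -!/(peval _ _) !invf_div; split=> //.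
by apply: contraNneq w0 => ->; rewrite mul0r.
Qed.

Lemma has_value_poly z p : has_value (tofrac p) z (peval z p).
Proof.
exists p, 1; rewrite -!/(peval _ _) peval1 divr1 oner_neq0; split=> //.
by rewrite ?tofrac1 ?divr1.
Qed.

Lemma has_value0 z : has_value 0 z 0.
Proof. by have := has_value_poly z 0; rewrite tofrac0 peval0. Qed.

Lemma has_value1 z : has_value 1 z 1.
Proof. by have := has_value_poly z 1; rewrite tofrac1 peval1. Qed.

Lemma has_valueN f z w : has_value f z w -> has_value (- f) z (- w).
Proof.
move=> h; rewrite -mulN1r -[X in has_value _ _ X]mulN1r; apply: has_valueM => //.
by have := has_value_poly z (- 1); rewrite tofracN tofrac1 pevalN peval1.
Qed.

Lemma has_value_qhalf z : has_value qhalf z z.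
Proof. by have := has_value_poly z 'X; rewrite pevalX. Qed.

Lemma has_valueXn f z w n : has_value f z w -> has_value (f ^+ n) z (w ^+ n).
Proof.
move=> h; elim: n => [|n IH]; first exact: has_value1.
by rewrite !exprS; apply: has_valueM.
Qed.

Lemma has_value_qhalfX z (k : int) : z != 0 -> has_value (qhalf ^ k) z (z ^ k).
Proof.
move=> z0; have h n : has_value (qhalf ^+ n) z (z ^+ n).
  exact: has_valueXn (has_value_qhalf z).
case: k => n; first exact: h.
by rewrite !NegzE -!exprnN; apply: has_valueV; rewrite ?expf_neq0.
Qed.

Lemma has_value_sum (I : Type) (s : seq I) (P : pred I) (f : I -> ratfun) (w : I -> F) z :
    (forall i, P i -> has_value (f i) z (w i)) ->
  has_value (\sum_(i <- s | P i) f i) z (\sum_(i <- s | P i) w i).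
Proof.
move=> h; elim/big_rec2: _ => [|i y1 y2 Pi]; first exact: has_value0.
exact: has_valueD (h i Pi).
Qed.

(** The fraction behind [has_value] is arbitrary and [d] may vanish at [z]; clearing denominators
    compares any two presentations of [f]. *)
Lemma has_value_cross f z w n d : has_value f z w -> f * tofrac d = tofrac n ->
  w * peval z d = peval z n.
Proof.
move=> [p [r [-> r0 ->]]] h; rewrite -!/(peval _ _) in r0 *.
have : tofrac (p * d) = tofrac (n * r).
  rewrite !tofracM -h -mulrA [tofrac d * _]mulrC mulrA; congr (_ * _).
  by rewrite divfK //; apply: peval_neq0 r0.
move/eqP; rewrite tofrac_eq => /eqP /(congr1 (peval z)); rewrite !pevalM => e.
by rewrite mulrAC e mulfK.
Qed.

Lemma has_value_uniq f z w w' : has_value f z w -> has_value f z w' -> w = w'.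
Proof.
move=> h [p [r [e r0 ->]]]; rewrite -!/(peval _ _) in r0 *.
apply: (mulIf r0); rewrite divfK //; apply: (has_value_cross h).
by rewrite e divfK // (peval_neq0 r0).
Qed.

End Evaluation.

(** The difference has value 0 outside the unit disc, hence a numerator with infinitely many
    roots. *)
Lemma ratfun_eq (F : numFieldType) (f g : ratfun) :
    (forall z : F, 1 < `|z| -> exists2 w, has_value f z w & has_value g z w) -> f = g.
Proof.
move=> h; apply/eqP; rewrite -subr_eq0; apply/eqP.
have {}h (z : F) : 1 < `|z| -> has_value (f - g) z 0.
  move=> /h [w h1 h2]; rewrite -(subrr w); apply: has_valueD => //.
  exact: has_valueN.
have [|n [d [e d0 _]]] := h 2; first by rewrite ger0_norm ?ler0n // ltr1n.
rewrite -!/(peval _ _) in d0; have td0 := peval_neq0 d0.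
have {}e : (f - g) * tofrac d = tofrac n by rewrite e divfK.
have : n = 0.
  apply/eqP; case: (eqVneq n 0) => // n0.
  have m0 : map_poly (ratr : rat -> F) n != 0 by rewrite map_poly_eq0.
  (* The integers from 2 on lie in the domain [|z| > 1]; [size n] of them are already more than a
     nonzero numerator admits. *)
  have := max_poly_roots m0 (rs := [seq k.+2%:R | k <- iota 0 (size n)]).
  rewrite size_map_poly size_map size_iota ltnn => ->//.
    apply/allP => _ /mapP[k _ ->]; apply/rootP; rewrite -/(peval _ _).
    rewrite -(has_value_cross (h _ _) e) ?mul0r //.
    by rewrite ger0_norm ?ler0n // ltr1n.
  rewrite map_inj_uniq ?iota_uniq // => a b /eqP; rewrite eqr_nat eqSS eqSS => /eqP //.
move=> n0; move/eqP: e; rewrite n0 tofrac0 mulf_eq0 (negbTE td0) orbF.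
by move/eqP.
Qed.

(* The truncated alphabet [q^(nu + rho)], in the order in which [sk] removes
   the variables of a tableau. *)
Definition qalph (K : fieldType) nu (z : K) N : seq K := rev (mkseq (qrho nu z) N).

Lemma qrhoS (K : fieldType) (z : K) k : z != 0 ->
  qrho empty_intpart z k.+1 = z ^- 2 * qrho empty_intpart z k.
Proof.
move=> z0; rewrite /qrho !part_empty exprnN -expfzDr //; congr (_ ^ _); lia.
Qed.

(** Self-similarity: a shift of the index in [q^rho] is multiplication by [z ^- 2]. It turns growth
    of the alphabet into a recursion in [N]. *)
Lemma qalphS (K : fieldType) (z : K) N : z != 0 ->
  qalph empty_intpart z N.+1 =
  rcons [seq z ^- 2 * x | x <- qalph empty_intpart z N] (qrho empty_intpart z 0).
Proof.
move=> z0; have -> : N.+1 = (1 + N)%N by [].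
rewrite /qalph /mkseq iotaD map_cat rev_cat cats1; congr rcons.
rewrite add0n (iotaDl 1 0) -map_comp -!map_rev -map_comp.
by apply: eq_map => k /=; rewrite add1n qrhoS.
Qed.

Lemma qalphD (K : fieldType) nu (z : K) N : z != 0 ->
  qalph nu z (size nu + N) =
  [seq z ^- (2 * size nu) * x | x <- qalph empty_intpart z N] ++ qalph nu z (size nu).
Proof.
move=> z0; rewrite /qalph /mkseq iotaD map_cat rev_cat; congr (_ ++ _).
rewrite add0n -[X in iota X _]addn0 (iotaDl (size nu) 0) -map_comp -!map_rev -map_comp.
apply: eq_map => k /=.
rewrite /qrho part_empty part_default ?leq_addr // exprnN -expfzDr //; congr (_ ^ _); lia.
Qed.

Lemma sk1 (A : comNzRingType) (x : A) la mu :
  sk [:: x] la mu = if hstrip la mu then x ^+ (psize la - psize mu) else 0.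
Proof.
rewrite /=; case: ifP => h.
  rewrite big_mkcond (bigD1_seq mu) ?mem_ple ?uniq_ple ?hstrip_psize //= h eqxx mulr1.
  rewrite big1 ?addr0 // => k /negbTE ->; by rewrite mulr0 if_same.
by rewrite big1 // => k hk; case: eqP => [e|]; [rewrite -e hk in h|rewrite mulr0].
Qed.

(** * Rational functions determined by limits for [|q| > 1] *)

Section LimitValues.

Variable R : realType.
Implicit Types (f g : ratfun) (u v : R[i] -> nat -> R[i]).

(** The format in which identities are transferred: [u z N] is a truncation, and by [lim_val_uniq]
    equal truncations have equal rational functions. *)
Definition lim_val f u : Prop := forall z : R[i], 1 < `|z| ->
  exists2 w : R[i], has_value f z w & (fun N => u z N : R[i]^o) @ \oo --> (w : R[i]^o).

Lemma lim_valD f g u v : lim_val f u -> lim_val g v ->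
  lim_val (f + g) (fun z N => u z N + v z N).
Proof.
move=> hf hg z z1; have [w h1 h2] := hf z z1; have [w' h1' h2'] := hg z z1.
by exists (w + w'); [apply: has_valueD|apply: (cvgD_regular h2 h2')].
Qed.

Lemma lim_valM f g u v : lim_val f u -> lim_val g v ->
  lim_val (f * g) (fun z N => u z N * v z N).
Proof.
move=> hf hg z z1; have [w h1 h2] := hf z z1; have [w' h1' h2'] := hg z z1.
by exists (w * w'); [apply: has_valueM|apply: (cvgM_regular h2 h2')].
Qed.

Lemma lim_val_cst f (u : R[i] -> R[i]) :
  (forall z, 1 < `|z| -> has_value f z (u z)) -> lim_val f (fun z _ => u z).
Proof. by move=> h z z1; exists (u z); [apply: h|apply: cvg_cst]. Qed.

Lemma lim_val_eq f u v :
  (forall z, 1 < `|z| -> exists N0, forall N, (N0 <= N)%N -> u z N = v z N) ->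
  lim_val f u -> lim_val f v.
Proof.
move=> e h z z1; have [w h1 /cvg_regularP h2] := h z z1; exists w => //.
apply/cvg_regularP => ep /h2 [N hN]; have [N0 hN0] := e z z1.
by exists (maxn N N0) => n; rewrite geq_max => /andP[a b]; rewrite -hN0 // hN.
Qed.

Lemma lim_val_uniq f g u : lim_val f u -> lim_val g u -> f = g.
Proof.
move=> hf hg; apply: (@ratfun_eq R[i]) => z z1.
have [w h1 h2] := hf z z1; have [w' h1' h2'] := hg z z1; exists w => //.
by rewrite (cvg_unique_regular h2 h2').
Qed.

Lemma lim_val_sum (I : Type) (s : seq I) (P : pred I) (f : I -> ratfun)
    (u : I -> R[i] -> nat -> R[i]) :
    (forall i, P i -> lim_val (f i) (u i)) ->
  lim_val (\sum_(i <- s | P i) f i) (fun z N => \sum_(i <- s | P i) u i z N).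
Proof.
move=> h; elim: s => [|i s IH].
  rewrite big_nil; apply: lim_val_eq (lim_val_cst (fun z _ => has_value0 z)) => z _.
  by exists 0%N => N _; rewrite big_nil.
rewrite big_cons; case: ifP => Pi.
  apply: lim_val_eq (lim_valD (h i Pi) IH) => z _.
  by exists 0%N => N _; rewrite big_cons Pi.
by apply: lim_val_eq IH => z _; exists 0%N => N _; rewrite big_cons Pi.
Qed.

Lemma norm_gt1_neq0 (z : R[i]) : 1 < `|z| -> z != 0.
Proof. by apply: contraTneq => ->; rewrite normr0 ltr10. Qed.

Lemma lim_val_qhalf (k : int) : lim_val (qhalf ^ k) (fun z _ => z ^ k).
Proof. by apply: lim_val_cst => z /norm_gt1_neq0; apply: has_value_qhalfX. Qed.

Lemma lim_val_shift f u n : lim_val f u -> lim_val f (fun z N => u z (N - n)%N).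
Proof.
move=> h z z1; have [w h1 /cvg_regularP h2] := h z z1; exists w => //.
apply/cvg_regularP => e /h2 [N hN]; exists (N + n)%N => k hk; apply: hN.
by rewrite leq_subRL ?(leq_trans _ hk) ?leq_addl // addnC.
Qed.

Lemma cvg_expC (c : R[i]) : `|c| < 1 -> (fun n => c ^+ n : R[i]^o) @ \oo --> (0 : R[i]^o).
Proof.
move=> c1; apply/cvg_regularP => e e0.
have [r rE] : exists r : R, `|c| = (r%:C)%C by rewrite normc_def; eexists.
have r1 : `|r| < 1.
  have r0 : 0 <= r by rewrite -lecR -rE normr_ge0.
  by rewrite ger0_norm // -ltcR -rE.
have [ee eE ee0] : exists2 x : R, e = (x%:C)%C & 0 < x.
  by case: e e0 => a b; rewrite ltcE /= => /andP[/eqP -> a0]; exists a.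
have /cvgrPdist_lt /(_ ee ee0) [N _ hN] := cvg_expr r1.
exists N => n /hN; rewrite !sub0r !normrN => h.
by rewrite normrX rE eE -rmorphXn ltcR; apply: le_lt_trans h; apply: ler_norm.
Qed.

Lemma lim_val_scalar f u : lim_val f u -> forall k : int,
  lim_val (qhalf ^ k * f) (fun z N => z ^ k * u z N).
Proof. by move=> h k; apply: lim_valM (lim_val_qhalf k) h. Qed.

Lemma lim_val_affine_rec f g u v (k : nat) : (0 < k)%N ->
    (forall z N, 1 < `|z| -> u z N.+1 = z ^- k * u z N + v z N) ->
    lim_val g v -> f = g / (1 - qhalf ^- k) -> lim_val f u.
Proof.
move=> k0 rec hg -> z z1; have [w h1 h2] := hg z z1.
have zk : `|z ^- k| < 1.
  by rewrite normfV normrX invf_lt1 ?exprn_gt0 ?(lt_trans ltr01) // exprn_egt1 // -lt0n.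
have z0 := norm_gt1_neq0 z1.
exists (w / (1 - z ^- k)).
  apply: has_valueM => //; apply: has_valueV.
    apply: has_valueD; first exact: has_value1.
    apply: has_valueN; apply: has_valueV; last by rewrite expf_neq0.
    exact: has_valueXn (has_value_qhalf z).
  by apply: contraTneq zk => /subr0_eq <-; rewrite normr1 ltxx.
exact: (@cvg_affine_rec R[i] (z ^- k) (u z) (v z) w zk (cvg_expC zk) (fun n => rec z n z1) h2).
Qed.

(** By [qalphS] and [sk_cat] the truncation for [N.+1] is an affine function of the one for [N],
    with multiplier [z ^- (2 (|la| - |mu|))], which is less than 1 in norm. The inhomogeneous part
    involves only larger inner shapes, whence the induction on [|la| - |mu|]. *)
Lemma sk_lim_empty la mu : exists f,
  lim_val f (fun z N => sk (qalph empty_intpart z N) la mu).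
Proof.
have [n] := ubnP (psize la - psize mu); elim: n mu => // n IH mu lt.
case: (eqVneq la mu) => [->|ne].
  exists 1; apply: lim_val_eq (lim_val_cst (fun z _ => has_value1 z)) => z _.
  by exists 0%N => N _; rewrite sk_refl.
case: (boolP (sub_intpart mu la)) => [/sub_intpartP sub|h]; last first.
  exists 0; apply: lim_val_eq (lim_val_cst (fun z _ => has_value0 z)) => z _.
  by exists 0%N => N _; rewrite sk_sub.
have sz : (psize mu < psize la)%N.
  rewrite ltn_neqAle sub_part_psize // andbT; apply: contra ne => /eqP e.
  by apply/eqP/esym/sub_part_eq.
pose P k := hstrip k mu && (k != mu).
have hP k : P k -> (psize mu < psize k)%N.
  case/andP => h kn; rewrite ltn_neqAle hstrip_psize // andbT; apply: contra kn => /eqP e.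
  by apply/eqP/esym/sub_part_eq => //; apply: hstrip_sub.
have ex k : exists f, P k -> lim_val f (fun z N => sk (qalph empty_intpart z N) la k).
  case: (boolP (P k)) => [Pk|_]; last by exists 0.
  have [f hf] : exists f, lim_val f (fun z N => sk (qalph empty_intpart z N) la k).
    by apply: IH; have := hP k Pk; lia.
  by exists f.
have [fk hfk] := @choice intpart ratfun (fun k f => P k -> lim_val f
  (fun z N => sk (qalph empty_intpart z N) la k)) ex.
pose g := \sum_(k <- ple (psize la) | P k)
  qhalf ^ (- (2 * (psize la - psize k))%:Z - (psize k - psize mu)%:Z) * fk k.
have hg : lim_val g (fun z N => \sum_(k <- ple (psize la) | P k)
    z ^ (- (2 * (psize la - psize k))%:Z - (psize k - psize mu)%:Z) *
      sk (qalph empty_intpart z N) la k).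
  apply: (@lim_val_sum _ _ _ _ (fun k z N =>
    z ^ (- (2 * (psize la - psize k))%:Z - (psize k - psize mu)%:Z) *
    sk (qalph empty_intpart z N) la k)) => k /hfk h.
  exact: (lim_val_scalar h).
(* The fixed point of the recursion: the term [k = mu] gives the multiplier and the other [k] give
   [g]. *)
exists (g / (1 - qhalf ^- (2 * (psize la - psize mu)))).
apply: (lim_val_affine_rec _ _ hg (erefl _)) => [|z N /norm_gt1_neq0 z0]; first by lia.
rewrite qalphS // -cats1 (sk_cat _ _ _ (leqnn _)).
rewrite (bigD1_seq mu) ?mem_ple ?uniq_ple ?(ltnW sz) //= sk_scale.
rewrite -/(sk [:: _] _ _) sk_refl mulr1 exprVn -exprM; congr (_ + _).
rewrite big_mkcond [RHS]big_mkcond; apply: eq_bigr => k _.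
rewrite -/(sk [:: _] k mu) sk1 sk_scale /P.
case: eqP => //= _; rewrite ?andbF ?andbT //; case: ifP => h; rewrite ?mulr0 //.
rewrite mulrAC; congr (_ * _).
rewrite /qrho part_empty exprVn -exprM expfzDr // exprnN.
rewrite muln0 expr0z mul1r [RHS]expfzDr //; congr (_ * _).
by rewrite exprnP exprz_exp; congr (_ ^ _); lia.
Qed.

(** The choice made by [xget] is meaningful once some rational limit exists. Only [size nu]
    variables of [q^(nu + rho)] differ from a rescaled [q^rho], so [sk_cat] reduces existence to
    [sk_lim_empty]. *)
Lemma skew_schur_qE la mu nu : lim_val (skew_schur_q R la mu nu)
  (fun z N => sk (qalph nu z N) la mu).
Proof.
have [f hf] : exists f, lim_val f (fun z N => sk (qalph nu z N) la mu).
  have [fk hfk] := @choice intpart ratfun (fun k f => lim_val f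
    (fun z N => sk (qalph empty_intpart z N) la k)) (sk_lim_empty la).
  exists (\sum_(k <- ple (psize la))
    (qhalf ^ (- (2 * size nu * (psize la - psize k))%:Z) * fk k) *
    sk (qalph nu qhalf (size nu)) k mu).
  apply: (@lim_val_eq _ (fun z N => \sum_(k <- ple (psize la))
      (z ^ (- (2 * size nu * (psize la - psize k))%:Z) *
       sk (qalph empty_intpart z (N - size nu)) la k) *
      sk (qalph nu z (size nu)) k mu)) => [z /norm_gt1_neq0 z0|].
    exists (size nu) => N hN; rewrite -{2}(subnKC hN) qalphD // (sk_cat _ _ _ (leqnn _)).
    apply: eq_bigr => k _; rewrite sk_scale; congr (_ * _ * _).
    by rewrite exprVn -exprM -exprnN.
  apply: lim_val_sum => k _; apply: lim_valM.
    apply: lim_val_scalar; exact: (lim_val_shift (size nu) (hfk k)).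
  apply: lim_val_cst => z /norm_gt1_neq0 z0.
  have h (s : seq nat) j : has_value (sk (rev (map (qrho nu qhalf) s)) j mu) z
      (sk (rev (map (qrho nu z) s)) j mu).
    rewrite -!map_rev; elim: (rev s) j => [|i r IHr] j /=.
      by case: eqP => _; [apply: has_value1|apply: has_value0].
    apply: has_value_sum => l _; apply: has_valueM (IHr l).
    by apply: has_valueXn; apply: has_value_qhalfX.
  exact: h.
have : [set f | is_skew_schur_q R la mu nu f] (skew_schur_q R la mu nu).
  apply: xgetPex; exists f => z z1; have [w h1 h2] := hf z z1; exists w => //.
  by under eq_fun do rewrite skew_schurE.
by move=> /= h z z1; have [w h1] := h z z1; under eq_fun do rewrite skew_schurE; exists w.
Qed.

End LimitValues.

(** * Principal specializations *)

Section JacobiTrudi.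

Variable A : comNzRingType.
Implicit Types (x : A) (xs : seq A).

(* h_(l - c), where negative indices give 0. *)
Definition hshift xs (l c : nat) : A := if (c <= l)%N then hs xs (l - c) else 0.

Lemma hshift_cons x xs l c :
  hshift (x :: xs) l.+1 c = hshift xs l.+1 c + x * hshift (x :: xs) l c.
Proof.
rewrite /hshift; case: ltngtP => [cl|cl|->].
- by rewrite -ltnS cl subSn ?hs_cons // -ltnS.
- by rewrite leqNgt (ltnW cl) mulr0 addr0.
by rewrite subnn !hs0 ltnn mulr0 addr0.
Qed.

Lemma hshift0 xs c : hshift xs 0 c = (c == 0%N)%:R.
Proof. by rewrite /hshift leqn0; case: eqP => // _; rewrite sub0n hs0. Qed.

(** Telescoping of [hshift_cons]. For [a] the next part of [la], the boundary term is a multiple of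
    the entry in the next row of [jt_matrix], so a row operation can absorb it. *)
Lemma hshift_sum x xs a b d c : (a <= b)%N ->
  \sum_(a <= v < b.+1) x ^+ (b - v) * hshift xs (v + d) c =
  hshift (x :: xs) (b + d) c -
  (if (a + d)%N is l.+1 then x ^+ (b - a).+1 * hshift (x :: xs) l c else 0).
Proof.
move=> ab; rewrite -(subnK ab) addnC; elim: (b - a)%N => [|k IH].
  rewrite addn0 big_nat1 subnn mul1r; case: (a + d)%N => [|l].
    by rewrite !hshift0 subr0.
  by rewrite hshift_cons expr1 addrK.
rewrite addnS big_nat_recr /=; last by lia.
rewrite subnn mul1r addSn hshift_cons.
rewrite [X in X + _](_ : _ = x * \sum_(a <= v < (a + k).+1) x ^+ (a + k - v) * hshift xs (v + d) c).
  rewrite IH; case: (a + d)%N => [|l]; first by rewrite !subr0 addrC.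
  have -> : ((a + k).+1 - a)%N = k.+1 by lia.
  have -> : (a + k - a)%N = k by lia.
  by rewrite [x ^+ k.+2]exprS; ring.
rewrite mulr_sumr; apply: eq_big_nat => v /andP[_ hv].
by rewrite subSn // exprS mulrA.
Qed.

Section Determinant.

Variable n : nat.

(** The columns are in the order opposite to the usual [h_(la_i - i + j)], which keeps both indices
    natural. The resulting sign is the determinant for no variables and the empty partition. *)
Definition jt_matrix xs la : 'M[A]_n :=
  \matrix_(i, c) hshift xs (part la i + (n - i.+1)) c.

Lemma jt_matrix_nil la : (size la <= n)%N -> la != empty_intpart ->
  \det (jt_matrix [::] la) = 0.
Proof.
move=> sn ne.
have s0 : (0 < size la)%N by rewrite lt0n size_eq0; apply: contra ne => /eqP e; apply/eqP/val_inj.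
have n0 : (0 < n)%N by rewrite (leq_trans s0).
rewrite (expand_det_row _ (Ordinal n0)) big1 // => c _.
rewrite mxE /hshift /= /conv1.
have := ltn_ord c; rewrite -part_pos in s0; move: s0 => *.
by rewrite ifT; [rewrite (_ : (_ == 0%N) = false) ?mul0r //; lia|lia].
Qed.

Lemma sum_hstrip_prod la (f : nat -> nat -> A) : (size la <= n)%N ->
  \sum_(k <- ple (psize la) | hstrip la k) \prod_(i < n) f i (part k i) =
  \prod_(i < n) \sum_(part la i.+1 <= v < (part la i).+1) f i v.
Proof.
move=> sn; pose Q i v := (part la i.+1 <= v <= part la i)%N.
have -> : \prod_(i < n) \sum_(part la i.+1 <= v < (part la i).+1) f i v =
    \prod_(i < n) \sum_(v < (psize la).+1 | Q i v) f i v.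
  apply: eq_bigr => i _; rewrite -(big_mkord (Q i)) /Q.
  rewrite [RHS](big_cat_nat (n := part la i.+1)) //=; last first.
    by rewrite ltnW // ltnS part_le_psize.
  rewrite [X in _ = X + _]big_nat_cond [X in _ = X + _]big1 ?add0r; last first.
    by move=> v /andP[/andP[_ h1] /andP[h2 _]]; lia.
  rewrite [RHS](big_cat_nat (n := (part la i).+1)) //=; first last.
  - by rewrite ltnS part_le_psize.
  - by rewrite ltnW // ltnS part_nonincreasing.
  rewrite [X in _ = _ + X]big_nat_cond [X in _ = _ + X]big1 ?addr0; last first.
    by move=> v /andP[/andP[h1 _] /andP[_ h2]]; lia.
  by apply: congr_big_nat => // v /andP[h1 h2]; rewrite h1 -ltnS h2.
rewrite prod_sum_part; last by move=> i v w _ /andP[h1 _] /andP[_ h2]; apply: leq_trans h2 h1.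
have e (k : intpart) : (size k <= n)%N &&
    [forall i : 'I_n, (part k i <= psize la)%N && Q i (part k i)] = hstrip la k.
  apply/andP/hstripP => [[sk /forallP h] i|h].
    have [il|il] := ltnP i n; first by have /andP[_ /andP[h1 h2]] := h (Ordinal il).
    by rewrite !part_default //; lia.
  split; first by rewrite size_leqE -leqn0; have [+ _] := h n; rewrite [part la n]part_default.
  apply/forallP => i; have [h1 h2] := h i; rewrite /Q h1 h2 !andbT.
  exact: leq_trans h1 (part_le_psize _ _).
rewrite -(eq_bigl _ _ e); case: (eqVneq n 0%N) => [n0|n0].
  have la0 : la = empty_intpart.
    by apply: eq_intpart => i; rewrite part_default ?part_empty // (leq_trans sn) // n0.
  by rewrite la0 psize_empty muln0.
rewrite !(eq_bigl _ _ e); apply: big_ple_widen => k hk.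
by have := hstrip_psize hk => h; rewrite h (leq_trans h) // leq_pmull // lt0n.
Qed.

(** Induction on the variables: after a unitriangular row operation each row is a sum over the
    values [v] between two consecutive parts of [la], and multilinearity expands the determinant
    over the horizontal strips of the branching rule. *)
Lemma jacobi_trudi xs la : (size la <= n)%N ->
  \det (jt_matrix xs la) = sk xs la empty_intpart * \det (jt_matrix [::] empty_intpart).
Proof.
elim: xs la => [|x xs IH] la sn.
  rewrite [sk _ _ _]/=; case: eqP => [->|/eqP ne]; first by rewrite mul1r.
  by rewrite mul0r jt_matrix_nil.
(* Subtracts from each row the multiple of the next one that is the boundary term of [hshift_sum];
   the last row has no such term. *)
pose U : 'M[A]_n := \matrix_(i, k) ((i == k)%:R -
  ((k : nat) == i.+1)%:R * x ^+ (part la i - part la i.+1).+1).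
have detU : \det U = 1.
  rewrite -det_tr det_trig; first by apply: big1 => i _; rewrite !mxE eqxx ltn_eqF // mul0r subr0.
  apply/is_trig_mxP => i k ik; rewrite !mxE.
  have -> : (k == i) = false by rewrite -val_eqE /= gtn_eqF.
  by rewrite ltn_eqF ?mul0r ?subr0 // ltnS ltnW.
rewrite -[LHS]mul1r -detU -det_mulmx.
have eM : U *m jt_matrix (x :: xs) la = \matrix_(i, c)
    \sum_(part la i.+1 <= v < (part la i).+1)
      x ^+ (part la i - v) * hshift xs (v + (n - i.+1)) c.
  apply/matrixP => i c; rewrite !mxE hshift_sum; last exact: part_nonincreasing.
  under eq_bigr do rewrite !mxE mulrBl.
  rewrite sumrB (bigD1 i) //= eqxx mul1r big1 ?addr0 => [|k ki]; last first.
    by rewrite eq_sym (negbTE ki) mul0r.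
  congr (_ - _); have [iS|iS] := ltnP i.+1 n; last first.
    have ni : n = i.+1 by apply/eqP; rewrite eqn_leq iS ltn_ord.
    rewrite big1 => [|k _].
      by rewrite part_default; [rewrite {1}ni subnn|rewrite (leq_trans sn)].
    by rewrite ltn_eqF ?mul0r // (leq_trans (ltn_ord k)).
  rewrite (bigD1 (Ordinal iS)) //= eqxx mul1r big1 ?addr0 => [|k ki]; last first.
    by rewrite (negbTE (_ : (k : nat) != i.+1)) ?mul0r.
  have -> : (n - i.+1 = (n - i.+2).+1)%N by rewrite -subSn ?subSS.
  by rewrite addnS.
rewrite eM /determinant.
rewrite (sk_widen _ _ _ (leqnn _)) mulr_suml.
rewrite [RHS](eq_bigr (fun k => \sum_(s : 'S_n) (-1) ^+ s *
    \prod_(i < n) (x ^+ (part la i - part k i) * hshift xs (part k i + (n - i.+1)) (s i)))).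
  rewrite exchange_big /=; apply: eq_bigr => s _; rewrite -mulr_sumr; congr (_ * _).
  have sE (i : 'I_n) : nth 0%N [seq (s j : nat) | j <- enum 'I_n] i = s i.
    by rewrite (nth_map i) ?size_enum_ord // nth_ord_enum.
  pose f i v := x ^+ (part la i - v) *
    hshift xs (v + (n - i.+1)) (nth 0%N [seq (s j : nat) | j <- enum 'I_n] i).
  rewrite [RHS](eq_bigr (fun k => \prod_(i < n) f i (part k i))); last first.
    by move=> k _; apply: eq_bigr => i _; rewrite /f sE.
  rewrite (sum_hstrip_prod f sn); apply: eq_bigr => i _; rewrite mxE.
  by apply: eq_bigr => v _; rewrite /f sE.
move=> k hk.
have skn : (size k <= n)%N.
  by rewrite size_leqE -leqn0 (leq_trans (hstrip_sub hk n)) // part_default.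
rewrite -mulrA -(IH _ skn) /determinant mulr_sumr; apply: eq_bigr => s _.
rewrite big_split /= prodrXr (psizeE sn) (psizeE skn) -sumnB => [|i _]; last exact: hstrip_sub.
rewrite mulrCA; congr (_ * (_ * _)).
by apply: eq_bigr => i _; rewrite mxE.
Qed.

End Determinant.

End JacobiTrudi.

(** Arm plus leg plus one; the cell itself is counted in the second difference. *)
Definition hook la i j : nat := (part la i - j.+1 + (part (conj_intpart la) j - i))%N.

Lemma hook_gt0 la i j : (j < part la i)%N -> (0 < hook la i j)%N.
Proof. by rewrite part_conj /hook; lia. Qed.

(* Induct on [n], truncating the legs at row [n]: the new row [n] turns the hook
   lengths of its first [part la n] columns into the next integers. *)
Lemma hook_row (A : comNzRingType) (phi : nat -> A) la n i :
    (size la <= n)%N -> (i < n)%N ->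
  (\prod_(j < part la i) phi (hook la i j)) *
  \prod_(i.+1 <= k < n) phi (part la i - part la k + (k - i))%N =
  \prod_(m < part la i + (n - i.+1)) phi m.+1.
Proof.
move=> sn lin.
have trunc m : (i < m)%N ->
    (\prod_(j < part la i) phi (part la i - j.+1 + (minn (part (conj_intpart la) j) m - i))%N) *
    \prod_(i.+1 <= k < m) phi (part la i - part la k + (k - i))%N =
    \prod_(k < part la i + (m - i.+1)) phi k.+1.
  elim: m => // m IH; rewrite ltnS leq_eqVlt => /orP[/eqP <-|im].
    rewrite big_geq // mulr1 subnn addn0 (reindex_inj rev_ord_inj) /=.
    apply: eq_bigr => j _; congr phi; have := ltn_ord j => hj.
    have : (i < part (conj_intpart la) (part la i - j.+1))%N by rewrite -part_conj; lia.
    by lia.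
  rewrite big_nat_recr //= mulrA.
  have -> : (part la i + (m.+1 - i.+1) = (part la i + (m - i.+1)).+1)%N by lia.
  rewrite [RHS]big_ord_recr /= -IH // mulrAC [RHS]mulrAC; congr (_ * _).
  have := part_nonincreasing la (ltnW im); set b := part la m => bi.
  rewrite -!(big_mkord xpredT (fun j => phi (part la i - j.+1 +
     (minn (part (conj_intpart la) j) _ - i))%N)).
  rewrite !(big_cat_nat (n := b) (leq0n _) bi) /=.
  rewrite [X in _ * X * _](_ : _ = \prod_(b <= j < part la i)
    phi (part la i - j.+1 + (minn (part (conj_intpart la) j) m - i))%N); last first.
    apply: eq_big_nat => j /andP[bj _]; congr phi.
    have : (part (conj_intpart la) j <= m)%N by rewrite leqNgt -part_conj -leqNgt.
    by lia.
  rewrite mulrAC [RHS]mulrAC; congr (_ * _).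
  pose a := (part la i + (m - i))%N.
  have e1 : \prod_(0 <= j < b) phi (part la i - j.+1 +
      (minn (part (conj_intpart la) j) m.+1 - i))%N = \prod_(0 <= j < b) phi (a - j)%N.
    apply: eq_big_nat => j /andP[_ jb]; congr phi; rewrite /a.
    have : (m < part (conj_intpart la) j)%N by rewrite -part_conj.
    by lia.
  have e2 : \prod_(0 <= j < b) phi (part la i - j.+1 +
      (minn (part (conj_intpart la) j) m - i))%N = \prod_(0 <= j < b) phi (a - j.+1)%N.
    apply: eq_big_nat => j /andP[_ jb]; congr phi; rewrite /a.
    have : (m < part (conj_intpart la) j)%N by rewrite -part_conj.
    by lia.
  rewrite e1 e2; have -> : (part la i - b + (m - i) = a - b)%N by rewrite /a; lia.
  have -> : (part la i + (m - i.+1)).+1 = (a - 0)%N by rewrite /a; lia.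
  by rewrite -(big_nat_recr _ _ (fun j => phi (a - j)%N)) // big_nat_recl // mulrC.
rewrite -trunc //; congr (_ * _); apply: eq_bigr => j _; congr phi.
rewrite /hook (minn_idPl _) //.
have : (size (conj_intpart (conj_intpart la)) <= n)%N by rewrite conj_intpartK.
rewrite size_conj; apply: leq_trans; exact: part_nonincreasing.
Qed.

(** The matrix is a Vandermonde matrix times the matrix of coefficients, which is triangular by the
    bound on the degrees. *)
Lemma det_poly_eval (K : comNzRingType) n (y : 'I_n -> K) (P : 'I_n -> {poly K}) :
    (forall c, (size (P c) <= c.+1)%N) ->
  \det (\matrix_(i, c) (P c).[y i]) =
  (\prod_c (P c)`_c) * \prod_(i < n) \prod_(j < n | (i < j)%N) (y j - y i).
Proof.
move=> sP; pose V := (Vandermonde n (\row_i y i))^T.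
pose M : 'M[K]_n := \matrix_(m, c) (P c)`_m.
have -> : \matrix_(i, c) (P c).[y i] = V *m M.
  apply/matrixP => i c; rewrite !mxE (horner_coef_wide _ (n := n)); last first.
    exact: leq_trans (sP c) (ltn_ord c).
  by apply: eq_bigr => m _; rewrite !mxE mulrC.
rewrite det_mulmx mulrC; congr (_ * _); last first.
  rewrite det_tr det_Vandermonde; apply: eq_bigr => i _; apply: eq_bigr => j _.
  by rewrite !mxE.
rewrite -det_tr det_trig; first by apply: eq_bigr => c _; rewrite !mxE.
apply/is_trig_mxP => i k ik; rewrite !mxE.
by have /leq_sizeP := leq_trans (sP i) ik; apply.
Qed.

(** * Evaluation of the Jacobi-Trudi determinant on a geometric progression *)

Section PrincipalSpecialization.

Variables (K : fieldType) (x p : K).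
Hypotheses (x0 : x != 0) (p0 : p != 0) (p1 : forall m, 1 - p ^+ m.+1 != 0).

Definition qfact m : K := \prod_(k < m) (1 - p ^+ k.+1).

Lemma qfact_neq0 m : qfact m != 0.
Proof. by apply/prodf_neq0 => i _; apply: p1. Qed.

Definition hqshift (l c : nat) : K :=
  if (c <= l)%N then x ^+ (l - c) / qfact (l - c) else 0.

Let P (c : nat) : {poly K} := \prod_(r < c) (1 - p ^- r *: 'X).

Let sizeP c : (size (P c) <= c.+1)%N.
Proof.
elim: c => [|c IH]; first by rewrite /P big_ord0 size_poly1.
rewrite /P big_ord_recr /=; apply: leq_trans (size_polyMleq _ _) _.
have : (size (1 - p ^- c *: 'X : {poly K})%R <= 2)%N.
  apply: leq_trans (size_polyD _ _) _; rewrite geq_max size_poly1 size_polyN /=.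
  by apply: leq_trans (size_scale_leq _ _) _; rewrite size_polyX.
by move: IH; rewrite -/(P c); lia.
Qed.

(** Dividing the q-factorial of [l] by that of [l - c] leaves [c] factors, which form a polynomial
    in [p ^+ l]. Its roots [p ^+ r] with [r < c] account for the entries that are 0, so a single
    formula holds for all [l]. *)
Lemma hqshiftE l c : hqshift l c = x ^+ l / qfact l * x ^- c * (P c).[p ^+ l].
Proof.
rewrite /hqshift horner_prod; case: leqP => cl; last first.
  rewrite (bigD1 (Ordinal cl)) //= hornerD hornerN hornerC hornerZ hornerX.
  by rewrite mulVf ?expf_neq0 // subrr mul0r mulr0.
have -> : \prod_(r < c) (1 - p ^- r *: 'X).[p ^+ l] = \prod_(r < c) (1 - p ^+ (l - r)).
  apply: eq_bigr => r _; rewrite !hornerE; congr (_ - _).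
  have rl : (r <= l)%N := leq_trans (ltnW (ltn_ord r)) cl.
  by rewrite -{1}(subnK rl) exprD mulrC mulfK ?expf_neq0.
have -> : qfact l = qfact (l - c) * \prod_(r < c) (1 - p ^+ (l - r)).
  rewrite -[X in qfact X = _](subnK cl) /qfact big_split_ord /=; congr (_ * _).
  rewrite (reindex_inj rev_ord_inj) /=; apply: eq_bigr => r _.
  by congr (1 - _ ^+ _); have := ltn_ord r; lia.
have n0 : \prod_(r < c) (1 - p ^+ (l - r)) != 0.
  apply/prodf_neq0 => r _; have := ltn_ord r => hr.
  by have -> : (l - r = (l - r.+1).+1)%N by lia.
have -> : x ^+ l = x ^+ (l - c) * x ^+ c by rewrite -exprD subnK.
by field; rewrite ?qfact_neq0 n0 expf_neq0.
Qed.

Variable n : nat.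

Definition hq_matrix la : 'M[K]_n :=
  \matrix_(i, c) hqshift (part la i + (n - i.+1)) c.

(** The hook formula for the Schur function of [x, x p, x p^2, ...]; the exponent of [p] in the
    numerator is the statistic usually written [n(la)]. *)
Definition schur_weight la : K :=
  x ^+ psize la * (\prod_(i < n) p ^+ (i * part la i)) /
  \prod_(i < size la) \prod_(j < part la i) (1 - p ^+ hook la i j).

(** The matrix is polynomial evaluation up to diagonal factors, so its determinant is a Vandermonde
    product. In row [i] this product contains the factors [1 - p^(l_i - l_j)], and [hook_row]
    cancels them against the q-factorial of [l_i], leaving the hooks. *)
Lemma det_hq_matrix la : (size la <= n)%N ->
  \det (hq_matrix la) = schur_weight la * \det (hq_matrix empty_intpart).
Proof.
(* All factors that do not depend on the partition; comparison with the empty partition removes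
   them. *)
pose C := (\prod_(c < n) x ^- c) * (\prod_(c < n) (P c)`_c) *
  (\prod_(i < n) x ^+ (n - i.+1)) *
  \prod_(i < n) \prod_(j < n | (i < j)%N) p ^+ (n - j.+1).
have h mu : (size mu <= n)%N -> \det (hq_matrix mu) = schur_weight mu * C.
  move=> sn; pose l (i : nat) := (part mu i + (n - i.+1))%N.
  have eM : hq_matrix mu = diag_mx (\row_i (x ^+ l i / qfact (l i))) *m
      (\matrix_(i, c) (P c).[p ^+ l i]) *m diag_mx (\row_c x ^- c).
    apply/matrixP => i c; rewrite mul_mx_diag mul_diag_mx !mxE hqshiftE /l.
    by rewrite mulrAC.
  rewrite eM !det_mulmx !det_diag (@det_poly_eval _ _ (fun i : 'I_n => p ^+ l i) (fun c : 'I_n => P c)) //.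
  under eq_bigr do rewrite mxE.
  under [X in _ * X]eq_bigr do rewrite mxE.
  have row (i : 'I_n) : \prod_(j < n | (i < j)%N) (p ^+ l j - p ^+ l i) =
      (\prod_(j < n | (i < j)%N) p ^+ part mu j) *
      (\prod_(j < n | (i < j)%N) p ^+ (n - j.+1)) *
      (qfact (l i) / \prod_(j < part mu i) (1 - p ^+ hook mu i j)).
    have hn0 : \prod_(j < part mu i) (1 - p ^+ hook mu i j) != 0.
      by apply/prodf_neq0 => j _; have := hook_gt0 (ltn_ord j); case: (hook mu i j).
    rewrite /qfact -(hook_row (fun m => 1 - p ^+ m) sn (ltn_ord i)).
    rewrite [_ * _ / _]mulrC mulKf // -big_split /=.
    rewrite big_geq_mkord /= -big_split /=; apply: eq_bigr => j ij.
    rewrite mulrBr mulr1 -!exprD /l; congr (_ - _ ^+ _).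
    have := part_nonincreasing mu (ltnW ij); have := ltn_ord j; lia.
  rewrite (eq_bigr _ (fun i _ => row i)) !big_split /= /schur_weight /C !prodfV.
  have -> : \prod_(i < n) x ^+ l i = x ^+ psize mu * \prod_(i < n) x ^+ (n - i.+1).
    by rewrite (psizeE sn) -prodrXr -big_split; apply: eq_bigr => i _; rewrite exprD.
  have -> : \prod_(i < n) \prod_(j < n | (i < j)%N) p ^+ part mu j =
      \prod_(i < n) p ^+ (i * part mu i).
    rewrite (exchange_big_dep xpredT) //=; apply: eq_bigr => j _.
    rewrite -(big_ord_widen n (fun=> p ^+ part mu j) (ltnW (ltn_ord j))).
    by rewrite prodr_const card_ord -exprM mulnC.
  have -> : \prod_(i < size mu) \prod_(j < part mu i) (1 - p ^+ hook mu i j) =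
      \prod_(i < n) \prod_(j < part mu i) (1 - p ^+ hook mu i j).
    rewrite (big_ord_widen n (fun i => \prod_(j < part mu i) (1 - p ^+ hook mu i j)) sn).
    rewrite big_mkcond; apply: eq_bigr => i _; case: ltnP => // /part_default ->.
    by rewrite big_ord0.
  have F0 : \prod_(i < n) qfact (l i) != 0 by apply/prodf_neq0 => i _; apply: qfact_neq0.
  move: F0; set a1 := \prod_(i < n) qfact (l i); set a2 := \prod_(i < n) \prod_(j < part mu i) _.
  set a3 := \prod_(i < n) \prod_(j < n | _) _; move=> F0.
  move: a2^-1 (\prod_(i < n) x ^+ i)^-1 => b2 b3.
  by field.
move=> sn; rewrite !h // [schur_weight empty_intpart]/schur_weight.
rewrite psize_empty big_ord0 big1 => [|i _]; last by rewrite part_empty muln0.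
by rewrite !mul1r invr1 mul1r.
Qed.

End PrincipalSpecialization.

(** Within a row the arms are a rearrangement of the column indices, and likewise the legs within a
    column. *)
Lemma sum_hook la : (\sum_(i < size la) \sum_(j < part la i) hook la i j =
  \sum_(i < size la) \sum_(j < part la i) (i + j + 1))%N.
Proof.
have arm mu : (\sum_(i < size mu) \sum_(j < part mu i) (part mu i - j.+1) =
    \sum_(i < size mu) \sum_(j < part mu i) j)%N.
  apply: eq_bigr => i _; rewrite (reindex_inj rev_ord_inj) /=.
  by apply: eq_bigr => j _; have := ltn_ord j; lia.
transitivity (\sum_(i < size la) \sum_(j < part la i) (part la i - j.+1) +
  \sum_(i < size la) \sum_(j < part la i) (part (conj_intpart la) j - i.+1) +
  \sum_(i < size la) \sum_(j < part la i) 1)%N.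
  rewrite -!big_split; apply: eq_bigr => i _; rewrite -!big_split; apply: eq_bigr => j _.
  by have := ltn_ord j; rewrite /hook /= part_conj; lia.
rewrite arm (big_cells_conj _ la (fun i j => (part (conj_intpart la) j - i.+1)%N)) arm.
rewrite -(big_cells_conj _ la (fun i j => i)).
rewrite -!big_split; apply: eq_bigr => i _; rewrite -!big_split; apply: eq_bigr => j _.
by rewrite /= [(j + i)%N]addnC.
Qed.

Lemma hook_conj la i j : (j < part la i)%N -> hook (conj_intpart la) j i = hook la i j.
Proof. by rewrite /hook conj_intpartK => h; have := h; rewrite part_conj; lia. Qed.

(** With [p = t ^- 2] the numerators have total exponent [|la| + n(la) + n(la^t)], which by
    [sum_hook] is the sum of the hooks; each cell receives [p^h / (1 - p^h)^2 = (t^h - t^-h)^-2]. *)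
Lemma schur_weight_conj (K : fieldType) (t : K) (t0 : t != 0)
    (t1 : forall m, 1 - (t ^- 2) ^+ m.+1 != 0) la :
  schur_weight t^-1 (t ^- 2) (size la) la *
  schur_weight t^-1 (t ^- 2) (size (conj_intpart la)) (conj_intpart la) =
  \prod_(i < size la) \prod_(j < part la i) (t ^+ hook la i j - t ^- hook la i j) ^- 2.
Proof.
rewrite /schur_weight psize_conj; set p := t ^- 2.
set H := \prod_(i < size la) \prod_(j < part la i) (1 - p ^+ hook la i j).
have -> : \prod_(j < size (conj_intpart la)) \prod_(i < part (conj_intpart la) j)
    (1 - p ^+ hook (conj_intpart la) j i) = H.
  rewrite -(big_cells_conj _ la (fun i j => 1 - p ^+ hook (conj_intpart la) j i)).
  by apply: eq_bigr => i _; apply: eq_bigr => j _; rewrite hook_conj.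
have nE mu : \prod_(i < size mu) p ^+ (i * part mu i) =
    p ^+ (\sum_(i < size mu) \sum_(j < part mu i) i).
  rewrite -prodrXr; apply: eq_bigr => i _.
  by rewrite sum_nat_const card_ord mulnC.
rewrite !nE -(big_cells_conj _ la (fun i j => j)).
have -> : \prod_(i < size la) \prod_(j < part la i)
      (t ^+ hook la i j - t ^- hook la i j) ^- 2 =
    p ^+ (\sum_(i < size la) \sum_(j < part la i) hook la i j) / (H * H).
  rewrite -prodrXr /H -big_split -prodf_div; apply: eq_bigr => i _.
  rewrite -prodrXr -big_split -prodf_div; apply: eq_bigr => j _ /=.
  have tn : t ^+ hook la i j != 0 by rewrite expf_neq0.
  have -> : p ^+ hook la i j = (t ^+ hook la i j) ^- 2.
    by rewrite /p exprVn -exprM mulnC exprM.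
  move: (t ^+ _) tn => T T0.
  have -> : T - T^-1 = T * (1 - T ^- 2).
    by rewrite mulrBr mulr1 expr2 invfM mulrA divff // mul1r.
  by rewrite exprMn invfM [X in _ * X^-1]expr2.
rewrite sum_hook.
have -> : (\sum_(i < size la) \sum_(j < part la i) (i + j + 1) =
  psize la + \sum_(i < size la) \sum_(j < part la i) i +
  \sum_(i < size la) \sum_(j < part la i) j)%N.
  rewrite psize_cells -!big_split; apply: eq_bigr => i _; rewrite -!big_split.
  by apply: eq_bigr => j _ /=; lia.
rewrite !exprD invfM.
have -> : p ^+ psize la = t^-1 ^+ psize la * t^-1 ^+ psize la.
  by rewrite -exprMn -invfM -expr2.
by ring.
Qed.

Lemma inv_expf_neq0 (K : fieldType) (t : K) n : t != 0 -> t ^- n != 0.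
Proof. by move=> t0; rewrite invr_eq0 expf_neq0. Qed.

Lemma qfact_rec (K : fieldType) (t g f : K) k :
    g = t ^ (- (2 * k.+1)%:Z) * g + t ^ (-1) * (t ^- k / f) ->
    1 - (t ^- 2) ^+ k.+1 != 0 ->
  t ^- k.+1 / (f * (1 - (t ^- 2) ^+ k.+1)) = g.
Proof.
rewrite exprVn -exprM -exprnN => e u; apply: (mulIf u).
have -> : g * (1 - t ^- (2 * k.+1)) = t ^ (-1) * (t ^- k / f).
  by rewrite mulrBr mulr1 {1}e [t ^- _ * g]mulrC addrAC subrr add0r.
by rewrite invfM mulrA divfK // exprS invfM -mulrA.
Qed.

Section PrincipalSchur.

Variable R : realType.

Lemma hs_rcons (A : comNzRingType) (x : A) xs k :
  hs (rcons xs x) k.+1 = hs xs k.+1 + x * hs (rcons xs x) k.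
Proof.
have e : hs (rcons xs x) =1 hs (x :: xs).
  move=> m; rewrite -cats1 hs_cat convC (eq_conv (hs_cat [:: x] [::]) (frefl _)) /=.
  by apply: eq_conv => // i; rewrite convC conv1f convC conv1f.
by rewrite !e hs_cons.
Qed.

Local Notation p := (qhalf ^- 2).
Local Notation S la := (skew_schur_q R la empty_intpart empty_intpart).

Lemma qhalf_neq0 : qhalf != 0.
Proof. by rewrite tofrac_eq0 polyX_eq0. Qed.

Lemma qhalf_expr_neq1 m : 1 - p ^+ m.+1 != 0.
Proof.
apply/eqP => e.
have h z : z != 0 -> has_value (1 - p ^+ m.+1) z (1 - z ^- 2 ^+ m.+1 : R[i]).
  move=> z0; apply: has_valueD; first exact: has_value1.
  apply: has_valueN; apply: has_valueXn; apply: has_valueV; last by rewrite expf_neq0.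
  exact: has_valueXn (has_value_qhalf z).
have n2 : (2 : R[i]) != 0 by rewrite pnatr_eq0.
have := h 2 n2; rewrite e => h0; have := has_value_uniq h0 (has_value0 _).
move/subr0_eq/esym/eqP; rewrite exprVn -exprM invr_eq1 pexpr_eq1 // ?ler0n //.
by rewrite (eqr_nat _ 2 1).
Qed.

Lemma lim_valS f (u : R[i] -> nat -> R[i]) :
  lim_val f u -> lim_val f (fun z N => u z N.+1).
Proof.
move=> h z z1; have [w h1 /cvg_regularP h2] := h z z1; exists w => //.
by apply/cvg_regularP => e /h2 [N hN]; exists N => n hn; apply: hN; rewrite ltnW.
Qed.

Lemma lim_val_prod (I : Type) (s : seq I) (f : I -> ratfun) (u : I -> R[i] -> nat -> R[i]) :
    (forall i, lim_val (f i) (u i)) ->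
  lim_val (\prod_(i <- s) f i) (fun z N => \prod_(i <- s) u i z N).
Proof.
move=> h; elim: s => [|i s IH].
  rewrite big_nil; apply: lim_val_eq (lim_val_cst (fun z _ => has_value1 z)) => z _.
  by exists 0%N => N _; rewrite big_nil.
rewrite big_cons; apply: lim_val_eq (lim_valM (h i) IH) => z _.
by exists 0%N => N _; rewrite big_cons.
Qed.

Lemma lim_val_det n (M : 'M[ratfun]_n) (u : R[i] -> nat -> 'M[R[i]]_n) :
    (forall i j, lim_val (M i j) (fun z N => u z N i j)) ->
  lim_val (\det M) (fun z N => \det (u z N)).
Proof.
move=> h; rewrite /determinant.
refine (@lim_val_sum R {perm 'I_n} _ _ _
  (fun s z N => (-1) ^+ s * \prod_i u z N i (s i)) _) => s _.
apply: (@lim_valM _ _ _ (fun _ _ => (-1) ^+ s) (fun z N => \prod_i u z N i (s i))).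
  apply: (@lim_val_cst R _ (fun=> (-1) ^+ s)) => z _; apply: has_valueXn.
  by apply: has_valueN; apply: has_value1.
exact: (@lim_val_prod _ _ _ (fun i z N => u z N i (s i))).
Qed.

(** Pieri over the empty partition writes [h_(k+1)] as a sum of Schur functions, so a rational limit
    [g] exists. Self-similarity then gives [g = q^-(k+1) g + q^(-1/2) h_k], which determines it. *)
Lemma lim_val_hs k : lim_val (qhalf ^- k / qfact p k)
  (fun z N => hs (qalph empty_intpart z N) k : R[i]).
Proof.
elim: k => [|k IH].
  apply: (@lim_val_eq _ _ (fun _ _ => 1)) => [z _|]; first by exists 0%N => N _; rewrite hs0.
  rewrite /qfact big_ord0 divr1 expr0 invr1.
  exact: (@lim_val_cst R 1 (fun=> 1) (fun z _ => has_value1 z)).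
have [g hg] : exists g, lim_val g (fun z N => hs (qalph empty_intpart z N) k.+1 : R[i]).
  exists (\sum_(a <- peq k.+1 | hstrip a empty_intpart) S a).
  apply: (@lim_val_eq _ _ (fun z N => \sum_(a <- peq k.+1 | hstrip a empty_intpart)
    sk (qalph empty_intpart z N) a empty_intpart)) => [z _|].
    by exists 0%N => N _; rewrite -[RHS]mulr1 -(sk_refl (qalph empty_intpart z N) empty_intpart) -pieri.
  apply: (@lim_val_sum R _ _ _ _ (fun a z N => sk (qalph empty_intpart z N) a empty_intpart)).
  by move=> a _; exact: skew_schur_qE.
have e : g = qhalf ^ (- (2 * k.+1)%:Z) * g + qhalf ^ (-1) * (qhalf ^- k / qfact p k).
  apply: lim_val_uniq (lim_valS hg) _.
  apply: lim_val_eq (lim_valD (lim_val_scalar hg _) (lim_val_scalar (lim_valS IH) _)).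
  move=> z /norm_gt1_neq0 z0; exists 0%N => N _.
  rewrite qalphS // hs_rcons hs_scale -qalphS //; congr (_ + _).
    congr (_ * _).
    by rewrite exprVn -exprM exprnN.
suff -> : qhalf ^- k.+1 / qfact p k.+1 = g by [].
rewrite /qfact big_ord_recr /= -/(qfact p k).
exact: (qfact_rec e (qhalf_expr_neq1 k)).
Qed.

Lemma hshift_nil (A : comNzRingType) l c : hshift [::] l c = (c == l)%:R :> A.
Proof.
rewrite /hshift /= /conv1; case: ltngtP => [h|h|->]; rewrite ?subnn //.
by rewrite (_ : (_ == 0%N) = false) //; lia.
Qed.

(** The matrix is the antidiagonal permutation matrix, an involution; so its determinant can be
    cancelled in [jacobi_trudi]. *)
Lemma det_jt_nil (A : comNzRingType) n :
  \det (jt_matrix n [::] empty_intpart : 'M[A]_n) *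
  \det (jt_matrix n [::] empty_intpart : 'M[A]_n) = 1.
Proof.
rewrite -det_mulmx -[RHS](det1 _ n); congr (\det _); apply/matrixP => i c; rewrite !mxE.
under eq_bigr do rewrite !mxE !hshift_nil !part_empty !add0n.
rewrite (bigD1 (rev_ord i)) //= eqxx mul1r big1 ?addr0 => [|m mi]; last first.
  by rewrite (negbTE (_ : (m : nat) != (n - i.+1)%N)) ?mul0r.
by congr (nat_of_bool _)%:R; rewrite -val_eqE /=; have := ltn_ord i; have := ltn_ord c; lia.
Qed.

Lemma skew_schur_q_empty : S empty_intpart = 1.
Proof.
apply: lim_val_uniq (skew_schur_qE _ _ _) _.
apply: lim_val_eq (lim_val_cst (fun z _ => has_value1 z)) => z _.
by exists 0%N => N _; rewrite sk_refl.
Qed.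

(** The limit of Jacobi-Trudi for [la] is divided by that for the empty partition, whose Schur
    function is 1. *)
Lemma skew_schur_q_hook la n : (size la <= n)%N ->
  S la = schur_weight qhalf^-1 p n la.
Proof.
move=> sn; have x0 : qhalf^-1 != 0 by rewrite invr_eq0 qhalf_neq0.
have p0 : p != 0 by apply: (inv_expf_neq0 2 qhalf_neq0).
pose eps : ratfun := \det (jt_matrix n [::] empty_intpart).
have eps0 : eps != 0.
  by apply: contra_eq_neq (det_jt_nil ratfun n) => e; rewrite -/eps e mul0r eq_sym oner_neq0.
have h mu : (size mu <= n)%N -> S mu * eps = \det (hq_matrix qhalf^-1 p n mu).
  move=> smu; apply: (@lim_val_uniq R _ _ (fun z N => \det (jt_matrix n (qalph empty_intpart z N) mu))).
    apply: (@lim_val_eq _ _ (fun z N => sk (qalph empty_intpart z N) mu empty_intpart *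
      \det (jt_matrix n [::] empty_intpart))) => [z _|].
      by exists 0%N => N _; rewrite [RHS]jacobi_trudi.
    apply: lim_valM (skew_schur_qE _ _ _) _.
    apply: (@lim_val_det _ _ (fun _ _ => jt_matrix n [::] empty_intpart)) => i j.
    rewrite !mxE !hshift_nil; apply: (@lim_val_cst R _ (fun=> _)) => z _.
    by case: eqP => _; [apply: has_value1|apply: has_value0].
  apply: lim_val_det => i j; rewrite mxE /hqshift.
  apply: (@lim_val_eq _ _ (fun z N => hshift (qalph empty_intpart z N)
    (part mu i + (n - i.+1)) j)) => [z _|]; first by exists 0%N => N _; rewrite mxE.
  rewrite /hshift; case: ifP => _; last exact: (lim_val_cst (fun z _ => has_value0 z)).
  by rewrite exprVn; apply: lim_val_hs.
have := h la sn; rewrite (det_hq_matrix x0 p0 qhalf_expr_neq1 sn) -h //.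
by rewrite skew_schur_q_empty mul1r; apply: mulIf.
Qed.

Lemma skew_schur_q_conj la : S la * S (conj_intpart la) =
  \prod_(i < size la) \prod_(j < part la i)
     (qhalf ^+ hook la i j - qhalf ^- hook la i j) ^- 2.
Proof.
rewrite (skew_schur_q_hook (leqnn _)) (skew_schur_q_hook (leqnn (size (conj_intpart la)))).
exact: (schur_weight_conj qhalf_neq0 qhalf_expr_neq1).
Qed.

End PrincipalSchur.

(** * Ratios of infinite products *)

(* Division-free telescoping; both sides are products over the same multiset of
   arguments. *)
Lemma staircase_prod (A : comNzRingType) (phi : int -> A) (g : nat -> nat) M N :
    (forall i j, (i <= j)%N -> (g i <= g j)%N) -> (forall i, (g i <= M)%N) ->
  (\prod_(i < N) phi ((g i)%:Z - i%:Z)) * \prod_(m < M) phi m.+1%:Z =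
  (\prod_(m < M) phi (m.+1%:Z - (\sum_(i < N) (g i <= m)%N)%:Z)) *
    \prod_(i < N) phi (M%:Z - i%:Z).
Proof.
move=> gm gM; elim: N => [|N IH].
  rewrite !big_ord0 mul1r mulr1; apply: eq_bigr => m _.
  by rewrite big_ord0 subr0.
rewrite big_ord_recr /= mulrAC IH [X in _ = _ * X]big_ord_recr /=.
rewrite [RHS]mulrA [RHS]mulrAC [LHS]mulrAC; congr (_ * _).
rewrite -!(big_mkord xpredT (fun m => phi (m.+1%:Z - (\sum_(i < _) (g i <= m)%N)%:Z))).
rewrite !(big_cat_nat (n := g N) (leq0n _) (gM N)) /= -!mulrA; congr (_ * _).
  apply: eq_big_nat => m /andP[_ mg]; rewrite big_ord_recr /=.
  by rewrite leqNgt mg /= addn0.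
rewrite (eq_big_nat _ _ (F2 := fun m => phi (m.+1%:Z - N%:Z))); last first.
  move=> m /andP[mg _]; congr (phi (_ - _%:Z)).
  rewrite (eq_bigr (fun=> 1%N)) ?sum1_card ?card_ord // => i _.
  by rewrite (leq_trans _ mg) // gm // ltnW.
rewrite [X in _ = X * _](eq_big_nat _ _ (F2 := fun m => phi (m%:Z - N%:Z))); last first.
  move=> m /andP[mg _]; rewrite big_ord_recr /= mg.
  rewrite (eq_bigr (fun=> 1%N)) ?sum1_card ?card_ord; first by congr phi; lia.
  by move=> i _; rewrite (leq_trans _ mg) // gm // ltnW.
by rewrite -(big_nat_recr _ _ (fun m => phi (m%:Z - N%:Z))) // big_nat_recl // mulrC.
Qed.

Lemma prod_ord_split (A : comNzRingType) (f : nat -> A) m n : (m <= n)%N ->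
  \prod_(i < n) f i = (\prod_(i < m) f i) * \prod_(i < n - m) f (m + i)%N.
Proof.
move=> mn; have [d ->] : exists d, n = (m + d)%N by exists (n - m)%N; rewrite subnKC.
by rewrite addKn big_split_ord.
Qed.

Section NekrasovProduct.

Variables (A : idomainType) (phi : int -> A).
Hypothesis phi0 : forall e, phi e != 0.

(* The exponents of the factors in the two products over the cells of mu and of
   nu that define [sinh_ratio]. *)
Definition arm_leg mu nu (i j : nat) : int :=
  (part mu i)%:Z - j.+1%:Z + (part (conj_intpart nu) j)%:Z - i.+1%:Z + 1.

Definition cells_prod mu nu : A :=
  (\prod_(i < size mu) \prod_(j < part mu i) phi (arm_leg mu nu i j)) *
  \prod_(i < size nu) \prod_(j < part nu i) phi (- arm_leg nu mu i j).

(* The factors of the truncated products without counterpart. *)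
Definition corr_prod mu N : A :=
  \prod_(i < size mu) \prod_(j < part mu i) phi (j%:Z - i%:Z - N%:Z).

Variables (al ga : intpart) (N : nat).
Hypotheses (alN : (size al + part al 0 <= N)%N) (gaN : (size ga + part ga 0 <= N)%N).

Let be := conj_intpart ga.

Let col j m : nat := part (conj_intpart al) (part be m - j.+1).

(** The row is cut at column [part al i]. Before the cut stand the factors of the cells of [al];
    after it the columns are renumbered from 0, and the correction fills the places that the
    renumbering leaves empty at the end, where [ga] vanishes. *)
Let row_split (i : 'I_N) :
  (\prod_(j < N) phi ((part al i)%:Z + (part ga j)%:Z - i%:Z - j%:Z - 1)) *
    \prod_(j < part al i) phi (j%:Z - i%:Z - N%:Z) =
  (\prod_(j < part al i) phi (arm_leg al be i j)) *
  \prod_(j < N) phi ((part ga (part al i + j))%:Z - i%:Z - j%:Z - 1).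
Proof.
have kN : (part al i <= N)%N.
  by have := part_nonincreasing al (leq0n i); lia.
set k := part al i in kN *.
pose F j := phi (k%:Z + (part ga j)%:Z - i%:Z - j%:Z - 1).
pose G j := phi ((part ga (k + j))%:Z - i%:Z - j%:Z - 1).
rewrite -(big_mkord xpredT F) -(big_mkord xpredT G).
rewrite (big_cat_nat (n := k) (leq0n _) kN) /= -mulrA; congr (_ * _).
  rewrite big_mkord; apply: eq_bigr => j _; rewrite /F /arm_leg /be conj_intpartK.
  by congr phi; rewrite -/k; lia.
rewrite [RHS](big_cat_nat (n := (N - k)%N)) ?leq_subr //=; congr (_ * _).
  rewrite -{1}[k]add0n big_addn; apply: eq_big_nat => j _; rewrite /F /G addnC.
  by congr phi; lia.
rewrite -[X in \prod_(X <= _ < _) _]add0n big_addn.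
have -> : (N - (N - k) = k)%N by lia.
rewrite big_mkord (reindex_inj rev_ord_inj) /=; apply: eq_bigr => j _.
rewrite /G [part ga _]part_default; last by have := ltn_ord j; lia.
by congr phi; have := ltn_ord j; lia.
Qed.

(** Down a column the values [part ga (part al i + j)] increase with [i] and are bounded by
    [part ga j], which is the situation of [staircase_prod]. *)
Let col_split (j : 'I_N) :
  (\prod_(i < N) phi ((part ga (part al i + j))%:Z - i%:Z - j%:Z - 1)) *
    \prod_(m < part ga j) phi (m%:Z - j%:Z - N%:Z) =
  (\prod_(m < part ga j) phi (m%:Z - j%:Z - (col j m)%:Z)) *
  \prod_(i < N) phi (- i%:Z - j%:Z - 1).
Proof.
pose g i := part ga (part al i + j).
have gm a b : (a <= b)%N -> (g a <= g b)%N.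
  by move=> ab; rewrite part_nonincreasing // leq_add2r part_nonincreasing.
have gM a : (g a <= part ga j)%N by rewrite part_nonincreasing // leq_addl.
have := staircase_prod (fun e => phi (e - j%:Z - 1)) N gm gM.
set M := part ga j => st.
have MN : (M <= N)%N by have := part_nonincreasing ga (leq0n j); rewrite -/M; lia.
(* The staircase identity carries this product on both sides; it can be cancelled because [phi]
   never vanishes. *)
have P0 : \prod_(m < M) phi (m%:Z - j%:Z) != 0 by apply/prodf_neq0.
apply: (mulIf P0).
have e1 : \prod_(m < M) phi (m.+1%:Z - j%:Z - 1) = \prod_(m < M) phi (m%:Z - j%:Z).
  by apply: eq_bigr => m _; congr phi; lia.
have e2 : \prod_(m < M) phi (m.+1%:Z - (\sum_(i < N) (g i <= m)%N)%:Z - j%:Z - 1) =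
    \prod_(m < M) phi (m%:Z - j%:Z - (col j m)%:Z).
  apply: eq_bigr => m _; congr phi.
  have mM := ltn_ord m; have jb : (j < part be m)%N by rewrite -part_conj.
  (* By conjugation [g i <= m] means [part be m <= part al i + j], that is, row [i] of [al] reaches
     column [part be m - j.+1]. *)
  have -> : (\sum_(i < N) (g i <= m)%N = col j m)%N; last by lia.
  have cN : (col j m <= N)%N.
    have := part_nonincreasing (conj_intpart al) (leq0n (part be m - j.+1)).
    by rewrite -size_conj conj_intpartK /col; lia.
  rewrite -[RHS]card_ord -[RHS]sum1_card (big_ord_widen N (fun=> 1%N) cN) [RHS]big_mkcond.
  apply: eq_bigr => i _; rewrite /col -part_conj /g leqNgt part_conj -/be.
  rewrite (_ : (part be m - j.+1 < part al i)%N = ~~ (part al i + j < part be m)%N).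
    by case: (~~ _).
  by move: jb; lia.
have e3 : \prod_(i < N) phi (M%:Z - i%:Z - j%:Z - 1) * \prod_(m < M) phi (m%:Z - j%:Z - N%:Z) =
    \prod_(m < M) phi (m%:Z - j%:Z) * \prod_(i < N) phi (- i%:Z - j%:Z - 1).
  have s1 : \prod_(i < N) phi (M%:Z - i%:Z - j%:Z - 1) =
      \prod_(m < M) phi (m%:Z - j%:Z) * \prod_(i < N - M) phi (- i%:Z - j%:Z - 1).
    rewrite (prod_ord_split (fun i => phi (M%:Z - i%:Z - j%:Z - 1)) MN); congr (_ * _).
      rewrite (reindex_inj rev_ord_inj) /=; apply: eq_bigr => m _.
      by congr phi; have := ltn_ord m; lia.
    by apply: eq_bigr => i _; congr phi; lia.
  have s2 : \prod_(i < N) phi (- i%:Z - j%:Z - 1) =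
      \prod_(i < N - M) phi (- i%:Z - j%:Z - 1) * \prod_(m < M) phi (m%:Z - j%:Z - N%:Z).
    rewrite (prod_ord_split (fun i => phi (- i%:Z - j%:Z - 1)) (leq_subr M N)) subKn //.
    congr (_ * _); rewrite (reindex_inj rev_ord_inj) /=; apply: eq_bigr => m _.
    by congr phi; have := ltn_ord m; lia.
  by rewrite s1 s2 mulrA.
rewrite mulrAC -{1}e1 -(mulrC (\prod_(m < M) phi (m%:Z - j%:Z - N%:Z))).
transitivity (\prod_(m < M) phi (m%:Z - j%:Z - N%:Z) *
  (\prod_(i < N) phi ((g i)%:Z - i%:Z - j%:Z - 1) * \prod_(m < M) phi (m.+1%:Z - j%:Z - 1))).
  by [].
by rewrite st e2 mulrCA [_ * \prod_(i < N) phi (M%:Z - i%:Z - j%:Z - 1)]mulrC e3; ring.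
Qed.

(** Row splitting extracts the cells of [al] and column splitting those of [ga]. The bounds on [N]
    place both partitions, in either direction, inside the square, so that the remaining factors are
    those of the empty partitions. *)
Lemma nekrasov_prod :
  (\prod_(i < N) \prod_(j < N) phi ((part al i)%:Z + (part ga j)%:Z - i%:Z - j%:Z - 1)) *
    (corr_prod al N * corr_prod ga N) =
  cells_prod al be * \prod_(i < N) \prod_(j < N) phi (- i%:Z - j%:Z - 1).
Proof.
have widen mu (F : nat -> nat -> A) : (size mu <= N)%N ->
    \prod_(i < size mu) \prod_(j < part mu i) F i j =
    \prod_(i < N) \prod_(j < part mu i) F i j.
  move=> sN; rewrite (big_ord_widen N (fun i => \prod_(j < part mu i) F i j)) //.
  rewrite big_mkcond; apply: eq_bigr => i _; case: ltnP => // /part_default ->.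
  by rewrite big_ord0.
have sal : (size al <= N)%N by lia.
have sga : (size ga <= N)%N by lia.
rewrite {1}/corr_prod (widen al (fun i j => phi (j%:Z - i%:Z - N%:Z)) sal).
rewrite mulrA -big_split /= (eq_bigr _ (fun i _ => row_split i)) big_split /=.
rewrite -(widen al (fun i j => phi (arm_leg al be i j)) sal) /cells_prod -!mulrA.
congr (_ * _); rewrite exchange_big /=.
rewrite {1}/corr_prod (widen ga (fun i j => phi (j%:Z - i%:Z - N%:Z)) sga).
rewrite -big_split /= (eq_bigr _ (fun i _ => col_split i)) big_split /=.
rewrite [X in _ = _ * X]exchange_big /=; congr (_ * _).
rewrite -(widen ga (fun j m => phi (m%:Z - j%:Z - (col j m)%:Z)) sga).
rewrite (big_cells_conj _ ga (fun j m => phi (m%:Z - j%:Z - (col j m)%:Z))) -/be.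
(* In [col] the cells of row [m] of [be] are numbered from the end; reversal restores the order of
   [arm_leg]. *)
apply: eq_bigr => m _; rewrite (reindex_inj rev_ord_inj) /=; apply: eq_bigr => j _.
congr phi; rewrite /arm_leg /col; have hj : (j < part be m)%N := ltn_ord j.
rewrite (_ : (part be m - (part be m - j.+1).+1)%N = j); last by move: hj; lia.
by rewrite -subzn //; ring.
Qed.

End NekrasovProduct.

(** * Cauchy products in the limit *)

Local Open Scope classical_set_scope.

Section LimPoly.

Variable R : realType.

Definition lim_poly (P : {poly ratfun}) (u : R[i] -> nat -> {poly R[i]}) : Prop :=
  forall k, lim_val P`_k (fun z N => (u z N)`_k).

Lemma lim_polyM P Q u v : lim_poly P u -> lim_poly Q v ->
  lim_poly (P * Q) (fun z N => u z N * v z N).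
Proof.
move=> hP hQ k; rewrite coefM.
apply: (@lim_val_eq _ _ (fun z N => \sum_(i < k.+1) (u z N)`_i * (v z N)`_(k - i))).
  by move=> z _; exists 0%N => N _; rewrite coefM.
refine (@lim_val_sum R 'I_k.+1 _ _ _ (fun i z N => (u z N)`_i * (v z N)`_(k - i)) _) => i _.
exact: lim_valM (hP i) (hQ (k - i)%N).
Qed.

Lemma lim_poly1 : lim_poly 1 (fun _ _ => 1).
Proof.
move=> k; rewrite coef1; apply: (@lim_val_cst R _ (fun=> (1 : {poly R[i]})`_k)) => z _.
by rewrite coef1; case: eqP => _; [apply: has_value1|apply: has_value0].
Qed.

Lemma lim_poly_prod (I : Type) (s : seq I) (P : I -> {poly ratfun})
    (u : I -> R[i] -> nat -> {poly R[i]}) :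
    (forall i, lim_poly (P i) (u i)) ->
  lim_poly (\prod_(i <- s) P i) (fun z N => \prod_(i <- s) u i z N).
Proof.
move=> h; elim: s => [|i s IH].
  move=> k; rewrite big_nil; apply: lim_val_eq (lim_poly1 k) => z _.
  by exists 0%N => N _; rewrite big_nil.
move=> k; rewrite big_cons; apply: lim_val_eq (lim_polyM (h i) IH k) => z _.
by exists 0%N => N _; rewrite big_cons.
Qed.

Definition linfac (K : fieldType) (c : K) : {poly K} := 1 - c *: 'X.

Lemma linfac_neq0 (K : fieldType) (c : K) : linfac c != 0.
Proof.
apply/eqP => /(congr1 (fun p : {poly K} => p`_0)) /eqP.
by rewrite coefB coefZ coefX coef1 coef0 mulr0 subr0 oner_eq0.
Qed.

Lemma lim_linfac f u : lim_val f u -> lim_poly (linfac f) (fun z N => linfac (u z N)).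
Proof.
move=> h k.
apply: (@lim_val_eq _ _ (fun z N => (1 : {poly R[i]})`_k + (- 'X : {poly R[i]})`_k * u z N)).
  move=> z _; exists 0%N => N _.
  by rewrite coefB coefZ coefN mulrC mulrN.
rewrite coefB coefZ mulrC -mulNr -coefN; apply: lim_valD; first exact: lim_poly1.
apply: lim_valM h; apply: (@lim_val_cst R _ (fun=> (- 'X : {poly R[i]})`_k)) => z _.
rewrite !coefN !coefX; apply: has_valueN.
by case: eqP => _; [apply: has_value1|apply: has_value0].
Qed.

(** The reason why the factors of [corr_prod] tend to 1: each is [1 - q^(e - N) X]. *)
Lemma lim_val_vanish (e : int) : lim_val 0 (fun z N => z ^ (2 * (e - N%:Z)) : R[i]).
Proof.
move=> z z1; exists 0; first exact: has_value0.
have z0 := norm_gt1_neq0 z1.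
have c1 : `|z ^- 2| < 1.
  by rewrite normfV normrX invf_lt1 ?exprn_gt0 ?(lt_trans ltr01) // exprn_egt1.
have -> : (fun N : nat => z ^ (2 * (e - N%:Z)) : R[i]^o) =
    (fun N => z ^ (2 * e) * z ^- 2 ^+ N : R[i]^o).
  apply: funext => N.
  by rewrite mulrBr expfzDr // exprVn -exprM exprnN; congr (_ * _ ^ _); lia.
rewrite -[X in _ --> X](mulr0 (z ^ (2 * e))); apply: cvgM_regular (cvg_expC c1).
exact: cvg_cst.
Qed.

(** The factor [1 - q^e X] with [t = q^(1/2)]; the variable [X] will become a monomial in the edge
    variables. *)
Definition qfac (K : fieldType) (t : K) (e : int) : {poly K} := linfac (t ^ (2 * e)).

Lemma qfac_neq0 (K : fieldType) (t : K) e : qfac t e != 0.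
Proof. exact: linfac_neq0. Qed.

Lemma lim_qfac e : lim_poly (qfac qhalf e) (fun z _ => qfac z e).
Proof. exact (@lim_linfac _ (fun z _ => z ^ (2 * e)) (lim_val_qhalf (2 * e))). Qed.

Lemma lim_poly_cells mu (f : nat -> nat -> {poly ratfun})
    (u : nat -> nat -> R[i] -> nat -> {poly R[i]}) :
    (forall i j, lim_poly (f i j) (u i j)) ->
  lim_poly (\prod_(i < size mu) \prod_(j < part mu i) f i j)
    (fun z N => \prod_(i < size mu) \prod_(j < part mu i) u i j z N).
Proof.
move=> h; refine (@lim_poly_prod 'I_(size mu) _ _
  (fun i z N => \prod_(j < part mu i) u i j z N) _) => i.
exact: (@lim_poly_prod 'I_(part mu i) _ _ (fun j z N => u i j z N)).
Qed.

Lemma lim_cells mu nu : lim_poly (cells_prod (qfac qhalf) mu nu)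
  (fun z _ => cells_prod (qfac z) mu nu).
Proof.
apply: (@lim_polyM _ _
  (fun z _ => \prod_(i < size mu) \prod_(j < part mu i) qfac z (arm_leg mu nu i j))
  (fun z _ => \prod_(i < size nu) \prod_(j < part nu i) qfac z (- arm_leg nu mu i j))).
  refine (@lim_poly_cells _ (fun i j => qfac qhalf (arm_leg mu nu i j))
    (fun i j z _ => qfac z (arm_leg mu nu i j)) _) => i j.
  exact: lim_qfac.
refine (@lim_poly_cells _ (fun i j => qfac qhalf (- arm_leg nu mu i j))
  (fun i j z _ => qfac z (- arm_leg nu mu i j)) _) => i j.
exact: lim_qfac.
Qed.

Lemma lim_corr mu : lim_poly 1 (fun z N => corr_prod (qfac z) mu N).
Proof.
have -> : 1 = \prod_(i < size mu) \prod_(j < part mu i) (1 : {poly ratfun}).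
  by rewrite big1 // => i _; rewrite big1.
apply: (@lim_poly_cells _ (fun _ _ => 1) (fun i j z N => qfac z (j%:Z - i%:Z - N%:Z))) => i j.
have -> : 1 = linfac (0 : ratfun) by rewrite /linfac scale0r subr0.
exact: (@lim_linfac _ (fun z N => z ^ (2 * (j%:Z - i%:Z - N%:Z))) (lim_val_vanish _)).
Qed.

End LimPoly.

Section CauchyLimits.

Variable R : realType.
Local Notation S := (skew_schur_q R).

(** The coefficient of [X^k] in the product of [1 / (1 - x y X)] over [x] in [q^(al + rho)] and [y]
    in [q^(ga + rho)]. *)
Definition cauchy_coef al ga k : ratfun :=
  \sum_(a <- peq k) S a empty_intpart al * S a empty_intpart ga.

(** With this sign the product has factors [1 - x y X] and is inverse to the series of
    [cauchy_coef]. *)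
Definition dual_cauchy_coef al ga k : ratfun :=
  (-1) ^+ k * \sum_(a <- peq k) S a empty_intpart al * S (conj_intpart a) empty_intpart ga.

Definition pairs (A : comNzRingType) (xs ys : seq A) := [seq x * y | y <- ys, x <- xs].

Lemma lim_cauchy_coef al ga k :
  lim_val (cauchy_coef al ga k)
    (fun z N => hs (pairs (qalph al z N) (qalph ga z N)) k : R[i]).
Proof.
apply: (@lim_val_eq _ _ (fun z N => \sum_(a <- peq k)
    sk (qalph al z N) a empty_intpart * sk (qalph ga z N) a empty_intpart)).
  move=> z _; exists 0%N => N _.
  by rewrite (cauchy_sum _ _ empty_intpart k) sk_refl mulr1.
refine (@lim_val_sum R _ _ _ _ (fun a z N =>
    sk (qalph al z N) a empty_intpart * sk (qalph ga z N) a empty_intpart) _) => a _.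
by apply: lim_valM; apply: skew_schur_qE.
Qed.

Lemma cauchy_q al ga mu k :
  \sum_(a <- peq (psize mu + k)) S a empty_intpart al * S a mu ga =
  cauchy_coef al ga k * S mu empty_intpart al.
Proof.
have h := lim_valM (lim_cauchy_coef al ga k) (skew_schur_qE mu empty_intpart al).
apply/esym; refine (lim_val_uniq h _).
apply: (@lim_val_eq _ _ (fun z N => \sum_(a <- peq (psize mu + k))
    sk (qalph al z N) a empty_intpart * sk (qalph ga z N) a mu)).
  by move=> z _; exists 0%N => N _; rewrite cauchy_sum.
refine (@lim_val_sum R _ _ _ _ (fun a z N =>
    sk (qalph al z N) a empty_intpart * sk (qalph ga z N) a mu) _) => a _.
by apply: lim_valM; apply: skew_schur_qE.
Qed.

Definition pair_poly (A : comNzRingType) (xs ys : seq A) : {poly A} :=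
  \prod_(x <- pairs xs ys) (1 - x *: 'X).

Lemma pair_polyE (A : comNzRingType) (xs ys : seq A) k :
  (pair_poly xs ys)`_k = (-1) ^+ k * (es_poly (pairs xs ys))`_k.
Proof.
rewrite -es_poly_scale /pair_poly /es_poly big_map; congr (polyseq _)`_k.
by elim: (pairs xs ys) => [|x s IH]; rewrite ?big_nil // !big_cons IH mulN1r scaleNr.
Qed.

Lemma lim_dual_cauchy_coef al ga k :
  lim_val (dual_cauchy_coef al ga k)
    (fun z N => (pair_poly (qalph al z N) (qalph ga z N))`_k : R[i]).
Proof.
apply: (@lim_val_eq _ _ (fun z N => (-1) ^+ k * \sum_(a <- peq k)
    sk (qalph al z N) a empty_intpart * sk (qalph ga z N) (conj_intpart a) empty_intpart)).
  by move=> z _; exists 0%N => N _; rewrite pair_polyE dual_cauchy_sum.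
apply: lim_valM.
  apply: (@lim_val_cst R _ (fun=> (-1) ^+ k)) => z _; apply: has_valueXn.
  by apply: has_valueN; apply: has_value1.
refine (@lim_val_sum R _ _ _ _ (fun a z N =>
    sk (qalph al z N) a empty_intpart * sk (qalph ga z N) (conj_intpart a) empty_intpart) _) => a _.
by apply: lim_valM; apply: skew_schur_qE.
Qed.

Lemma lim_val_conv f g (u v : R[i] -> nat -> nat -> R[i]) k :
    (forall j, lim_val (f j) (fun z N => u z N j)) ->
    (forall j, lim_val (g j) (fun z N => v z N j)) ->
  lim_val (conv f g k) (fun z N => conv (u z N) (v z N) k).
Proof.
move=> hf hg.
refine (@lim_val_sum R 'I_k.+1 _ _ _ (fun i z N => u z N i * v z N (k - i)%N) _) => i _.
exact: lim_valM (hf i) (hg (k - i)%N).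
Qed.

Lemma conv_cauchy_dual al ga : conv (cauchy_coef al ga) (dual_cauchy_coef al ga) =1 conv1 ratfun.
Proof.
move=> k; apply: lim_val_uniq (lim_val_conv k (lim_cauchy_coef al ga) (lim_dual_cauchy_coef al ga)) _.
apply: (@lim_val_eq _ _ (fun _ _ => conv1 R[i] k)) => [z _|].
  by exists 0%N => N _; rewrite hs_es.
apply: (@lim_val_cst R _ (fun=> conv1 R[i] k)) => z _; rewrite /conv1.
by case: eqP => _; [apply: has_value1|apply: has_value0].
Qed.

Lemma pair_poly_qalph al ga (z : R[i]) N : z != 0 ->
  pair_poly (qalph al z N) (qalph ga z N) = \prod_(i < N) \prod_(j < N)
    qfac z ((part al i)%:Z + (part ga j)%:Z - i%:Z - j%:Z - 1).
Proof.
move=> z0; rewrite /pair_poly /pairs big_allpairs_dep.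
have rm (F : R[i] -> {poly R[i]}) nu : \prod_(x <- qalph nu z N) F x =
    \prod_(i < N) F (qrho nu z i).
  rewrite (perm_big (mkseq (qrho nu z) N)) ?perm_rev //.
  by rewrite /mkseq big_map -{1}[N]subn0 -/(index_iota 0 N) big_mkord.
rewrite rm exchange_big /= rm; apply: eq_bigr => i _; apply: eq_bigr => j _.
by rewrite /qfac /linfac /qrho -expfzDr //; congr (1 - _ ^ _ *: _); lia.
Qed.

(** The limit of [nekrasov_prod], in which both corrections become 1. It is stated as a multiple of
    the product for empty partitions, the common factor that cancels in the instanton part. *)
Lemma dual_cauchy_coef_nekrasov al ga :
  dual_cauchy_coef al ga =1
  conv (fun k => (cells_prod (qfac qhalf) al (conj_intpart ga))`_k)
       (dual_cauchy_coef empty_intpart empty_intpart).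
Proof.
move=> k; set Num := cells_prod _ _ _.
have h1 : lim_val (conv (dual_cauchy_coef al ga) (fun j => (1 * 1 : {poly ratfun})`_j) k)
    (fun (z : R[i]) N => (pair_poly (qalph al z N) (qalph ga z N) *
       (corr_prod (qfac z) al N * corr_prod (qfac z) ga N))`_k).
  apply: (@lim_val_eq _ _ (fun z N => conv
      (fun j => (pair_poly (qalph al z N) (qalph ga z N))`_j)
      (fun j => (corr_prod (qfac z) al N * corr_prod (qfac z) ga N)`_j) k)).
    by move=> z _; exists 0%N => N _; rewrite coefM_conv.
  apply: (lim_val_conv (u := fun z N j => (pair_poly (qalph al z N) (qalph ga z N))`_j)
    (v := fun z N j => (corr_prod (qfac z) al N * corr_prod (qfac z) ga N)`_j)).
    exact: lim_dual_cauchy_coef.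
  exact (lim_polyM (lim_corr al) (lim_corr ga)).
have h2 : lim_val (conv (fun j => Num`_j) (dual_cauchy_coef empty_intpart empty_intpart) k)
    (fun (z : R[i]) N => (cells_prod (qfac z) al (conj_intpart ga) *
       pair_poly (qalph empty_intpart z N) (qalph empty_intpart z N))`_k).
  apply: (@lim_val_eq _ _ (fun z N => conv
      (fun j => (cells_prod (qfac z) al (conj_intpart ga))`_j)
      (fun j => (pair_poly (qalph empty_intpart z N) (qalph empty_intpart z N))`_j) k)).
    by move=> z _; exists 0%N => N _; rewrite coefM_conv.
  apply: (lim_val_conv (u := fun z _ j => (cells_prod (qfac z) al (conj_intpart ga))`_j)
    (v := fun z N j => (pair_poly (qalph empty_intpart z N) (qalph empty_intpart z N))`_j)).
    exact: lim_cells.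
  exact: lim_dual_cauchy_coef.
have {h1} h1 := @lim_val_eq _ _ _ (fun z N => (cells_prod (qfac z) al (conj_intpart ga) *
   pair_poly (qalph empty_intpart z N) (qalph empty_intpart z N))`_k) _ h1.
have := lim_val_uniq (h1 _) h2; rewrite mulr1 => <-.
- rewrite convC (eq_conv (g' := dual_cauchy_coef al ga) (f' := conv1 ratfun)) ?conv1f // => j.
  by rewrite coef1.
(* From this [N] on, the truncated squares contain both partitions; smaller [N] do not affect a
   limit. *)
- move=> z /norm_gt1_neq0 z0; exists (maxn (size al + part al 0) (size ga + part ga 0))%N => N.
  rewrite geq_max => /andP[n1 n2]; rewrite !pair_poly_qalph //.
  rewrite (nekrasov_prod (@qfac_neq0 _ z) n1 n2); congr (polyseq (_ * _))`_k.
  by apply: eq_bigr => i _; apply: eq_bigr => j _; rewrite !part_empty !add0r.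
Qed.

End CauchyLimits.

(** * The ring of formal power series *)

(** Such a sum is 0 by convention when the support is infinite; a list containing the support
    excludes this and computes the value. *)
Lemma fsum_list (T : choiceType) (V : nmodType) (A : set T) (r : seq T) (P : pred T)
    (F : T -> V) :
    uniq r -> (forall x, x \in r -> P x -> A x) ->
    (forall x, A x -> F x != 0 -> (x \in r) && P x) ->
  \sum_(x \in A) F x = \sum_(x <- r | P x) F x.
Proof.
move=> ur rA Ar; rewrite (fsbigE [seq x <- r | P x]) ?filter_uniq //.
- rewrite big_seq_cond -[RHS]big_filter [RHS]big_seq; apply: eq_bigl => x.
  rewrite andb_idr // => h; rewrite inE; move: h; rewrite mem_filter => /andP[Px xr].
  exact: rA.
- by move=> x /=; rewrite mem_filter => /andP[Px xr]; exact: rA.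
- move=> x Ax; rewrite mem_filter andbC; apply: contraNeq => h.
  exact: Ar.
Qed.

Section SeriesProduct.

Variables (n : nat) (K : fieldType).
Implicit Types (f g h : mseries n K) (d p : multinom n).

Lemma mseries_mulE k f g d : (mdeg d < k)%N -> mseries_mul f g d =
  \sum_(c : bmultinom n k * bmultinom n k | d == mnm_add c.1 c.2) f c.1 * g c.2.
Proof.
move=> dk; pose v (c : bmultinom n k * bmultinom n k) := (bmnm c.1, bmnm c.2).
have vi : injective v.
  by move=> [a b] [a' b'] [e1 e2]; congr (_, _); apply: val_inj.
rewrite /mseries_mul (fsum_list
  (r := [seq v c | c <- enum {: bmultinom n k * bmultinom n k}])
  (P := fun p : multinom n * multinom n => d == mnm_add p.1 p.2)).
- by rewrite big_map big_enum_cond.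
- by rewrite map_inj_uniq ?enum_uniq.
- by move=> x _ /= /eqP.
- move=> [a b] /= e _; rewrite e eqxx andbT.
  have ha : (mdeg a < k)%N by rewrite (leq_ltn_trans _ dk) // -e mdegD leq_addr.
  have hb : (mdeg b < k)%N by rewrite (leq_ltn_trans _ dk) // -e mdegD leq_addl.
  by apply/mapP; exists (BMultinom ha, BMultinom hb); rewrite ?mem_enum.
Qed.

(** A coefficient of a product of series involves only lower degrees, so the ring laws come from
    polynomials. *)
Definition truncation k f : mpoly n K := \sum_(m : bmultinom n k) f m *: mpolyX K m.

Lemma mcoeff_truncation k f d : (mdeg d < k)%N -> mcoeff d (truncation k f) = f d.
Proof. exact: mcoeff_mpoly. Qed.

Lemma eq_mcoeffM (p p' q q' : mpoly n K) d :
    (forall c, (mdeg c <= mdeg d)%N -> mcoeff c p = mcoeff c p') ->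
    (forall c, (mdeg c <= mdeg d)%N -> mcoeff c q = mcoeff c q') ->
  mcoeff d (p * q) = mcoeff d (p' * q').
Proof.
move=> hp hq; rewrite !mcoeffM; apply: eq_bigr => k _.
by rewrite hp ?hq // -ltnS bmdeg.
Qed.

Lemma mseries_mul_trunc k f g d : (mdeg d < k)%N ->
  mseries_mul f g d = mcoeff d (truncation k f * truncation k g).
Proof.
move=> dk; rewrite (mseries_mulE _ _ (ltnSn _)) mcoeffM; apply: eq_bigr => c _.
by rewrite !mcoeff_truncation // (leq_trans (bmdeg _)).
Qed.

Lemma eq_mseries_mul f f' g g' d :
    (forall c, (mdeg c <= mdeg d)%N -> f c = f' c) ->
    (forall c, (mdeg c <= mdeg d)%N -> g c = g' c) ->
  mseries_mul f g d = mseries_mul f' g' d.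
Proof.
move=> hf hg; rewrite !(mseries_mulE _ _ (ltnSn _)); apply: eq_bigr => k _.
by rewrite hf ?hg // -ltnS bmdeg.
Qed.

Lemma truncation_mul k f g d : (mdeg d < k)%N ->
  mcoeff d (truncation k (mseries_mul f g)) = mcoeff d (truncation k f * truncation k g).
Proof. by move=> dk; rewrite mcoeff_truncation // (mseries_mul_trunc _ _ dk). Qed.

Lemma mseries_mulA : associative (@mseries_mul n K).
Proof.
move=> f g h; apply: funext => d; have dk := ltnSn (mdeg d).
rewrite !(mseries_mul_trunc _ _ dk).
have e1 := @eq_mcoeffM (truncation (mdeg d).+1 f) (truncation (mdeg d).+1 f)
  _ (truncation (mdeg d).+1 g * truncation (mdeg d).+1 h) d (fun _ _ => erefl)
  (fun c hc => @truncation_mul (mdeg d).+1 g h c hc).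
have e2 := @eq_mcoeffM _ (truncation (mdeg d).+1 f * truncation (mdeg d).+1 g)
  (truncation (mdeg d).+1 h) (truncation (mdeg d).+1 h) d
  (fun c hc => @truncation_mul (mdeg d).+1 f g c hc) (fun _ _ => erefl).
by rewrite e1 e2 mulrA.
Qed.

Lemma mseries_mulC : commutative (@mseries_mul n K).
Proof.
move=> f g; apply: funext => d; have dk := ltnSn (mdeg d).
by rewrite !(mseries_mul_trunc _ _ dk) mulrC.
Qed.

Definition mseries1 : mseries n K := fun d => (d == mnm0)%:R.

Lemma mseries_mul1 : left_id mseries1 (@mseries_mul n K).
Proof.
move=> f; apply: funext => d; have dk := ltnSn (mdeg d).
rewrite (mseries_mul_trunc _ _ dk) -(mcoeff_truncation f dk).
rewrite -[in RHS](mul1r (truncation (mdeg d).+1 f)).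
apply: eq_mcoeffM => // c hc; rewrite mcoeff_truncation ?ltnS //.
by rewrite mcoeff1.
Qed.

Lemma mseries_mulDl f f' g d :
  mseries_mul (fun c => f c + f' c) g d = mseries_mul f g d + mseries_mul f' g d.
Proof.
rewrite !(mseries_mulE _ _ (ltnSn _)) -big_split /=; apply: eq_bigr => k _; exact: mulrDl.
Qed.

End SeriesProduct.

(** An alias of [mseries] that carries the ring structure, with [mseries_mul] as its product by
    definition. *)
Definition pser (n : nat) (K : fieldType) : Type := mseries n K.

Section SeriesRing.

Variables (n : nat) (K : fieldType).

HB.instance Definition _ := GRing.Zmodule.copy (pser n K) (multinom n -> K).

Fact pser_mulDl : left_distributive (@mseries_mul n K : pser n K -> pser n K -> pser n K) +%R.
Proof. by move=> f g h; apply: funext => d; exact: mseries_mulDl. Qed.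

Fact pser_oner_neq0 : (@mseries1 n K : pser n K) != 0.
Proof.
apply/eqP => /(congr1 (fun f : pser n K => f mnm0)) /eqP.
by rewrite /mseries1 eqxx /= oner_eq0.
Qed.

HB.instance Definition _ := GRing.Zmodule_isComNzRing.Build (pser n K)
  (@mseries_mulA n K) (@mseries_mulC n K) (@mseries_mul1 n K) pser_mulDl pser_oner_neq0.

Implicit Types (f g h : pser n K) (d p : multinom n).

Lemma pserD f g d : (f + g) d = f d + g d. Proof. by []. Qed.
Lemma pserN f d : (- f) d = - f d. Proof. by []. Qed.
Lemma pser1 d : (1 : pser n K) d = (d == mnm0)%:R. Proof. by []. Qed.
Lemma pserM f g : f * g = mseries_mul f g. Proof. by []. Qed.

Lemma pser_sum (I : Type) (s : seq I) (P : pred I) (f : I -> pser n K) d :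
  (\sum_(i <- s | P i) f i) d = \sum_(i <- s | P i) f i d.
Proof. exact: (big_morph (fun f : pser n K => f d)). Qed.

Lemma pserM_trunc f g g' d : (forall c, (mdeg c <= mdeg d)%N -> g c = g' c) ->
  (f * g) d = (f * g') d.
Proof. by move=> h; apply: eq_mseries_mul. Qed.

Lemma pserX_order (u : pser n K) k d : u mnm0 = 0 -> (mdeg d < k)%N -> (u ^+ k) d = 0.
Proof.
move=> u0; elim: k d => // k IH d dk.
rewrite exprS pserM (mseries_mulE _ _ dk) big1 // => -[a b] /= /eqP e.
case: (eqVneq (bmnm a) mnm0) => [->|c1]; first by rewrite u0 mul0r.
rewrite -mdeg_eq0 -lt0n in c1; rewrite [X in _ * X]IH ?mulr0 //.
by move: dk; rewrite e mdegD ltnS; apply: leq_trans; rewrite -[X in (X < _)%N]add0n ltn_add2r.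
Qed.

Lemma pserM0 f g : (f * g) mnm0 = f mnm0 * g mnm0.
Proof.
have h : (mdeg (@mnm0 n) < 1)%N by rewrite mdeg0.
rewrite pserM (mseries_mulE _ _ h).
rewrite (bigD1 (BMultinom h, BMultinom h)) /=; last by rewrite addm0.
rewrite big1 ?addr0 // => -[a b] /= /andP[/eqP/esym/eqP].
rewrite mnmD_eq0 => /andP[/eqP ea /eqP eb] /eqP[]; congr (_, _); exact: val_inj.
Qed.

(* The geometric series. *)
Lemma pser_inv f : f mnm0 = 1 -> exists g, f * g = 1.
Proof.
move=> f0; pose u : pser n K := 1 - f.
have u0 : u mnm0 = 0 by rewrite /u pserD pserN pser1 eqxx f0 subrr.
exists (fun d => \sum_(i < (mdeg d).+1) (u ^+ i) d : K).
apply: funext => d.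
rewrite (@pserM_trunc _ _ (\sum_(i < (mdeg d).+1) u ^+ i)) => [|c cd].
  have -> : f = 1 - u by rewrite /u opprB addrC subrK.
  rewrite -[1 - u]opprB mulNr -subrX1 opprB pserD pserN pserX_order ?subr0 //.
rewrite pser_sum (big_ord_widen _ (fun i => (u ^+ i) c) (cd : ((mdeg c).+1 <= (mdeg d).+1)%N)).
rewrite big_mkcond; apply: eq_bigr => i _; case: ltnP => // h.
by rewrite pserX_order.
Qed.

(** The equation defining the quotient has a single solution when [g] is invertible, so [xget]
    returns it. *)
Lemma mseries_divE f g h : g * h = 1 -> mseries_div f g = f * h.
Proof.
move=> gh; rewrite /mseries_div; apply: xget_unique => /=.
  by rewrite -!pserM -mulrA [h * g]mulrC gh mulr1.
by move=> y <-; rewrite -pserM -mulrA gh mulr1.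
Qed.

(* The series [\sum_k u_k m^k]. *)
Definition at_mono (m : multinom n) (u : nat -> K) : pser n K :=
  fun d => \sum_(k < (mdeg d).+1) if d == mnm_muln m k then u k else 0.

Lemma at_mono_widen m u d N : m != mnm0 -> (mdeg d <= N)%N ->
  at_mono m u d = \sum_(k < N.+1) if d == mnm_muln m k then u k else 0.
Proof.
move=> m0 dN; rewrite /at_mono.
rewrite (big_ord_widen N.+1 (fun k => if d == mnm_muln m k then u k else 0)) //.
rewrite big_mkcond; apply: eq_bigr => k _; case: ltnP => // h.
case: eqP => // e; move: h; rewrite e mdegMn ltnNge leq_pmull // lt0n.
by rewrite mdeg_eq0.
Qed.

Lemma at_monoM_coef m u f d N : m != mnm0 -> (mdeg d <= N)%N -> (at_mono m u * f) d =
  \sum_(k < N.+1 | lem (mnm_muln m k) d) u k * f (mnm_sub d (mnm_muln m k)).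
Proof.
move=> m0 dN; rewrite pserM (mseries_mulE _ _ (dN : (mdeg d < N.+1)%N)).
have wid (c : bmultinom n N.+1) : at_mono m u c =
    \sum_(k < N.+1) if bmnm c == mnm_muln m k then u k else 0.
  by apply: at_mono_widen => //; rewrite -ltnS bmdeg.
under eq_bigr do rewrite wid mulr_suml.
rewrite exchange_big /= [RHS]big_mkcond; apply: eq_bigr => k _; case: ifP => lk.
  have e : mnm_add (mnm_sub d (mnm_muln m k)) (mnm_muln m k) = d by apply: submK.
  have h1 : (mdeg (mnm_muln m k) < N.+1)%N.
    by rewrite ltnS (leq_trans _ dN) // -[X in (_ <= mdeg X)%N]e mdegD leq_addl.
  have h2 : (mdeg (mnm_sub d (mnm_muln m k)) < N.+1)%N.
    by rewrite ltnS (leq_trans _ dN) // mdegB.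
  rewrite (bigD1 (BMultinom h1, BMultinom h2)) /=; last by rewrite addmC e.
  rewrite eqxx big1 ?addr0 // => -[a b] /= /andP[/eqP ed ne]; case: eqP => ea; last by rewrite mul0r.
  case/eqP: ne; congr (_, _); apply: val_inj => //=.
  by rewrite ed ea addmC addmK.
rewrite big1 // => -[a b] /= /eqP ed; case: eqP => ea; last by rewrite mul0r.
by case/negP: (negbT lk); rewrite ed ea; apply: lem_addr.
Qed.

Lemma at_mono_conv1 m : m != mnm0 -> at_mono m (conv1 K) = 1.
Proof.
move=> m0; apply: funext => d; rewrite pser1 /at_mono big_ord_recl mulm0n big1 ?addr0.
  by rewrite /conv1; case: ifP.
by move=> k _; rewrite /conv1 /= if_same.
Qed.

Lemma eq_at_mono m u v : u =1 v -> at_mono m u = at_mono m v.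
Proof. by move=> e; congr at_mono; apply: funext. Qed.

(** Substitution of a nonconstant monomial is multiplicative: its powers are distinct, so no
    coefficients are merged. *)
Lemma at_monoM m u v : m != mnm0 -> at_mono m u * at_mono m v = at_mono m (conv u v).
Proof.
move=> m0; apply: funext => d; have [N dN] : exists N, (mdeg d <= N)%N by exists (mdeg d).
rewrite (at_monoM_coef _ _ m0 dN) (at_mono_widen _ m0 dN).
have mi k l : (mnm_muln m k == mnm_muln m l) = (k == l).
  apply/eqP/eqP => [/(congr1 mdeg)|->//]; rewrite !mdegMn => /eqP.
  by rewrite eqn_pmul2l => [/eqP //|]; rewrite lt0n mdeg_eq0.
have mD k l : mnm_add (mnm_muln m k) (mnm_muln m l) = mnm_muln m (k + l).
  by elim: k => [|k IH]; rewrite ?mulm0n ?add0m // addSn !mulmS -IH addmA.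
have md k : (k <= mdeg (mnm_muln m k))%N by rewrite mdegMn leq_pmull // lt0n mdeg_eq0.
case: (pselect (exists l, d = mnm_muln m l)) => [[l e]|ne].
  subst d; have lN := leq_trans (md l) dN.
  rewrite [RHS](bigD1 (Ordinal (lN : (l < N.+1)%N))) //= eqxx [X in _ = _ + X]big1 ?addr0; last first.
    by move=> k; rewrite mi -val_eqE /= eq_sym => /negbTE ->.
  rewrite /conv (big_ord_widen N.+1 (fun i => u i * v (l - i)%N)) //.
  rewrite (eq_bigl (fun k : 'I_N.+1 => (k < l.+1)%N)); last first.
    move=> k; rewrite ltnS; apply/mnm_lepP/idP => [h|h i]; last first.
      by rewrite !mulmnE leq_mul2l h orbT.
    have : (mdeg (mnm_muln m k) <= mdeg (mnm_muln m l))%N.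
      by rewrite !mdegE; apply: leq_sum => i _.
    by rewrite !mdegMn leq_pmul2l // lt0n mdeg_eq0.
  apply: eq_bigr => k kl; congr (_ * _).
  have -> : mnm_sub (mnm_muln m l) (mnm_muln m k) = mnm_muln m (l - k).
    by rewrite -{1}(subnK (kl : (k <= l)%N)) -mD addmK.
  rewrite /at_mono (bigD1 (Ordinal (md (l - k)%N : (_ < _.+1)%N))) //= eqxx big1 ?addr0 // => j.
  by rewrite mi -val_eqE /= eq_sym => /negbTE ->.
rewrite [RHS]big1 => [|l _]; last by case: eqP => // e; case: ne; exists l.
rewrite big1 // => k lk; rewrite [at_mono _ _ _]big1 ?mulr0 // => l _; case: eqP => // e.
by case: ne; exists (k + l)%N; rewrite -mD addmC -e submK.
Qed.

Definition pconst (c : K) : pser n K := fun d => if d == mnm0 then c else 0.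
Definition pmono (m : multinom n) : pser n K := fun d => (d == m)%:R.

Lemma pconstM c f d : (pconst c * f) d = c * f d.
Proof.
have [k dk] : exists k, (mdeg d < k)%N by exists (mdeg d).+1.
rewrite pserM (mseries_mulE _ _ dk).
have h0 : (mdeg (@mnm0 n) < k)%N by rewrite mdeg0 (leq_ltn_trans _ dk).
rewrite (bigD1 (BMultinom h0, BMultinom dk)) /=; last by rewrite add0m.
rewrite /pconst eqxx big1 ?addr0 // => -[a b] /= /andP[/eqP ed ne].
case: eqP => ea; last by rewrite mul0r.
case/eqP: ne; congr (_, _); apply: val_inj => //=.
by rewrite ed ea add0m.
Qed.

Lemma at_mono_linfac m (c : K) : m != mnm0 ->
  at_mono m (fun k => (linfac c)`_k) = 1 - pconst c * pmono m.
Proof.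
move=> m0; apply: funext => d; rewrite pserD pserN pser1 pconstM /pmono.
rewrite (@at_mono_widen _ _ _ (mdeg d).+1) // 2!big_ord_recl mulm0n mulm1n big1.
  rewrite /linfac !coefB !coefZ !coefX !coef1 /= mulr0 mulr1 subr0 sub0r addr0.
  by congr (_ + _); case: eqP => //=; rewrite ?mulr1 ?mulr0 ?oppr0.
by move=> k _; rewrite /linfac !coefB !coefZ !coefX !coef1 /= mulr0 subrr if_same.
Qed.

Lemma at_mono_prod m (I : Type) (s : seq I) (p : I -> {poly K}) : m != mnm0 ->
  at_mono m (fun k => (\prod_(i <- s) p i)`_k) = \prod_(i <- s) at_mono m (fun k => (p i)`_k).
Proof.
move=> m0; elim: s => [|i s IH].
  rewrite !big_nil -(at_mono_conv1 m0); apply: eq_at_mono => k.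
  by rewrite coef1.
rewrite !big_cons -IH at_monoM //; apply: eq_at_mono => k.
by rewrite coefM_conv.
Qed.

End SeriesRing.

(** * The dual Cauchy identity with two gradings *)

Section PairPoly.

Variable A : comNzRingType.
Implicit Types (xs ys : seq A) (f g : nat -> A).

Lemma pair_poly_prod xs ys :
  pair_poly xs ys = \prod_(y <- ys) \prod_(x <- xs) (1 - (x * y) *: 'X).
Proof. by rewrite /pair_poly /pairs big_allpairs_dep. Qed.

Lemma pair_poly_catl xs xs' ys :
  pair_poly (xs ++ xs') ys = pair_poly xs ys * pair_poly xs' ys.
Proof.
by rewrite !pair_poly_prod -big_split; apply: eq_bigr => y _; rewrite big_cat.
Qed.

Lemma pair_polyC xs ys : pair_poly xs ys = pair_poly ys xs.
Proof.
rewrite !pair_poly_prod exchange_big; apply: eq_bigr => x _; apply: eq_bigr => y _.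
by rewrite mulrC.
Qed.

Lemma pair_poly_scalel c xs ys k :
  (pair_poly [seq c * x | x <- xs] ys)`_k = c ^+ k * (pair_poly xs ys)`_k.
Proof.
rewrite !pair_polyE mulrCA -(es_poly_scale c); congr (_ * (polyseq (es_poly _))`_k).
rewrite /pairs map_allpairs; elim: ys => //= y ys IH; rewrite IH -map_comp.
by congr (_ ++ _); apply: eq_map => x; rewrite /= mulrA.
Qed.

Lemma pair_poly_map (B : comNzRingType) (h : {rmorphism A -> B}) xs ys k :
  (pair_poly (map h xs) (map h ys))`_k = h (pair_poly xs ys)`_k.
Proof.
rewrite -coef_map; congr (polyseq _)`_k; rewrite /pair_poly /pairs !big_allpairs_dep rmorph_prod /= big_map.
apply: eq_bigr => y _; rewrite rmorph_prod /= big_map; apply: eq_bigr => x _.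
by rewrite rmorphB rmorph1 /= map_polyZ map_polyX rmorphM.
Qed.

(* The coefficient of [c^l] in the degree [p] part of the product of the series
   [f] and [g(c _)]. *)
Definition graded f g p l : A := if (l <= p)%N then f (p - l)%N * g l else 0.

Lemma coef_graded f g p l :
  (conv (fun i => (f i)%:P) (fun i => 'X^i * (g i)%:P) p)`_l = graded f g p l.
Proof.
rewrite /conv coef_sum /graded; case: leqP => [lp|pl].
  rewrite (bigD1 (rev_ord (Ordinal (lp : (l < p.+1)%N)))) //= big1 ?addr0.
    by rewrite subSS subKn // coefCM coefXnM ltnn subnn coefC eqxx.
  move=> i; rewrite -val_eqE /= subSS coefCM coefXnM coefC => ne.
  case: ltnP => h; rewrite ?mulr0 //.
  case: eqP => h'; rewrite ?mulr0 //; case/eqP: ne; have := ltn_ord i; lia.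
rewrite big1 // => i _; rewrite coefCM coefXnM coefC.
case: ltnP => h; rewrite ?mulr0 //.
by case: eqP => h'; rewrite ?mulr0 //; have := ltn_ord i; lia.
Qed.

(** Marking the alphabet [xs] with ['X] in a concatenation lets the power of ['X] read off the size
    of the intermediate partition [m]. *)
Lemma sk_coef_cat xs ys a k :
  (sk (map polyC ys ++ [seq 'X * x | x <- map polyC xs]) a empty_intpart)`_k =
  \sum_(m <- peq k) sk xs m empty_intpart * sk ys a m.
Proof.
rewrite (sk_cat (n := (psize a + k)%N)) ?leq_addr // coef_sum.
rewrite (big_peq_ple (n := (psize a + k)%N) _ xpredT) ?leq_addl // [RHS]big_mkcond.
apply: eq_bigr => m _; rewrite sk_scale psize_empty subn0 !sk_map /=.
rewrite coefCM coefXnM coefC.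
case: ltnP => h; first by rewrite mulr0 gtn_eqF.
rewrite subn_eq0 [_ == k]eqn_leq h /=; case: ifP => _; last by rewrite mulr0.
by rewrite mulrC.
Qed.

Lemma dual_cauchy_pair xs ys n :
  (-1) ^+ n * \sum_(a <- peq n) sk xs a empty_intpart * sk ys (conj_intpart a) empty_intpart =
  (pair_poly xs ys)`_n.
Proof. by rewrite dual_cauchy_sum pair_polyE. Qed.

End PairPoly.

Section TwoGradings.

Lemma dual_cauchy_graded1 (A : comNzRingType) (xs ys ws : seq A) n k :
  (-1) ^+ n * \sum_(a <- peq n)
    (\sum_(m <- peq k) sk xs m empty_intpart * sk ys a m) *
      sk ws (conj_intpart a) empty_intpart =
  graded (fun i => (pair_poly ys ws)`_i) (fun i => (pair_poly xs ws)`_i) n k.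
Proof.
have := congr1 (fun p : {poly A} => p`_k) (dual_cauchy_pair
  (map polyC ys ++ [seq 'X * x | x <- map polyC xs]) (map polyC ws) n).
rewrite /= pair_poly_catl (coefM_conv (pair_poly _ _)) -coef_graded => e.
transitivity ((conv (fun i => (pair_poly (map polyC ys) (map polyC ws))`_i)
   (fun i => (pair_poly [seq 'X * x | x <- map polyC xs] (map polyC ws))`_i) n)`_k).
  rewrite -e -polyC1 -polyCN -polyC_exp coefCM coef_sum; congr (_ * _).
  apply: eq_bigr => a _; rewrite sk_map /= coefMC; congr (_ * _).
  by rewrite sk_coef_cat.
congr (polyseq _)`_k; apply: eq_conv => i; first by rewrite pair_poly_map.
by rewrite pair_poly_scalel pair_poly_map.
Qed.

(** The identity with one grading over the ring [{poly A}], whose variable marks the second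
    alphabet. The pairs between four alphabets give the four products. *)
Lemma dual_cauchy_graded2 (A : comNzRingType) (xs ys vs ws : seq A) n k l :
  (-1) ^+ n * \sum_(a <- peq n)
    (\sum_(m <- peq k) sk xs m empty_intpart * sk ys a m) *
    (\sum_(m <- peq l) sk vs m empty_intpart * sk ws (conj_intpart a) m) =
  if (k <= n)%N then \sum_(i < l.+1)
    graded (fun j => (pair_poly ys ws)`_j) (fun j => (pair_poly ys vs)`_j) (n - k) i *
    graded (fun j => (pair_poly xs ws)`_j) (fun j => (pair_poly xs vs)`_j) k (l - i)
  else 0.
Proof.
have := congr1 (fun p : {poly A} => p`_l) (dual_cauchy_graded1
  (map polyC xs) (map polyC ys) (map polyC ws ++ [seq 'X * x | x <- map polyC vs]) n k).
rewrite /= -[in (-1) ^+ n]polyC1 -polyCN -polyC_exp coefCM coef_sum => e.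
transitivity ((graded
  (fun i => (pair_poly (map polyC ys) (map polyC ws ++ [seq 'X * x | x <- map polyC vs]))`_i)
  (fun i => (pair_poly (map polyC xs) (map polyC ws ++ [seq 'X * x | x <- map polyC vs]))`_i) n k)`_l).
  rewrite -e; congr (_ * _); apply: eq_bigr => a _.
  rewrite (_ : \sum_(m <- peq k) sk (map polyC xs) m _ * _ =
    (\sum_(m <- peq k) sk xs m empty_intpart * sk ys a m)%:P) ?coefCM ?sk_coef_cat //.
  by rewrite rmorph_sum; apply: eq_bigr => m _; rewrite !sk_map rmorphM.
rewrite /graded; case: leqP => [kn|_]; last by rewrite coef0.
have E (us : seq A) p i :
    ((pair_poly (map polyC us) (map polyC ws ++ [seq 'X * x | x <- map polyC vs]))`_p)`_i =
    graded (fun j => (pair_poly us ws)`_j) (fun j => (pair_poly us vs)`_j) p i.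
  rewrite pair_polyC pair_poly_catl coefM_conv -coef_graded; congr (polyseq _)`_i.
  apply: eq_conv => j; first by rewrite pair_polyC pair_poly_map.
  by rewrite pair_poly_scalel pair_polyC pair_poly_map.
by rewrite coefM; apply: eq_bigr => i _; rewrite !E.
Qed.

End TwoGradings.

Section DualCauchyLimit.

Variable R : realType.
Local Notation S := (skew_schur_q R).

Lemma lim_val_graded f g (u v : R[i] -> nat -> nat -> R[i]) p k :
    (forall j, lim_val (f j) (fun z N => u z N j)) ->
    (forall j, lim_val (g j) (fun z N => v z N j)) ->
  lim_val (graded f g p k) (fun z N => graded (u z N) (v z N) p k).
Proof.
move=> hf hg; rewrite /graded; case: leqP => _; first exact: lim_valM (hf _) (hg _).
by apply: lim_val_cst => z _; apply: has_value0.
Qed.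

Lemma lim_val_grading be al a k :
  lim_val (\sum_(m <- peq k) S m empty_intpart be * S a m al)
    (fun z N => \sum_(m <- peq k)
      sk (qalph be z N) m empty_intpart * sk (qalph al z N) a m : R[i]).
Proof.
refine (@lim_val_sum R _ _ _ _ (fun m z N =>
  sk (qalph be z N) m empty_intpart * sk (qalph al z N) a m) _) => m _.
by apply: lim_valM; apply: skew_schur_qE.
Qed.

Lemma dual_cauchy_q al be ga de n k l :
  (-1) ^+ n * \sum_(a <- peq n)
    (\sum_(m <- peq k) S m empty_intpart be * S a m al) *
    (\sum_(m <- peq l) S m empty_intpart de * S (conj_intpart a) m ga) =
  if (k <= n)%N then \sum_(i < l.+1)
    graded (dual_cauchy_coef R al ga) (dual_cauchy_coef R al de) (n - k) i *
    graded (dual_cauchy_coef R be ga) (dual_cauchy_coef R be de) k (l - i)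
  else 0.
Proof.
pose P a b (z : R[i]) N j : R[i] := (pair_poly (qalph a z N) (qalph b z N))`_j.
have h : lim_val ((-1) ^+ n * \sum_(a <- peq n)
    (\sum_(m <- peq k) S m empty_intpart be * S a m al) *
    (\sum_(m <- peq l) S m empty_intpart de * S (conj_intpart a) m ga))
  (fun z N => if (k <= n)%N then \sum_(i < l.+1)
    graded (P al ga z N) (P al de z N) (n - k) i *
    graded (P be ga z N) (P be de z N) k (l - i) else 0).
  apply: (@lim_val_eq _ _ (fun z N => (-1) ^+ n * \sum_(a <- peq n)
    (\sum_(m <- peq k) sk (qalph be z N) m empty_intpart * sk (qalph al z N) a m) *
    (\sum_(m <- peq l) sk (qalph de z N) m empty_intpart * sk (qalph ga z N) (conj_intpart a) m))).
    by move=> z _; exists 0%N => N _; rewrite dual_cauchy_graded2.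
  apply: (@lim_valM _ _ _ (fun _ _ => (-1) ^+ n)).
    apply: (@lim_val_cst R _ (fun=> (-1) ^+ n)) => z _; apply: has_valueXn.
    by apply: has_valueN; apply: has_value1.
  refine (@lim_val_sum R _ _ _ _ (fun a z N =>
    (\sum_(m <- peq k) sk (qalph be z N) m empty_intpart * sk (qalph al z N) a m) *
    (\sum_(m <- peq l) sk (qalph de z N) m empty_intpart * sk (qalph ga z N) (conj_intpart a) m)) _).
  by move=> a _; apply: lim_valM; apply: lim_val_grading.
apply: lim_val_uniq h _; case: leqP => _; last first.
  by apply: lim_val_cst => z _; apply: has_value0.
refine (@lim_val_sum R 'I_l.+1 _ _ _ (fun i z N => graded (P al ga z N) (P al de z N) (n - k) i *
    graded (P be ga z N) (P be de z N) k (l - i)) _) => i _.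
by apply: lim_valM; apply: lim_val_graded => j; apply: lim_dual_cauchy_coef.
Qed.

End DualCauchyLimit.

(** * The strips *)

Definition mn3 (a b c : nat) : multinom 3 := @Multinom 3 [tuple a; b; c].

Lemma mn3E (d : multinom 3) : d = mn3 (d ord0) (d (inord 1)) (d (inord 2)).
Proof.
case: d => -[[|a [|b [|c []]]] // i]; congr Multinom; apply: val_inj => /=.
by rewrite !multinomE !(tnth_nth 0%N) /= !inordK.
Qed.

Lemma mn3_eq a b c a' b' c' :
  (mn3 a b c == mn3 a' b' c') = [&& a == a', b == b' & c == c'].
Proof.
apply/eqP/and3P => [[-> -> ->]|[/eqP -> /eqP -> /eqP ->]//].
by rewrite !eqxx.
Qed.

Lemma mnmP3 (d d' : multinom 3) : d ord0 = d' ord0 -> d (inord 1) = d' (inord 1) ->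
  d (inord 2) = d' (inord 2) -> d = d'.
Proof. by move=> e0 e1 e2; rewrite [d]mn3E [d']mn3E e0 e1 e2. Qed.

Lemma mn3_0 a b c : mn3 a b c ord0 = a. Proof. by []. Qed.
Lemma mn3_1 a b c : mn3 a b c (inord 1) = b.
Proof. by rewrite multinomE (tnth_nth 0%N) /= inordK. Qed.
Lemma mn3_2 a b c : mn3 a b c (inord 2) = c.
Proof. by rewrite multinomE (tnth_nth 0%N) /= inordK. Qed.

Definition mn3_coord := (mn3_0, mn3_1, mn3_2).

Lemma mn3D a b c a' b' c' :
  mnm_add (mn3 a b c) (mn3 a' b' c') = mn3 (a + a') (b + b') (c + c').
Proof. by apply: mnmP3; rewrite mnmDE !mn3_coord. Qed.

Lemma mn3B a b c a' b' c' :
  mnm_sub (mn3 a b c) (mn3 a' b' c') = mn3 (a - a') (b - b') (c - c').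
Proof. by apply: mnmP3; rewrite mnmBE !mn3_coord. Qed.

Lemma mn3_muln a b c k : mnm_muln (mn3 a b c) k = mn3 (a * k) (b * k) (c * k).
Proof. by apply: mnmP3; rewrite mulmnE !mn3_coord. Qed.

Lemma mdeg_mn3 a b c : mdeg (mn3 a b c) = (a + b + c)%N.
Proof. by rewrite /mdeg !big_cons big_nil addn0 addnA. Qed.

Lemma mn3_neq0 a b c : (mn3 a b c != mnm0) = (0 < a + b + c)%N.
Proof. by rewrite -mdeg_eq0 mdeg_mn3 lt0n. Qed.

Lemma lem_mn3 a b c a' b' c' :
  lem (mn3 a b c) (mn3 a' b' c') = [&& a <= a', b <= b' & c <= c']%N.
Proof.
apply/mnm_lepP/and3P => [h|[ha hb hc] i].
  by split; [have := h ord0|have := h (inord 1)|have := h (inord 2)]; rewrite !mn3_coord.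
case: i => -[|[|[|//]]] hi.
- by rewrite (_ : Ordinal hi = ord0) ?mn3_coord //; apply: val_inj.
- by rewrite (_ : Ordinal hi = inord 1) ?mn3_coord //; apply: val_inj; rewrite /= inordK.
- by rewrite (_ : Ordinal hi = inord 2) ?mn3_coord //; apply: val_inj; rewrite /= inordK.
Qed.

Section ThreeVariables.

Variable K : fieldType.
Implicit Types (f g : pser 3 K) (u v : nat -> K).

Lemma pser3P f g : (forall a b c, f (mn3 a b c) = g (mn3 a b c)) -> f = g.
Proof. by move=> h; apply: funext => d; rewrite [d]mn3E. Qed.

Lemma pser3M f g a b c : (f * g) (mn3 a b c) =
  \sum_(i < a.+1) \sum_(j < b.+1) \sum_(k < c.+1)
    f (mn3 i j k) * g (mn3 (a - i) (b - j) (c - k)).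
Proof.
pose h (x : 'I_a.+1 * ('I_b.+1 * 'I_c.+1)) :=
  (mn3 x.1 x.2.1 x.2.2, mn3 (a - x.1) (b - x.2.1) (c - x.2.2)).
rewrite pserM /mseries_mul (fsum_list (r := [seq h x | x <- enum {: 'I_a.+1 * ('I_b.+1 * 'I_c.+1)}])
  (P := xpredT)).
- rewrite big_map big_enum /= pair_bigA /= pair_bigA /=.
  rewrite (reindex (fun x : 'I_a.+1 * 'I_b.+1 * 'I_c.+1 => (x.1.1, (x.1.2, x.2)))) //=.
  by exists (fun x => ((x.1, x.2.1), x.2.2)) => [[[]]|[? []]].
- rewrite map_inj_uniq ?enum_uniq // => -[i [j k]] [i' [j' k']] [e1 e2 e3 _ _ _].
  by congr (_, (_, _)); apply: val_inj.
- move=> _ /mapP[[i [j k]] _ ->] _ /=; rewrite mn3D.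
  have := ltn_ord i; have := ltn_ord j; have := ltn_ord k => hk hj hi.
  by congr mn3; lia.
- move=> [x y] /=; rewrite [x]mn3E [y]mn3E mn3D => /eqP.
  rewrite mn3_eq => /and3P[/eqP ea /eqP eb /eqP ec] _; rewrite andbT; apply/mapP.
  have ha : (x ord0 < a.+1)%N by lia.
  have hb : (x (inord 1) < b.+1)%N by lia.
  have hc : (x (inord 2) < c.+1)%N by lia.
  exists (Ordinal ha, (Ordinal hb, Ordinal hc)); rewrite ?mem_enum // /h /=.
  by congr (_, mn3 _ _ _); lia.
Qed.

Lemma at_mono3M e0 e1 e2 u f a b c N : (0 < e0 + e1 + e2)%N -> (a + b + c <= N)%N ->
  (at_mono (mn3 e0 e1 e2) u * f) (mn3 a b c) =
  \sum_(k < N.+1 | [&& e0 * k <= a, e1 * k <= b & e2 * k <= c]%N)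
    u k * f (mn3 (a - e0 * k) (b - e1 * k) (c - e2 * k)).
Proof.
move=> e hN; rewrite (@at_monoM_coef _ _ _ _ _ _ N) ?mn3_neq0 ?mdeg_mn3 //.
by apply: eq_big => k; rewrite mn3_muln ?lem_mn3 ?mn3B.
Qed.

Lemma at_mono3 e0 e1 e2 u k : (0 < e0 + e1 + e2)%N ->
  at_mono (mn3 e0 e1 e2) u (mn3 (e0 * k) (e1 * k) (e2 * k)) = u k.
Proof.
move=> e; rewrite (@at_mono_widen _ _ _ _ _ (e0 * k + e1 * k + e2 * k + k)); last first.
- by rewrite mdeg_mn3 leq_addr.
- by rewrite mn3_neq0.
have hk : (k < (e0 * k + e1 * k + e2 * k + k).+1)%N by rewrite ltnS leq_addl.
rewrite (bigD1 (Ordinal hk)) //= -mn3_muln eqxx big1 ?addr0 // => j; rewrite -val_eqE /=.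
move=> jk; case: eqP => // /(congr1 mdeg); rewrite !mdegMn mdeg_mn3 => /eqP.
by rewrite eqn_pmul2l // eq_sym (negbTE jk).
Qed.

Lemma at_mono3_eq0 e0 e1 e2 u a b c :
    (forall k, ~ [/\ a = e0 * k, b = e1 * k & c = e2 * k]%N) ->
  at_mono (mn3 e0 e1 e2) u (mn3 a b c) = 0.
Proof.
move=> h; rewrite /at_mono big1 // => k _; rewrite mn3_muln mn3_eq.
by case: and3P => // -[/eqP e1' /eqP e2' /eqP e3']; case: (h k).
Qed.

Lemma at_monoM_F1 u f a b c : (at_mono (mn3 0 1 0) u * f) (mn3 a b c) =
  \sum_(i < b.+1) u i * f (mn3 a (b - i) c).
Proof.
rewrite (@at_mono3M _ _ _ _ _ _ _ _ (a + b + c)) //.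
rewrite (big_ord_widen (a + b + c).+1 (fun i => u i * f (mn3 a (b - i) c))); last by lia.
by apply: eq_big => k; rewrite ?mul0n ?mul1n ?leq0n ?andbT ?ltnS ?subn0.
Qed.

Lemma at_monoM_F2 u f a b c : (at_mono (mn3 0 0 1) u * f) (mn3 a b c) =
  \sum_(i < c.+1) u i * f (mn3 a b (c - i)).
Proof.
rewrite (@at_mono3M _ _ _ _ _ _ _ _ (a + b + c)) //.
rewrite (big_ord_widen (a + b + c).+1 (fun i => u i * f (mn3 a b (c - i)))); last by lia.
by apply: eq_big => k; rewrite ?mul0n ?mul1n ?leq0n ?andbT ?ltnS ?subn0.
Qed.

Lemma at_mono_Q0_Q0F2 u v a b c :
  (at_mono (mn3 1 0 0) u * at_mono (mn3 1 0 1) v) (mn3 a b c) =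
  if b == 0%N then graded u v a c else 0.
Proof.
rewrite (@at_mono3M _ _ _ _ _ _ _ _ (a + b + c)) // /graded.
case: eqP => [->|b0]; last first.
  rewrite big1 // => k _; rewrite at_mono3_eq0 ?mulr0 // => j [_ e _].
  by apply: b0; move: e; lia.
case: leqP => ca.
  have h : (a - c < (a + 0 + c).+1)%N by lia.
  rewrite (bigD1 (Ordinal h)) /= ?mul0n ?mul1n ?leq_subr //.
  rewrite [X in _ + X]big1 ?addr0; last first.
    move=> k /andP[/andP[h1 _] ne]; rewrite at_mono3_eq0 ?mulr0 // => j [e _ e'].
    by case/eqP: ne; apply: val_inj => /=; move: h1 e e'; lia.
  congr (_ * _); have := @at_mono3 1 0 1 v c isT.
  by rewrite mul0n mul1n !subn0 subKn.
rewrite big1 // => k /and3P[h1 _ _]; rewrite at_mono3_eq0 ?mulr0 // => j [e _ e'].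
by move: h1 e e'; lia.
Qed.

Lemma at_mono_Q0F1_Q0F1F2 u v a b c :
  (at_mono (mn3 1 1 0) u * at_mono (mn3 1 1 1) v) (mn3 a b c) =
  if a == b then graded u v b c else 0.
Proof.
rewrite (@at_mono3M _ _ _ _ _ _ _ _ (a + b + c)) // /graded.
case: eqP => [->|ab]; last first.
  rewrite big1 // => k /and3P[h1 h2 _]; rewrite at_mono3_eq0 ?mulr0 // => j [e e' _].
  by apply: ab; move: h1 h2 e e'; lia.
case: leqP => ca.
  have h : (b - c < (b + b + c).+1)%N by lia.
  rewrite (bigD1 (Ordinal h)) /= ?mul0n ?mul1n ?leq_subr //.
  rewrite [X in _ + X]big1 ?addr0; last first.
    move=> k /andP[/and3P[h1 _ _] ne]; rewrite at_mono3_eq0 ?mulr0 // => j [e _ e'].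
    by case/eqP: ne; apply: val_inj => /=; move: h1 e e'; lia.
  congr (_ * _); have := @at_mono3 1 1 1 v c isT.
  by rewrite mul1n !subn0 subKn.
rewrite big1 // => k /and3P[h1 _ _]; rewrite at_mono3_eq0 ?mulr0 // => j [e _ e'].
by move: h1 e e'; lia.
Qed.

(** Only the second pair involves the middle variable, and there its degree equals that of the first
    variable; so [k] fixes the split of [n], and only the split of [l] is left to sum. *)
Lemma four_monomials u1 u2 u3 u4 n k l :
  (at_mono (mn3 1 0 0) u1 * at_mono (mn3 1 0 1) u2 *
    (at_mono (mn3 1 1 0) u3 * at_mono (mn3 1 1 1) u4)) (mn3 n k l) =
  if (k <= n)%N then
    \sum_(i < l.+1) graded u1 u2 (n - k) i * graded u3 u4 k (l - i) else 0.
Proof.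
rewrite pser3M; case: leqP => kn.
  have h : (n - k < n.+1)%N by lia.
  rewrite (bigD1 (Ordinal h)) //= [X in _ + X]big1 ?addr0; last first.
    move=> i ik; rewrite big1 // => j _; rewrite big1 // => m _.
    rewrite at_mono_Q0_Q0F2 at_mono_Q0F1_Q0F1F2.
    case: eqP => j0; rewrite ?mul0r //; case: eqP => e; rewrite ?mulr0 //.
    by case/eqP: ik; apply: val_inj => /=; have := ltn_ord i; lia.
  rewrite (bigD1 ord0) //= [X in _ + X]big1 ?addr0; last first.
    move=> j j0; rewrite big1 // => m _; rewrite at_mono_Q0_Q0F2.
    by rewrite ifN ?mul0r.
  apply: eq_bigr => m _; rewrite at_mono_Q0_Q0F2 at_mono_Q0F1_Q0F1F2 eqxx subKn //.
  by rewrite subn0 eqxx.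
rewrite big1 // => i _; rewrite big1 // => j _; rewrite big1 // => m _.
rewrite at_mono_Q0_Q0F2 at_mono_Q0F1_Q0F1F2.
case: eqP => j0; rewrite ?mul0r //; case: eqP => e; rewrite ?mulr0 //.
by have := ltn_ord i; lia.
Qed.

End ThreeVariables.

(** * Summation over the labels of the edges of [Q_0], [Q_(F_1)] and [Q_(F_2)] *)

Section Strips.

Variable R : realType.
Local Notation S := (skew_schur_q R).
Local Notation L := (cauchy_coef R).
Local Notation E := (dual_cauchy_coef R).
Implicit Types (al be ga de : intpart).

(** For each [m] the sum over the fibre label [a] is [cauchy_q], which replaces the skew function of
    [a] by [S m] at [al] and leaves a sum over [m] graded by its size. *)
Lemma vertex_sum al ga de l n :
  \sum_(a <- peq n) S a empty_intpart al * \sum_(m <- ple n) S l m de * S a m ga =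
  conv (L al ga) (fun k => \sum_(m <- peq k) S m empty_intpart al * S l m de) n.
Proof.
under eq_bigr do rewrite mulr_sumr.
rewrite exchange_big big_ple_peq convC /conv; apply: eq_bigr => k _.
rewrite mulr_suml big_seq [RHS]big_seq; apply: eq_bigr => m; rewrite mem_peq => /eqP mk.
have := cauchy_q R al ga m (n - k); rewrite mk subnKC ?[X in (X <= _)%N]mk; last first.
  by rewrite -ltnS ltn_ord.
move=> e; rewrite -mulrA [_ * L al ga _]mulrC mulrA.
rewrite [_ * L al ga _]mulrC -e mulr_suml; apply: eq_bigr => a _.
by rewrite mulrA mulrAC.
Qed.

(** The edge of [Q_0] with the fibre edge at each end. Here [be], [pi], [ga], [de] stand for
    [mu^1_1], [mu^1_2], [mu^2_2], [mu^2_1]. *)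
Definition middle be pi ga de n0 n1 n2 : ratfun :=
  (-1) ^+ n0 * \sum_(l <- peq n0)
    (\sum_(a <- peq n1) S a empty_intpart be *
       \sum_(m <- ple n1) S l m pi * S a m (conj_intpart pi)) *
    (\sum_(a <- peq n2) S a empty_intpart (conj_intpart de) *
       \sum_(m <- ple n2) S (conj_intpart l) m (conj_intpart ga) * S a m ga).

(** After [vertex_sum] at both ends the sum over [l] is [dual_cauchy_q], the gradings being the
    sizes [n1 - i] and [n2 - j] left over by the two Cauchy factors. *)
Lemma middleE be pi ga de n0 n1 n2 : middle be pi ga de n0 n1 n2 =
  \sum_(i < n1.+1) L be (conj_intpart pi) i *
    \sum_(j < n2.+1) L ga (conj_intpart de) j *
    if (n1 - i <= n0)%N then \sum_(r < (n2 - j).+1)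
      graded (E pi (conj_intpart ga)) (E pi (conj_intpart de)) (n0 - (n1 - i)) r *
      graded (E be (conj_intpart ga)) (E be (conj_intpart de)) (n1 - i) ((n2 - j) - r)
    else 0.
Proof.
rewrite /middle; under eq_bigr do rewrite !vertex_sum.
rewrite mulr_sumr.
under [RHS]eq_bigr do under eq_bigr do rewrite -dual_cauchy_q.
have LC i : L (conj_intpart de) ga i = L ga (conj_intpart de) i.
  by apply: eq_bigr => a _; rewrite mulrC.
under [RHS]eq_bigr do rewrite mulr_sumr.
under [RHS]eq_bigr do under eq_bigr do rewrite mulrCA 2!mulr_sumr mulr_sumr.
under [RHS]eq_bigr do rewrite exchange_big /=.
rewrite [RHS]exchange_big /=; apply: eq_bigr => l _.
rewrite /conv mulr_suml mulr_sumr; apply: eq_bigr => i _.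
set G := \sum_(m <- peq (n1 - i)) _.
rewrite 2!mulr_sumr; apply: eq_bigr => j _; rewrite LC.
by ring.
Qed.

(* The coefficient of [Q_0^n0 Q_(F_1)^n1 Q_(F_2)^n2]. *)
Definition strip be pi ga de n0 n1 n2 : ratfun :=
  \sum_(i < n1.+1) L be (conj_intpart pi) i *
    \sum_(j < n2.+1) L ga (conj_intpart de) j * middle be pi ga de n0 (n1 - i) (n2 - j).

Local Notation mQ0 := (mn3 1 0 0).
Local Notation mF1 := (mn3 0 1 0).
Local Notation mF2 := (mn3 0 0 1).
Local Notation mQ0F1 := (mn3 1 1 0).
Local Notation mQ0F2 := (mn3 1 0 1).
Local Notation mQ0F1F2 := (mn3 1 1 1).

(** Each fibre variable has a square: one factor from the fibre edge away from the edge of [Q_0],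
    and an equal one from the vertex at its end. *)
Definition strip_series be pi ga de : pser 3 ratfun :=
  at_mono mF1 (L be (conj_intpart pi)) ^+ 2 * at_mono mF2 (L ga (conj_intpart de)) ^+ 2 *
  (at_mono mQ0 (E pi (conj_intpart ga)) * at_mono mQ0F2 (E pi (conj_intpart de)) *
   (at_mono mQ0F1 (E be (conj_intpart ga)) * at_mono mQ0F1F2 (E be (conj_intpart de)))).

Lemma strip_seriesE be pi ga de n0 n1 n2 :
  strip_series be pi ga de (mn3 n0 n1 n2) = strip be pi ga de n0 n1 n2.
Proof.
rewrite /strip_series !expr2.
set A := at_mono mF1 _; set B := at_mono mF2 _; set Q := _ * _ * (at_mono mQ0F1 _ * _).
have -> : A * A * (B * B) * Q = A * (B * (A * (B * Q))) by ring.
rewrite at_monoM_F1; apply: eq_bigr => i _; rewrite at_monoM_F2; congr (_ * _).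
apply: eq_bigr => j _; congr (_ * _); rewrite at_monoM_F1 middleE.
apply: eq_bigr => i' _; rewrite at_monoM_F2; congr (_ * _).
by apply: eq_bigr => j' _; rewrite /Q four_monomials.
Qed.

(* The Laurent polynomial [cells_prod] in the variables [q^(1/2)] and [m]. *)
Definition nek (m : multinom 3) mu nu : pser 3 ratfun :=
  (\prod_(i < size mu) \prod_(j < part mu i)
     (1 - pconst (qhalf ^ (2 * arm_leg mu nu i j)) * pmono ratfun m)) *
  \prod_(i < size nu) \prod_(j < part nu i)
     (1 - pconst (qhalf ^ (2 * - arm_leg nu mu i j)) * pmono ratfun m).

Lemma at_mono_cells m mu nu : m != mnm0 ->
  at_mono m (fun k => (cells_prod (qfac qhalf) mu nu)`_k) = nek m mu nu.
Proof.
move=> m0; rewrite /cells_prod /nek.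
have h la (F : nat -> nat -> int) :
    at_mono m (fun k => (\prod_(i < size la) \prod_(j < part la i) qfac qhalf (F i j))`_k) =
    \prod_(i < size la) \prod_(j < part la i)
      (1 - pconst (qhalf ^ (2 * F i j)) * pmono ratfun m).
  rewrite at_mono_prod //; apply: eq_bigr => i _.
  rewrite at_mono_prod //; apply: eq_bigr => j _.
  exact: at_mono_linfac.
rewrite -(h mu (fun i j => arm_leg mu nu i j)) -(h nu (fun i j => - arm_leg nu mu i j)).
by rewrite at_monoM //; apply: eq_at_mono => k; rewrite coefM_conv.
Qed.

Lemma at_mono_dual m al ga : m != mnm0 ->
  at_mono m (E al ga) = nek m al (conj_intpart ga) * at_mono m (E empty_intpart empty_intpart).
Proof.
move=> m0; rewrite -at_mono_cells // at_monoM //; apply: eq_at_mono => k.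
exact: dual_cauchy_coef_nekrasov.
Qed.

(** The inverse of [at_mono_dual], written without division. *)
Lemma at_mono_cauchy m al ga : m != mnm0 ->
  at_mono m (L al ga) * nek m al (conj_intpart ga) = at_mono m (L empty_intpart empty_intpart).
Proof.
move=> m0; have h a b : at_mono m (L a b) * at_mono m (E a b) = 1.
  rewrite at_monoM // -(at_mono_conv1 _ m0); apply: eq_at_mono.
  exact: conv_cauchy_dual.
have := h al ga; rewrite at_mono_dual // => e.
have e' := h empty_intpart empty_intpart.
set L0 := at_mono m (L empty_intpart _) in e' *.
set E0 := at_mono m (E empty_intpart _) in e e'.
rewrite -[LHS]mulr1 -e' -[RHS]mul1r -e.
by ring.
Qed.

Definition strip_num be pi ga de : pser 3 ratfun :=
  nek mQ0 pi ga * nek mQ0F2 pi de * (nek mQ0F1 be ga * nek mQ0F1F2 be de).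

Definition strip_den be pi ga de : pser 3 ratfun :=
  nek mF1 be pi ^+ 2 * nek mF2 ga de ^+ 2.

Local Notation strip0 := (strip_series empty_intpart empty_intpart empty_intpart empty_intpart).

Lemma strip_ratio be pi ga de :
  strip_series be pi ga de * strip_den be pi ga de = strip0 * strip_num be pi ga de.
Proof.
rewrite /strip_series !conj_empty /strip_den /strip_num.
rewrite !(at_mono_dual pi) ?mn3_neq0 // !(at_mono_dual be) ?mn3_neq0 // !conj_intpartK.
rewrite -(@at_mono_cauchy mF1 be (conj_intpart pi)) ?mn3_neq0 // conj_intpartK.
rewrite -(@at_mono_cauchy mF2 ga (conj_intpart de)) ?mn3_neq0 // conj_intpartK.
by ring.
Qed.

Lemma at_mono0 n (K : fieldType) (m : multinom n) (u : nat -> K) : at_mono m u mnm0 = u 0%N.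
Proof. by rewrite /at_mono mdeg0 big_ord_recl big_ord0 addr0 mulm0n eqxx. Qed.

Lemma strip0_const : strip0 mnm0 = 1.
Proof.
have L0 : L empty_intpart empty_intpart 0 = 1.
  by rewrite /cauchy_coef peq0 big_seq1 !skew_schur_q_empty mulr1.
have E0 : E empty_intpart empty_intpart 0 = 1.
  by rewrite /dual_cauchy_coef peq0 big_seq1 conj_empty !skew_schur_q_empty !mulr1.
by rewrite /strip_series conj_empty !expr2 !pserM0 !at_mono0 L0 E0 !mulr1.
Qed.

Lemma pser_prod0 n (K : fieldType) (I : Type) (s : seq I) (f : I -> pser n K) :
  (forall i, f i mnm0 = 1) -> (\prod_(i <- s) f i) mnm0 = 1.
Proof.
move=> h; elim: s => [|i s IH]; first by rewrite big_nil pser1 eqxx.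
by rewrite big_cons pserM0 h IH mulr1.
Qed.

Lemma nek_const m mu nu : m != mnm0 -> nek m mu nu mnm0 = 1.
Proof.
move=> m0; have h c : (1 - pconst c * pmono ratfun m) mnm0 = 1.
  by rewrite pserD pserN pser1 eqxx pconstM /pmono eq_sym (negbTE m0) mulr0 subr0.
have hh la (F : nat -> nat -> int) : (\prod_(i < size la) \prod_(j < part la i)
    (1 - pconst (qhalf ^ (2 * F i j)) * pmono ratfun m)) mnm0 = 1.
  by apply: pser_prod0 => i; apply: pser_prod0.
rewrite /nek pserM0 (hh mu (arm_leg mu nu)) (hh nu (fun i j => - arm_leg nu mu i j)).
by rewrite mulr1.
Qed.

Lemma strip_den_const be pi ga de : strip_den be pi ga de mnm0 = 1.
Proof. by rewrite /strip_den !expr2 !pserM0 !nek_const ?mn3_neq0 // !mulr1. Qed.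

End Strips.

(** * The amplitudes *)

Section ToricGraph.

Implicit Types (e : edge) (s : lattice_pt * lattice_pt).

(** Edges are addressed by number, so that statements about all of them become boolean tests on
    [iota 0 9], settled by computation. *)
Definition ed (k : nat) : edge := inord k.

Definition seg (k : nat) := (nth ((0, 0), (0, 0), ord0) interior_segments k).1.

Lemma edP (P : edge -> Prop) : (forall k, (k < 9)%N -> P (ed k)) -> forall e, P e.
Proof. by move=> h e; rewrite -(inord_val e); apply: h; exact: ltn_ord. Qed.

Lemma ed_eq i j : (i < 9)%N -> (j < 9)%N -> (ed i == ed j) = (i == j).
Proof. by move=> i9 j9; rewrite -val_eqE /= !inordK. Qed.

Lemma segmentE k : (k < 9)%N -> segment (ed k) = seg k.
Proof. by move=> k9; rewrite /segment (tnth_nth ((0, 0), (0, 0), ord0)) /= inordK. Qed.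

Lemma big_ed (V : Type) (idx : V) (op : V -> V -> V) (P : pred edge) (F : edge -> V) :
  \big[op/idx]_(e : edge | P e) F e = \big[op/idx]_(k <- iota 0 9 | P (ed k)) F (ed k).
Proof.
have edK (e : 'I_9) : ed e = e by apply: inord_val.
transitivity (\big[op/idx]_(0 <= k < 9 | P (ed k)) F (ed k)); last by [].
by rewrite big_mkord; apply: eq_big => e; rewrite edK.
Qed.

Lemma all_seg (P : nat -> bool) k : all P (iota 0 9) -> (k < 9)%N -> P k.
Proof. by move/allP => h k9; apply: h; rewrite mem_iota. Qed.

Lemma segment_inj : injective segment.
Proof.
apply: edP => i i9; apply: edP => j j9; rewrite !segmentE // => h; apply/eqP.
rewrite ed_eq //; move/eqP: h.
have /all_seg/(_ i9)/all_seg/(_ j9)/implyP : all (fun i => all (fun j =>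
  (seg i == seg j) ==> (i == j)) (iota 0 9)) (iota 0 9) by [].
exact.
Qed.

Lemma segment_flip e e' : segment e <> flip (segment e').
Proof.
move: e e'; apply: edP => i i9; apply: edP => j j9; rewrite !segmentE //; apply/eqP.
by have /all_seg/(_ i9)/all_seg/(_ j9) : all (fun i => all (fun j =>
  seg i != flip (seg j)) (iota 0 9)) (iota 0 9) by [].
Qed.

Lemma flipK : involutive flip. Proof. by case. Qed.

Lemma flip_inj : injective flip. Proof. exact: inv_inj flipK. Qed.

Lemma pick_unique (P : pred edge) e : P e -> (forall e', P e' -> e' = e) ->
  [pick x | P x] = Some e.
Proof. by move=> Pe u; case: pickP => [x /u -> //|/(_ e)]; rewrite Pe. Qed.

Lemma pick_none (P : pred edge) : (forall e, ~~ P e) -> [pick x | P x] = None.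
Proof. by move=> h; case: pickP => // x; rewrite (negbTE (h x)). Qed.

Lemma prod8 (K : comNzRingType) (T : Type) (F : T -> K) (a b c d e f g h : T) :
  \prod_(v <- [:: a; b; c; d; e; f; g; h]) F v =
  F a * F b * F c * F d * (F e * F f * F g * F h).
Proof. by rewrite !big_cons big_nil mulr1 !mulrA. Qed.

Section Directed.

Variables (dir : edge -> bool) (lam : labelling).

(** The label as seen from the triangle that has [segment e] among its sides; the opposite triangle
    sees the conjugate. *)
Definition oriented e : intpart := if dir e then lam e else conj_intpart (lam e).

Lemma side_segment e : side_intpart dir lam (segment e) = oriented e.
Proof.
rewrite /side_intpart /oriented /right_left; case: ifP => de.
  rewrite (pick_unique (e := e)) ?de // => e'; case: ifP => _ /eqP; first exact: segment_inj.
  by move/esym/segment_flip.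
rewrite pick_none => [|e']; last first.
  apply/eqP; case: ifP => de'; first by move/segment_inj => ee; rewrite ee de in de'.
  by move/esym/segment_flip.
rewrite (pick_unique (e := e)) ?de // => e'; case: ifP => _ /eqP.
  by move/segment_flip.
by move/flip_inj/segment_inj.
Qed.

Lemma side_flip e : side_intpart dir lam (flip (segment e)) = conj_intpart (oriented e).
Proof.
rewrite /side_intpart /oriented /right_left flipK; case: ifP => de.
  rewrite pick_none => [|e']; last first.
    apply/eqP; case: ifP => de'; first by move/segment_flip.
    by move/flip_inj/segment_inj => ee; rewrite ee de in de'.
  rewrite (pick_unique (e := e)) ?de // => e'; case: ifP => _ /eqP; first exact: segment_inj.
  by move/esym/segment_flip.
rewrite (pick_unique (e := e)) ?de ?conj_intpartK // => e'; case: ifP => _ /eqP.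
  by move/segment_flip.
by move/flip_inj/segment_inj.
Qed.

Lemma side_seg k : (k < 9)%N -> side_intpart dir lam (seg k) = oriented (ed k).
Proof. by move=> k9; rewrite -segmentE // side_segment. Qed.

Lemma side_flip_seg k : (k < 9)%N ->
  side_intpart dir lam (flip (seg k)) = conj_intpart (oriented (ed k)).
Proof. by move=> k9; rewrite -segmentE // side_flip. Qed.

Lemma side_boundary s : all (fun k => (seg k != s) && (seg k != flip s)) (iota 0 9) ->
  side_intpart dir lam s = empty_intpart.
Proof.
move=> h; rewrite /side_intpart !pick_none //; apply: edP => k k9;
  have /andP[h1 h2] := all_seg h k9; rewrite /right_left segmentE //; case: ifP => _ //.
- by rewrite (inj_eq flip_inj).
- by apply: contra h2 => /eqP <-; rewrite flipK.
Qed.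

Local Notation o k := (oriented (ed k)).
Local Notation o' k := (conj_intpart (oriented (ed k))).

Lemma prod_triangles (R : realType) :
  \prod_(v <- triangles) triangle_vertex R dir lam v =
  top_vertex R (o 0) (o' 1) (o 3) * top_vertex R (o' 4) (o 1) empty_intpart *
  top_vertex R empty_intpart (o' 2) (o 4) * top_vertex R (o' 3) (o 2) empty_intpart *
  (top_vertex R empty_intpart (o' 5) (o 7) * top_vertex R (o' 8) (o 5) empty_intpart *
  top_vertex R (o' 0) (o' 6) (o 8) * top_vertex R (o' 7) (o 6) empty_intpart).
Proof.
have T (v : lattice_pt * lattice_pt * lattice_pt) l1 l2 l3 :
    side_intpart dir lam (v.1.1, v.1.2) = l1 -> side_intpart dir lam (v.1.2, v.2) = l2 ->
    side_intpart dir lam (v.2, v.1.1) = l3 ->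
  triangle_vertex R dir lam v = top_vertex R l1 l2 l3 by move=> <- <- <-.
have B s : all (fun k => (seg k != s) && (seg k != flip s)) (iota 0 9) ->
  side_intpart dir lam s = empty_intpart by exact: side_boundary.
have e k : (k < 9)%N -> side_intpart dir lam (seg k) = o k by exact: side_seg.
have e' k : (k < 9)%N -> side_intpart dir lam (flip (seg k)) = o' k by exact: side_flip_seg.
rewrite /triangles (@prod8 ratfun).
rewrite (T ((1, 0), (0, 1), (0, 0)) _ _ _ (e 0%N isT) (e' 1%N isT) (e 3%N isT)).
rewrite (T ((-1, 0), (0, 0), (0, 1)) _ _ _ (e' 4%N isT) (e 1%N isT) (B ((0, 1), (-1, 0)) isT)).
rewrite (T ((-1, 0), (0, -1), (0, 0)) _ _ _ (B ((-1, 0), (0, -1)) isT) (e' 2%N isT) (e 4%N isT)).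
rewrite (T ((1, 0), (0, 0), (0, -1)) _ _ _ (e' 3%N isT) (e 2%N isT) (B ((0, -1), (1, 0)) isT)).
rewrite (T ((2, 1), (1, 2), (1, 1)) _ _ _ (B ((2, 1), (1, 2)) isT) (e' 5%N isT) (e 7%N isT)).
rewrite (T ((0, 1), (1, 1), (1, 2)) _ _ _ (e' 8%N isT) (e 5%N isT) (B ((1, 2), (0, 1)) isT)).
rewrite (T ((0, 1), (1, 0), (1, 1)) _ _ _ (e' 0%N isT) (e' 6%N isT) (e 8%N isT)).
rewrite (T ((2, 1), (1, 1), (1, 0)) _ _ _ (e' 7%N isT) (e 6%N isT) (B ((1, 0), (2, 1)) isT)).
by [].
Qed.

(** The two intersection numbers are -1 and -1 on the edge of [Q_0], and 0 and -2 on the others;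
    reversing an edge exchanges right and left. *)
Lemma framingE k : (k < 9)%N ->
  framing dir (ed k) = if k == 0%N then 0 else if dir (ed k) then -1 else 1.
Proof.
move=> k9; rewrite /framing /right_left segmentE //.
have /all_seg/(_ k9)/andP[/eqP h1 /eqP h2] : all (fun k =>
  (((intersection1 (seg k) - intersection2 (seg k)) %/ 2)%Z == if k == 0%N then 0 else -1) &&
  (((intersection1 (flip (seg k)) - intersection2 (flip (seg k))) %/ 2)%Z ==
     if k == 0%N then 0 else 1)) (iota 0 9) by [].
by case: ifP => _; rewrite ?h1 ?h2.
Qed.

End Directed.

End ToricGraph.

(** * The vertex in the special cases occurring in the graph *)

Section VertexValues.

Variable R : realType.
Local Notation S := (skew_schur_q R).

Lemma skew_schur_q_sub la mu nu : ~~ sub_intpart mu la -> S la mu nu = 0.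
Proof.
move=> h; apply: lim_val_uniq (skew_schur_qE la mu nu) _.
apply: lim_val_eq (lim_val_cst (fun z _ => has_value0 z)) => z _.
by exists 0%N => N _; rewrite sk_sub.
Qed.

Lemma skew_schur_q_refl la nu : S la la nu = 1.
Proof.
apply: lim_val_uniq (skew_schur_qE la la nu) _.
apply: lim_val_eq (lim_val_cst (fun z _ => has_value1 z)) => z _.
by exists 0%N => N _; rewrite sk_refl.
Qed.

(** The third argument is a conjugate since the vertex contains the transpose of it. Terms vanish
    unless [m] is contained in [l3], which makes the sum finite. *)
Lemma top_vertexE l1 l2 l3 : top_vertex R l1 l2 (conj_intpart l3) =
  qhalf ^ (- kappa l3) * S l2 empty_intpart empty_intpart *
  \sum_(m <- ple (psize l3)) S l1 m (conj_intpart l2) * S l3 m l2.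
Proof.
rewrite /top_vertex kappa_conj conj_intpartK; congr (_ * _).
rewrite (fsum_list (r := ple (psize l3)) (P := xpredT)) ?uniq_ple // => m _ ne.
rewrite andbT mem_ple; apply: sub_part_psize; apply/sub_intpartP.
by apply: contraNT ne => h; rewrite (skew_schur_q_sub l2 h) mulr0.
Qed.

Lemma top_vertex_empty3 l1 l2 : top_vertex R l1 l2 empty_intpart =
  S l2 empty_intpart empty_intpart * S l1 empty_intpart (conj_intpart l2).
Proof.
rewrite -conj_empty top_vertexE conj_empty psize_empty.
have -> : ple 0 = [:: empty_intpart].
  by rewrite -peq0 /peq; apply/esym/all_filterP/allP => m; rewrite mem_ple leqn0.
have -> : kappa empty_intpart = 0 by rewrite kappa_cells big_ord0.
by rewrite big_seq1 oppr0 expr0z mul1r skew_schur_q_refl mulr1.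
Qed.

Lemma top_vertex_empty1 l2 l3 : top_vertex R empty_intpart l2 (conj_intpart l3) =
  qhalf ^ (- kappa l3) * S l2 empty_intpart empty_intpart * S l3 empty_intpart l2.
Proof.
rewrite top_vertexE; congr (_ * _).
rewrite (bigD1_seq empty_intpart) ?mem_ple ?psize_empty ?uniq_ple //= skew_schur_q_refl mul1r.
rewrite big1 ?addr0 // => m m0; rewrite skew_schur_q_sub ?mul0r //.
apply: contra m0 => /sub_intpartP/sub_part_psize; rewrite psize_empty leqn0.
by rewrite psize_eq0.
Qed.

End VertexValues.

(** * Sums over the labellings *)

Section LabelSums.

Variables (R : realType) (dir : edge -> bool).
Local Notation S := (skew_schur_q R).
Local Notation S0 la := (skew_schur_q R la empty_intpart empty_intpart).

(* The directions for which the matching with the right-hand side is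
   [mu^1_1 = l 2], [mu^1_2 = l 1], [mu^2_1 = l 5], [mu^2_2 = l 6]. *)
Definition dir0 (e : edge) : bool := (e : nat) \in [:: 0; 1; 5]%N.

(** Reversing an edge conjugates its label, so this bijection of the labellings reduces every choice
    of directions to [dir0]. *)
Definition relabel (l : labelling) : labelling :=
  [ffun e => if dir e == dir0 e then l e else conj_intpart (l e)].

Lemma relabelK : involutive relabel.
Proof.
by move=> l; apply/ffunP => e; rewrite !ffunE; case: (_ == _); rewrite ?conj_intpartK.
Qed.

Lemma psize_relabel (l : labelling) e : psize (relabel l e) = psize (l e).
Proof. by rewrite ffunE; case: ifP; rewrite ?psize_conj. Qed.

Lemma oriented_relabel (l : labelling) k : (k < 9)%N -> oriented dir (relabel l) (ed k) =
  if k \in [:: 0; 1; 5]%N then l (ed k) else conj_intpart (l (ed k)).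
Proof.
move=> k9; rewrite /oriented ffunE /dir0 /ed inordK //.
by case: (dir _); case: (k \in _); rewrite /= ?conj_intpartK.
Qed.

Lemma edge_factor (l : labelling) k : (k < 9)%N ->
  (-1) ^ ((psize (relabel l (ed k)))%:Z * (framing dir (ed k) + 1)) *
    qhalf ^ (kappa (relabel l (ed k)) * framing dir (ed k)) =
  if k == 0%N then (-1) ^+ psize (l (ed k))
  else qhalf ^ (if k \in [:: 1; 5]%N then - kappa (l (ed k)) else kappa (l (ed k))).
Proof.
move=> k9; rewrite psize_relabel framingE //; case: eqP => [->|/eqP k0].
  by rewrite add0r mulr0 mulr1 expr0z mulr1.
(* The framing is 1 or -1 here, so the exponent is twice the size or 0. *)
have -> : (-1 : ratfun) ^ ((psize (l (ed k)))%:Z * ((if dir (ed k) then -1 else 1) + 1)) = 1.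
  case: (dir _); first by rewrite addNr mulr0 expr0z.
  have -> : (psize (l (ed k)))%:Z * (1 + 1) = (2 * psize (l (ed k)))%N%:Z by lia.
  by rewrite -exprnP exprM sqrrN expr1n expr1n.
rewrite mul1r ffunE /dir0 /ed inordK //.
have -> : (k \in [:: 0; 1; 5]%N) = (k \in [:: 1; 5]%N) by rewrite in_cons (negbTE k0).
congr (_ ^ _); case: (dir _); case: (k \in _); rewrite /= ?kappa_conj; lia.
Qed.

(** What depends only on the four labels carrying [Q_(B_1)] and [Q_(B_2)]: each such edge lies
    between two vertices, which contribute the Schur functions of its label and of the conjugate. *)
Definition prefactor (be pi ga de : intpart) : ratfun :=
  qhalf ^ (kappa be - kappa pi - kappa de + kappa ga) *
  (S0 be * S0 (conj_intpart be)) * (S0 pi * S0 (conj_intpart pi)) *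
  (S0 ga * S0 (conj_intpart ga)) * (S0 de * S0 (conj_intpart de)).

Lemma prod9 (K : comNzRingType) (F : nat -> K) : \prod_(k <- iota 0 9) F k =
  F 0%N * F 1%N * F 2%N * F 3%N * F 4%N * F 5%N * F 6%N * F 7%N * F 8%N.
Proof. by rewrite /= !big_cons big_nil mulr1 !mulrA. Qed.

(** The framing powers of the four fibre edges cancel against the [kappa] powers of the vertices.
    Abstract field elements give [field] atoms to work with. *)
Lemma amplitude_algebra (K : fieldType) (F : nat -> K) (t1 t2 t3 t4 t5 t6 t7 t8 : K)
    (s xP xB x3 x4 xT xC x7 x8 P P' B B' T T' C C' : K)
    (v1 v2 v3 v4 v5 v6 v7 v8 pre : K) :
    xP != 0 -> x3 != 0 -> x4 != 0 -> xT != 0 -> x7 != 0 -> x8 != 0 ->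
    F 0%N = s -> F 1%N = xP^-1 -> F 2%N = xB -> F 3%N = x3 -> F 4%N = x4 ->
    F 5%N = xT^-1 -> F 6%N = xC -> F 7%N = x7 -> F 8%N = x8 ->
    t1 = x3^-1 * P' * v1 -> t2 = P * v2 -> t3 = x4^-1 * B * v3 -> t4 = B' * v4 ->
    t5 = x7^-1 * T' * v5 -> t6 = T * v6 -> t7 = x8^-1 * C * v7 -> t8 = C' * v8 ->
    pre = xB * xP^-1 * xT^-1 * xC ->
  (\prod_(k <- iota 0 9) F k) * (t1 * t2 * t3 * t4 * (t5 * t6 * t7 * t8)) =
  pre * (B * B') * (P * P') * (C * C') * (T * T') *
    (s * (v3 * v2 * (v8 * v5) * (v4 * v1 * (v6 * v7)))).
Proof.
move=> p0 x30 x40 t0 x70 x80; rewrite prod9.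
by do 18!(move=> ->); field; rewrite ?p0 ?x30 ?x40 ?t0 ?x70 ?x80.
Qed.

Lemma qhalf_expr4 (a b c d : int) : qhalf ^ (a - b - c + d) =
  qhalf ^ a * (qhalf ^ b)^-1 * (qhalf ^ c)^-1 * qhalf ^ d.
Proof.
have N (k : int) : qhalf ^ (- k) = (qhalf ^ k)^-1 by rewrite invr_expz.
by rewrite !(expfzDr _ _ qhalf_neq0) !N.
Qed.

Definition strip_summand (be pi ga de l0 l3 l4 l7 l8 : intpart) : ratfun :=
  (-1) ^+ psize l0 *
   (S l4 empty_intpart be * S l4 empty_intpart (conj_intpart pi) *
    (S l7 empty_intpart ga * S l7 empty_intpart (conj_intpart de)) *
    ((S l3 empty_intpart be *
        \sum_(m <- ple (psize l3)) S l0 m pi * S l3 m (conj_intpart pi)) *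
     (S l8 empty_intpart (conj_intpart de) *
        \sum_(m <- ple (psize l8)) S (conj_intpart l0) m (conj_intpart ga) * S l8 m ga))).

Lemma amplitude_relabel (l : labelling) (x := fun k => l (ed k)) : amplitude R dir (relabel l) =
  prefactor (x 2%N) (x 1%N) (x 6%N) (x 5%N) *
  strip_summand (x 2%N) (x 1%N) (x 6%N) (x 5%N) (x 0%N) (x 3%N) (x 4%N) (x 7%N) (x 8%N).
Proof.
have N k : qhalf ^ (- k) = (qhalf ^ k)^-1 by rewrite invr_expz.
have X0 k : qhalf ^ k != 0 by apply: expfz_neq0; apply: qhalf_neq0.
have o k : (k < 9)%N -> k \in [:: 0; 1; 5]%N -> oriented dir (relabel l) (ed k) = x k.
  by move=> k9 h; rewrite oriented_relabel // h.
have o' k : (k < 9)%N -> k \notin [:: 0; 1; 5]%N ->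
    oriented dir (relabel l) (ed k) = conj_intpart (x k).
  by move=> k9 h; rewrite oriented_relabel // (negbTE h).
rewrite /amplitude big_ed prod_triangles /prefactor /strip_summand.
refine (amplitude_algebra
  (X0 (kappa (x 1%N))) (X0 (kappa (x 3%N))) (X0 (kappa (x 4%N))) (X0 (kappa (x 5%N)))
  (X0 (kappa (x 7%N))) (X0 (kappa (x 8%N))) (edge_factor l (k := 0%N) isT)
  (etrans (edge_factor l (k := 1%N) isT) (N _)) (edge_factor l (k := 2%N) isT)
  (edge_factor l (k := 3%N) isT) (edge_factor l (k := 4%N) isT)
  (etrans (edge_factor l (k := 5%N) isT) (N _)) (edge_factor l (k := 6%N) isT)
  (edge_factor l (k := 7%N) isT) (edge_factor l (k := 8%N) isT) _ _ _ _ _ _ _ _ _).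
- by rewrite (o 0%N) // (o 1%N) // (o' 3%N) // top_vertexE N conj_intpartK.
- by rewrite (o 1%N) // (o' 4%N) // conj_intpartK top_vertex_empty3.
- by rewrite (o' 2%N) // (o' 4%N) // conj_intpartK top_vertex_empty1 N.
- by rewrite (o' 2%N) // (o' 3%N) // conj_intpartK top_vertex_empty3 conj_intpartK.
- by rewrite (o 5%N) // (o' 7%N) // top_vertex_empty1 N.
- by rewrite (o 5%N) // (o' 8%N) // conj_intpartK top_vertex_empty3.
- by rewrite (o 0%N) // (o' 6%N) // (o' 8%N) // conj_intpartK top_vertexE N.
- by rewrite (o' 6%N) // (o' 7%N) // conj_intpartK top_vertex_empty3 conj_intpartK.
exact: qhalf_expr4.
Qed.

Definition ppairs (f : nat) : seq (intpart * intpart) :=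
  [seq x <- [seq (a, b) | a <- ple f, b <- ple f] | (psize x.1 + psize x.2 == f)%N].

Lemma mem_ppairs f x : (x \in ppairs f) = (psize x.1 + psize x.2 == f)%N.
Proof.
rewrite mem_filter andb_idr // => /eqP <-; apply/allpairsP; exists x; rewrite !mem_ple.
by split; [exact: leq_addr|exact: leq_addl|case: x].
Qed.

Lemma uniq_ppairs f : uniq (ppairs f).
Proof.
by apply: filter_uniq; apply: allpairs_uniq; rewrite ?uniq_ple // => -[? ?] [? ?].
Qed.

Lemma big_ppairs f (V : nmodType) (G : intpart -> intpart -> V) :
  \sum_(x <- ppairs f) G x.1 x.2 =
  \sum_(i < f.+1) \sum_(a <- peq i) \sum_(b <- peq (f - i)) G a b.
Proof.
rewrite /ppairs big_filter big_mkcond big_allpairs_dep /= big_ple_peq.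
apply: eq_bigr => i _; rewrite big_seq [RHS]big_seq; apply: eq_bigr => a.
rewrite mem_peq => /eqP ai; rewrite (big_peq_ple (n := f) _ xpredT) ?leq_subr //.
rewrite -big_mkcond; apply: eq_bigl => b /=.
by have := ltn_ord i; rewrite ai; lia.
Qed.

Definition surf_seq b1 b2 := [seq (p, q) | p <- ppairs b1, q <- ppairs b2].

Definition strip_seq n0 f1 f2 :=
  [seq (p, q) | p <- [seq (l, p) | l <- peq n0, p <- ppairs f1], q <- ppairs f2].

(* The lists are ordered as [(mu^1_1, mu^1_2), (mu^2_1, mu^2_2)] and
   [l 0, (l 4, l 3), (l 7, l 8)]. *)
Definition mk_labelling (x : (intpart * intpart) * (intpart * intpart))
    (y : intpart * (intpart * intpart) * (intpart * intpart)) : labelling :=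
  [ffun e : edge => nth empty_intpart
    [:: y.1.1; x.1.2; x.1.1; y.1.2.2; y.1.2.1; x.2.1; x.2.2; y.2.1; y.2.2] e].

Definition mn5 n0 f1 f2 b1 b2 : multinom 5 :=
  @Multinom 5 [tuple of rcons (rcons (multinom_val (mn3 n0 f1 f2)) b1) b2].

Lemma edge_varE k : (k < 9)%N ->
  (edge_var (ed k) : nat) = nth 0%N [:: 0; 3; 3; 1; 1; 4; 4; 2; 2]%N k.
Proof.
move=> k9; rewrite /edge_var (tnth_nth ((0, 0), (0, 0), ord0)) /= inordK //.
by case: k k9 => [|[|[|[|[|[|[|[|[|//]]]]]]]]] _ /=;
  rewrite /Q0 /QF1 /QF2 /QB1 /QB2 inordK.
Qed.

Lemma edge_degreeE (l : labelling) (i : 'I_5) : edge_degree l i =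
  (\sum_(k <- iota 0 9 | nth 0%N [:: 0; 3; 3; 1; 1; 4; 4; 2; 2]%N k == i) psize (l (ed k)))%N.
Proof.
rewrite /edge_degree big_ed big_seq_cond [RHS]big_seq_cond; apply: eq_bigl => k.
by rewrite mem_iota /=; case: (ltnP k 9) => //= k9; rewrite -edge_varE // -val_eqE.
Qed.

Lemma edge_monomialE (l : labelling) n0 f1 f2 b1 b2 (x := fun k => psize (l (ed k))) :
  edge_monomial l = mn5 n0 f1 f2 b1 b2 <->
  [/\ x 0%N = n0, (x 4 + x 3 = f1)%N, (x 7 + x 8 = f2)%N, (x 2 + x 1 = b1)%N &
      (x 5 + x 6 = b2)%N].
Proof.
have deg (i : 'I_5) : edge_monomial l i = edge_degree l i.
  by rewrite multinomE tnth_mktuple.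
have val5 (i : 'I_5) : mn5 n0 f1 f2 b1 b2 i = nth 0%N [:: n0; f1; f2; b1; b2] i.
  by rewrite multinomE (tnth_nth 0%N).
have E (i : 'I_5) : edge_degree l i = nth 0%N
    [:: x 0; x 4 + x 3; x 7 + x 8; x 2 + x 1; x 5 + x 6]%N i.
  rewrite edge_degreeE /= !big_cons big_nil -!/(x _).
  by case: i => -[|[|[|[|[|//]]]]] i5 /=; rewrite /x; lia.
split=> [e|[e0 e1 e2 e3 e4]].
  have h (i : 'I_5) : nth 0%N [:: x 0; x 4 + x 3; x 7 + x 8; x 2 + x 1; x 5 + x 6]%N i =
    nth 0%N [:: n0; f1; f2; b1; b2] i by rewrite -E -deg e val5.
  split.
  - exact: (h (@Ordinal 5 0 isT)).
  - exact: (h (@Ordinal 5 1 isT)).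
  - exact: (h (@Ordinal 5 2 isT)).
  - exact: (h (@Ordinal 5 3 isT)).
  - exact: (h (@Ordinal 5 4 isT)).
by apply/mnmP => i; rewrite deg val5 E e0 e1 e2 e3 e4.
Qed.

Lemma sum_strip_seq be pi ga de n0 f1 f2 :
  \sum_(y <- strip_seq n0 f1 f2)
    strip_summand be pi ga de y.1.1 y.1.2.2 y.1.2.1 y.2.1 y.2.2 = strip R be pi ga de n0 f1 f2.
Proof.
rewrite /strip_seq big_allpairs_dep /= big_allpairs_dep /=.
pose c (l0 l4 l7 : intpart) := S l4 empty_intpart be * S l4 empty_intpart (conj_intpart pi) *
    (S l7 empty_intpart ga * S l7 empty_intpart (conj_intpart de)).
pose u (l0 l3 : intpart) := S l3 empty_intpart be *
  \sum_(m <- ple (psize l3)) S l0 m pi * S l3 m (conj_intpart pi).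
pose v (l0 l8 : intpart) := S l8 empty_intpart (conj_intpart de) *
  \sum_(m <- ple (psize l8)) S (conj_intpart l0) m (conj_intpart ga) * S l8 m ga.
transitivity (\sum_(l0 <- peq n0) (-1) ^+ n0 *
  ((\sum_(i < f1.+1) \sum_(l4 <- peq i) \sum_(l3 <- peq (f1 - i))
     S l4 empty_intpart be * S l4 empty_intpart (conj_intpart pi) * u l0 l3) *
   (\sum_(j < f2.+1) \sum_(l7 <- peq j) \sum_(l8 <- peq (f2 - j))
     S l7 empty_intpart ga * S l7 empty_intpart (conj_intpart de) * v l0 l8))).
  rewrite big_seq [RHS]big_seq; apply: eq_bigr => l0; rewrite mem_peq => /eqP l0n.
  rewrite -(big_ppairs f1 (fun l4 l3 =>
    S l4 empty_intpart be * S l4 empty_intpart (conj_intpart pi) * u l0 l3)).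
  rewrite -(big_ppairs f2 (fun l7 l8 =>
    S l7 empty_intpart ga * S l7 empty_intpart (conj_intpart de) * v l0 l8)).
  rewrite mulr_suml mulr_sumr; apply: eq_bigr => p _.
  rewrite !mulr_sumr; apply: eq_bigr => q _; rewrite /strip_summand l0n -/(u l0 p.2) -/(v l0 q.2).
  by congr (_ * _); rewrite mulrACA.
rewrite /strip.
pose U l0 n := \sum_(a <- peq n) S a empty_intpart be *
       \sum_(m <- ple n) S l0 m pi * S a m (conj_intpart pi).
pose V l0 n := \sum_(a <- peq n) S a empty_intpart (conj_intpart de) *
       \sum_(m <- ple n) S (conj_intpart l0) m (conj_intpart ga) * S a m ga.
have mE n1 n2 : middle R be pi ga de n0 n1 n2 =
  (-1) ^+ n0 * \sum_(l <- peq n0) U l n1 * V l n2 by [].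
have uE l0 i n : \sum_(l4 <- peq i) \sum_(l3 <- peq n)
     S l4 empty_intpart be * S l4 empty_intpart (conj_intpart pi) * u l0 l3 =
    cauchy_coef R be (conj_intpart pi) i * U l0 n.
  rewrite /cauchy_coef mulr_suml; apply: eq_bigr => l4 _; rewrite -mulr_sumr; congr (_ * _).
  by rewrite /U big_seq [RHS]big_seq; apply: eq_bigr => l3; rewrite mem_peq /u => /eqP ->.
have vE l0 i n : \sum_(l7 <- peq i) \sum_(l8 <- peq n)
     S l7 empty_intpart ga * S l7 empty_intpart (conj_intpart de) * v l0 l8 =
    cauchy_coef R ga (conj_intpart de) i * V l0 n.
  rewrite /cauchy_coef mulr_suml; apply: eq_bigr => l7 _; rewrite -mulr_sumr; congr (_ * _).
  by rewrite /V big_seq [RHS]big_seq; apply: eq_bigr => l8; rewrite mem_peq /v => /eqP ->.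
clearbody U V.
under eq_bigr do under eq_bigr do rewrite uE.
under eq_bigr do under [X in _ * (_ * X)]eq_bigr do rewrite vE.
under [RHS]eq_bigr do under eq_bigr do rewrite mE mulrCA 2!mulr_sumr.
under [RHS]eq_bigr do rewrite exchange_big /= mulr_sumr.
rewrite [RHS]exchange_big /=; apply: eq_bigr => l0 _.
rewrite mulr_suml mulr_sumr; apply: eq_bigr => i _.
rewrite !mulr_sumr; apply: eq_bigr => j _.
by ring.
Qed.

Lemma uniq_surf_seq b1 b2 : uniq (surf_seq b1 b2).
Proof. by apply: allpairs_uniq; rewrite ?uniq_ppairs // => -[? ?] [? ?]. Qed.

Lemma mem_surf_seq b1 b2 x : (x \in surf_seq b1 b2) =
  (psize x.1.1 + psize x.1.2 == b1)%N && (psize x.2.1 + psize x.2.2 == b2)%N.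
Proof.
case: x => p q; rewrite -!mem_ppairs; apply/allpairsP/andP => [[[p' q'] [h1 h2 [-> ->]]]//|[h1 h2]].
by exists (p, q).
Qed.

Lemma uniq_strip_seq n0 f1 f2 : uniq (strip_seq n0 f1 f2).
Proof.
apply: allpairs_uniq; rewrite ?uniq_ppairs //; last by move=> [? ?] [? ?].
by apply: allpairs_uniq; rewrite ?uniq_ppairs ?uniq_peq // => -[? ?] [? ?].
Qed.

Lemma mem_strip_seq n0 f1 f2 y : (y \in strip_seq n0 f1 f2) =
  [&& psize y.1.1 == n0, psize y.1.2.1 + psize y.1.2.2 == f1 &
      psize y.2.1 + psize y.2.2 == f2]%N.
Proof.
case: y => [[l p] q]; rewrite -mem_peq -!mem_ppairs.
apply/allpairsP/and3P => [[[[l' p'] q'] [/allpairsP[[l'' p''] [h1 h2 [-> ->]]] h3 [-> -> ->]]]//|[h1 h2 h3]].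
exists ((l, p), q); split=> //; apply/allpairsP; by exists (l, p).
Qed.

Lemma mk_labellingE x y k : (k < 9)%N -> mk_labelling x y (ed k) = nth empty_intpart
    [:: y.1.1; x.1.2; x.1.1; y.1.2.2; y.1.2.1; x.2.1; x.2.2; y.2.1; y.2.2] k.
Proof. by move=> k9; rewrite ffunE /ed inordK. Qed.

Lemma coef_Z_X b1 b2 n0 f1 f2 : coef_QB b1 b2 (Z_X R dir) (mn3 n0 f1 f2) =
  \sum_(x <- surf_seq b1 b2)
    prefactor x.1.1 x.1.2 x.2.2 x.2.1 * strip R x.1.1 x.1.2 x.2.2 x.2.1 n0 f1 f2.
Proof.
rewrite /coef_QB -/(mn5 n0 f1 f2 b1 b2) /Z_X.
rewrite (reindex_fsbig relabel [set l : labelling | edge_monomial l = mn5 n0 f1 f2 b1 b2]);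
  last first.
  have mono l : edge_monomial (relabel l) = edge_monomial l.
    by apply/mnmP => i; rewrite !multinomE !tnth_mktuple; apply: eq_bigr => e _; rewrite psize_relabel.
  split=> [l /= <-|l l' _ _|l /= e]; first exact: mono.
    exact: (inv_inj relabelK).
  by exists (relabel l); rewrite ?relabelK //= mono.
pose mk z := mk_labelling z.1 z.2.
rewrite (fsum_list (P := xpredT)
  (r := [seq mk z | z <- [seq (x, y) | x <- surf_seq b1 b2, y <- strip_seq n0 f1 f2]])).
- rewrite big_map big_allpairs_dep; apply: eq_bigr => x _.
  rewrite -sum_strip_seq mulr_sumr; apply: eq_bigr => y _.
  by rewrite amplitude_relabel /mk /= !mk_labellingE.
- rewrite map_inj_in_uniq.
    by apply: allpairs_uniq; rewrite ?uniq_surf_seq ?uniq_strip_seq // => -[? ?] [? ?].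
  move=> [x y] [x' y'] _ _ e.
  have h k : (k < 9)%N -> mk (x, y) (ed k) = mk (x', y') (ed k) by rewrite e.
  move: (h 0%N isT) (h 1%N isT) (h 2%N isT) (h 3%N isT) (h 4%N isT) (h 5%N isT) (h 6%N isT)
    (h 7%N isT) (h 8%N isT); rewrite /mk !mk_labellingE //= {h e}.
  move: x y x' y' => [[? ?] [? ?]] [[? [? ?]] [? ?]] [[? ?] [? ?]] [[? [? ?]] [? ?]] /=.
  by do 9!(move=> ->).
- move=> _ /mapP[_ /allpairsP[[x y] /= [hx hy ->]] ->] _ /=.
  move: hx hy; rewrite mem_surf_seq mem_strip_seq => /andP[/eqP h1 /eqP h2] /and3P[/eqP h3 /eqP h4 /eqP h5].
  by apply/edge_monomialE; rewrite /mk !mk_labellingE.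
- move=> l /= /edge_monomialE[h1 h2 h3 h4 h5] _; rewrite andbT; apply/mapP.
  pose x := ((l (ed 2), l (ed 1)), (l (ed 5), l (ed 6))).
  pose y := ((l (ed 0), (l (ed 4), l (ed 3))), (l (ed 7), l (ed 8))).
  exists (x, y).
    apply/allpairsP; exists (x, y).
    by rewrite mem_surf_seq mem_strip_seq /= h1 h2 h3 h4 h5 !eqxx.
  apply/ffunP; apply: edP => k k9; rewrite /mk mk_labellingE //=.
  by case: k k9 => [|[|[|[|[|[|[|[|[|//]]]]]]]]].
Qed.

End LabelSums.

(** * The instanton series *)

Lemma mn5E (d : multinom 5) : d = mn5 (d Q0) (d QF1) (d QF2) (d QB1) (d QB2).
Proof.
apply/mnmP => i; rewrite [RHS]multinomE (tnth_nth 0%N) /=.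
case: i => -[|[|[|[|[|//]]]]] i5 /=; congr (d _); apply: val_inj;
  by rewrite /Q0 /QF1 /QF2 /QB1 /QB2 /= inordK.
Qed.

Lemma mn5_eq a b c e f a' b' c' e' f' : mn5 a b c e f = mn5 a' b' c' e' f' <->
  [/\ a = a', b = b', c = c', e = e' & f = f'].
Proof. by split=> [[-> -> -> -> ->]|[-> -> -> -> ->]]. Qed.

Lemma mn5_coord a b c e f : [/\ mn5 a b c e f Q0 = a, mn5 a b c e f QF1 = b,
  mn5 a b c e f QF2 = c, mn5 a b c e f QB1 = e & mn5 a b c e f QB2 = f].
Proof.
by split; rewrite multinomE (tnth_nth 0%N) /= /Q0 /QF1 /QF2 /QB1 /QB2 inordK.
Qed.

Lemma mn5D a b c e f a' b' c' e' f' : mnm_add (mn5 a b c e f) (mn5 a' b' c' e' f') =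
  mn5 (a + a') (b + b') (c + c') (e + e') (f + f').
Proof.
rewrite [LHS]mn5E !mnmDE.
have [-> -> -> -> ->] := mn5_coord a b c e f.
by have [-> -> -> -> ->] := mn5_coord a' b' c' e' f'.
Qed.

(** As [g] contains neither [Q_(B_1)] nor [Q_(B_2)], these degrees come from [f] alone and the
    coefficients multiply as series in the other three variables. *)
Lemma coef_QB_mul (f g : pser 5 ratfun) b1 b2 :
    (forall d : multinom 5, (d QB1 != 0%N) || (d QB2 != 0%N) -> g d = 0) ->
  coef_QB b1 b2 (f * g) = (coef_QB b1 b2 f : pser 3 ratfun) * (coef_QB 0 0 g : pser 3 ratfun).
Proof.
move=> g0; apply: pser3P => a b c; rewrite pser3M /coef_QB -/(mn5 a b c b1 b2).
pose h (x : 'I_a.+1 * ('I_b.+1 * 'I_c.+1)) :=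
  (mn5 x.1 x.2.1 x.2.2 b1 b2, mn5 (a - x.1) (b - x.2.1) (c - x.2.2) 0 0).
rewrite pserM /mseries_mul (fsum_list (r := [seq h x | x <- enum {: 'I_a.+1 * ('I_b.+1 * 'I_c.+1)}])
  (P := xpredT)).
- rewrite big_map big_enum /= pair_bigA /= pair_bigA /=.
  rewrite (reindex (fun x : 'I_a.+1 * 'I_b.+1 * 'I_c.+1 => (x.1.1, (x.1.2, x.2)))) //=.
  by exists (fun x => ((x.1, x.2.1), x.2.2)) => [[[]]|[? []]].
- rewrite map_inj_uniq ?enum_uniq // => -[i [j k]] [i' [j' k']] [e1 e2 e3 _ _ _].
  by congr (_, (_, _)); apply: val_inj.
- move=> _ /mapP[[i [j k]] _ ->] _ /=; rewrite mn5D.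
  have := ltn_ord i; have := ltn_ord j; have := ltn_ord k => hk hj hi.
  by congr mn5; lia.
- move=> [x y] /=; rewrite [x]mn5E [y]mn5E mn5D => /mn5_eq[ea eb ec e1 e2] ne.
  rewrite andbT; apply/mapP.
  have [y1 y2] : y QB1 = 0%N /\ y QB2 = 0%N.
    split; apply/eqP; apply: contraNT ne => y0; rewrite g0 ?mulr0 //;
    by have [_ _ _ -> ->] := mn5_coord (y Q0) (y QF1) (y QF2) (y QB1) (y QB2); rewrite y0 ?orbT.
  have ha : (x Q0 < a.+1)%N by lia.
  have hb : (x QF1 < b.+1)%N by lia.
  have hc : (x QF2 < c.+1)%N by lia.
  exists (Ordinal ha, (Ordinal hb, Ordinal hc)); rewrite ?mem_enum // /h /=.
  by congr (_, _); apply/mn5_eq; split; lia.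
Qed.

Section Instanton.

Variables (R : realType) (dir : edge -> bool).
Local Notation e0 := empty_intpart.
Local Notation strip0 := (strip_series R e0 e0 e0 e0).
Local Notation Z := (Z_X R dir : pser 5 ratfun).

Lemma prefactor_empty : prefactor R e0 e0 e0 e0 = 1.
Proof.
have -> : prefactor R e0 e0 e0 e0 = qhalf ^ (0 : int).
  rewrite /prefactor conj_empty skew_schur_q_empty !mulr1.
  by rewrite (_ : kappa e0 = 0) // kappa_cells big_ord0.
by rewrite expr0z.
Qed.

Lemma coef_Z_X_series b1 b2 : coef_QB b1 b2 Z = \sum_(x <- surf_seq b1 b2)
  pconst (prefactor R x.1.1 x.1.2 x.2.2 x.2.1) * strip_series R x.1.1 x.1.2 x.2.2 x.2.1.
Proof.
apply: pser3P => a b c; rewrite coef_Z_X pser_sum; apply: eq_bigr => x _.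
by rewrite pconstM strip_seriesE.
Qed.

Lemma coef_QB_Z0 : coef_QB 0 0 (at_QB0 Z) = strip0.
Proof.
have -> : coef_QB 0 0 (at_QB0 Z) = coef_QB 0 0 Z.
  apply: funext => d; rewrite [d]mn3E /coef_QB -/(mn5 _ _ _ 0 0) /at_QB0.
  by have [_ _ _ -> ->] := mn5_coord (d ord0) (d (inord 1)) (d (inord 2)) 0 0.
rewrite coef_Z_X_series.
have -> : surf_seq 0 0 = [:: ((e0, e0), (e0, e0))].
  apply: perm_small_eq => //; apply: uniq_perm; rewrite ?uniq_surf_seq // => x.
  rewrite mem_surf_seq !addn_eq0 !psize_eq0 mem_seq1.
  by case: x => [[x1 x2] [x3 x4]] /=; rewrite -!pair_eqE /= /pair_eq /= -!pair_eqE.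
rewrite big_seq1 /= prefactor_empty.
by apply: funext => d; rewrite pconstM mul1r.
Qed.

Definition pinv n (K : fieldType) (f : pser n K) : pser n K :=
  xget 0 [set g | f * g = 1].

Lemma pinvP n (K : fieldType) (f : pser n K) : f mnm0 = 1 -> f * pinv f = 1.
Proof. by move/pser_inv => h; apply: (xgetPex 0 (P := [set g | f * g = 1])). Qed.

(** Division by the part without [Q_B] is division of each coefficient by the series of the empty
    labels, and [strip_ratio] cancels that series. *)
Lemma coef_Z_X_inst b1 b2 : coef_QB b1 b2 (Z_X_inst R dir) = \sum_(x <- surf_seq b1 b2)
  pconst (prefactor R x.1.1 x.1.2 x.2.2 x.2.1) * strip_num x.1.1 x.1.2 x.2.2 x.2.1 *
  pinv (strip_den x.1.1 x.1.2 x.2.2 x.2.1).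
Proof.
have s0 := pinvP (strip0_const R).
have Z0 : (at_QB0 Z : pser 5 ratfun) mnm0 = 1.
  rewrite -(strip0_const R) -coef_QB_Z0 /coef_QB; congr at_QB0.
  by rewrite [mnm0]mn5E !mnm0E [in RHS](mn3E mnm0) !mnm0E.
have := pinvP Z0; set W := pinv _ => ZW.
have inst : (Z_X_inst R dir : pser 5 ratfun) * at_QB0 Z = Z.
  by rewrite /Z_X_inst (mseries_divE _ ZW) -mulrA [W * _]mulrC ZW mulr1.
have := @coef_QB_mul (Z_X_inst R dir) (at_QB0 Z) b1 b2.
rewrite inst coef_QB_Z0 => e.
have {}e : (coef_QB b1 b2 (Z_X_inst R dir) : pser 3 ratfun) * strip0 = coef_QB b1 b2 Z.
  by rewrite e // => d h; rewrite /at_QB0; move: h; case: eqP => //= _; case: eqP.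
rewrite -[LHS](mulr1 (coef_QB b1 b2 (Z_X_inst R dir) : pser 3 ratfun)) -s0 mulrA e.
rewrite coef_Z_X_series mulr_suml; apply: eq_bigr => x _.
have d1 := pinvP (strip_den_const x.1.1 x.1.2 x.2.2 x.2.1).
have r := strip_ratio R x.1.1 x.1.2 x.2.2 x.2.1.
move: (strip_series R x.1.1 _ _ _) (strip_den _ _ _ _) (pinv (strip_den _ _ _ _)) (strip_num _ _ _ _)
  (pinv strip0) strip0 (pconst _) d1 r s0 => s de ide nu is0 t0 c d1 r s0.
have -> : s = t0 * nu * ide by rewrite -r -mulrA d1 mulr1.
have ring_id (A : comNzRingType) (c' t nu' i p : A) :
  t * p = 1 -> c' * (t * nu' * i) * p = c' * nu' * i.
  by move=> tp; rewrite -[RHS]mulr1 -tp; ring.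
exact: ring_id s0.
Qed.

End Instanton.

(** * Expansions of rational functions *)

Section TpolySeries.

Implicit Types (P D : tpoly).

Definition of_tpoly P : pser 3 ratfun := mseries_of_tpoly P.

Lemma of_tpolyD P D : of_tpoly (P + D) = of_tpoly P + of_tpoly D.
Proof. by apply: funext => d; rewrite /of_tpoly /mseries_of_tpoly mcoeffD tofracD. Qed.

Lemma of_tpolyM P D : of_tpoly (P * D) = of_tpoly P * of_tpoly D.
Proof.
apply: funext => d; rewrite pserM (mseries_mulE _ _ (ltnSn _)) /of_tpoly /mseries_of_tpoly mcoeffM.
have h := @rmorph_sum _ _ (@tofrac {poly rat} : {rmorphism {poly rat} -> ratfun}).
rewrite h; apply: eq_bigr => k _; exact: tofracM.
Qed.

Lemma of_tpoly_inj : injective of_tpoly.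
Proof.
move=> P D e; apply/mpolyP => d; apply/eqP; rewrite -tofrac_eq; apply/eqP.
exact: (congr1 (fun f : pser 3 ratfun => f d) e).
Qed.

Lemma of_tpolyC (c : {poly rat}) : of_tpoly (mpolyC 3 c) = pconst (tofrac c).
Proof.
apply: funext => d; rewrite /of_tpoly /mseries_of_tpoly /pconst mcoeffC.
by case: eqP => _; rewrite ?mulr1 ?mulr0 ?tofrac0.
Qed.

Lemma of_tpoly1 : of_tpoly 1 = 1.
Proof.
apply: funext => d; rewrite /of_tpoly /mseries_of_tpoly mcoeff1 pser1.
by case: eqP => _; rewrite ?tofrac1 ?tofrac0.
Qed.

Lemma of_tpolyX m : of_tpoly (mpolyX _ m) = pmono ratfun m.
Proof.
apply: funext => d; rewrite /of_tpoly /mseries_of_tpoly mcoeffX /pmono eq_sym.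
by case: eqP => _; rewrite ?tofrac1 ?tofrac0.
Qed.

End TpolySeries.

Section PconstMorphism.

Variables (n : nat) (K : fieldType).

Lemma pconst_mul (a b : K) : pconst (a * b) = pconst a * pconst b :> pser n K.
Proof. by apply: funext => d; rewrite pconstM /pconst; case: eqP; rewrite ?mulr0. Qed.

Lemma pconstD (a b : K) : pconst (a + b) = pconst a + pconst b :> pser n K.
Proof. by apply: funext => d; rewrite pserD /pconst; case: eqP; rewrite ?addr0. Qed.

Lemma pconst1 : pconst 1 = 1 :> pser n K.
Proof. by apply: funext => d; rewrite pser1 /pconst; case: eqP. Qed.

Lemma pconstN (a : K) : pconst (- a) = - pconst a :> pser n K.
Proof. by apply: funext => d; rewrite pserN /pconst; case: eqP; rewrite ?oppr0. Qed.

Lemma pconst0 : pconst 0 = 0 :> pser n K.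
Proof. by apply: funext => d; rewrite /pconst; case: eqP. Qed.

End PconstMorphism.

(** * Expansions of rational functions together with their values *)

Section Represents.

Variable F : numFieldType.
Implicit Types (t x : F) (P D : tpoly) (f g : pser 3 ratfun).

Section Eval.

Variables (t x0 x1 x2 : F).
Local Notation ev := (eval_tpoly t x0 x1 x2).

Let peval_rmorphism : {rmorphism {poly rat} -> F} :=
  (horner_eval t \o map_poly ratr : {rmorphism {poly rat} -> F}).

Let vars (i : 'I_3) : F := nth 0 [:: x0; x1; x2] i.

Let evE P : ev P = mmap peval_rmorphism vars P. Proof. by []. Qed.

Lemma eval_tpolyD P D : ev (P + D) = ev P + ev D.
Proof. by rewrite !evE mmapD. Qed.

Lemma eval_tpolyM P D : ev (P * D) = ev P * ev D.
Proof. by rewrite !evE (mmap_is_multiplicative vars peval_rmorphism).1. Qed.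

Lemma eval_tpolyC c : ev (mpolyC 3 c) = peval t c.
Proof. by rewrite evE mmapC. Qed.

Lemma eval_tpoly1 : ev 1 = 1.
Proof. by rewrite evE (mmap_is_multiplicative vars peval_rmorphism).2. Qed.

Lemma eval_tpolyX a b c : ev (mpolyX _ (mn3 a b c)) = x0 ^+ a * x1 ^+ b * x2 ^+ c.
Proof.
rewrite evE mmapX /mmap1 !big_ord_recl big_ord0 mulr1 mulrA.
by rewrite !multinomE !(tnth_nth 0%N).
Qed.

End Eval.

Variable G : F -> F -> F -> F -> Prop.

(** Carries an expansion and its values together through ring operations; [G] restricts to points
    where the denominators do not vanish. *)
Definition represents f (v : F -> F -> F -> F -> F) : Prop :=
  exists P D, is_expansion f P D /\ forall t x0 x1 x2, G t x0 x1 x2 ->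
    eval_tpoly t x0 x1 x2 D != 0 /\
    eval_tpoly t x0 x1 x2 P / eval_tpoly t x0 x1 x2 D = v t x0 x1 x2.

Lemma represents_ext f v w : (forall t x0 x1 x2, G t x0 x1 x2 -> v t x0 x1 x2 = w t x0 x1 x2) ->
  represents f v -> represents f w.
Proof.
move=> e [P [D [h1 h2]]]; exists P, D; split=> // t x0 x1 x2 g.
by have [d0 e0] := h2 _ _ _ _ g; rewrite e0 e.
Qed.

Lemma is_expansionE f P D : is_expansion f P D <-> D != 0 /\ of_tpoly D * f = of_tpoly P.
Proof. by []. Qed.

Lemma represents_tpoly P v : (forall t x0 x1 x2, eval_tpoly t x0 x1 x2 P = v t x0 x1 x2) ->
  represents (of_tpoly P) v.
Proof.
move=> h; exists P, 1; split; first by rewrite is_expansionE oner_neq0 of_tpoly1 mul1r.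
by move=> t x0 x1 x2 _; rewrite eval_tpoly1 oner_neq0 divr1.
Qed.

Lemma representsM f g v w : represents f v -> represents g w ->
  represents (f * g) (fun t x0 x1 x2 => v t x0 x1 x2 * w t x0 x1 x2).
Proof.
move=> [P [D [/is_expansionE[D0 e] h]]] [P' [D' [/is_expansionE[D0' e'] h']]].
exists (P * P'), (D * D'); split.
  rewrite is_expansionE mulf_neq0 //; split=> //.
  by rewrite !of_tpolyM mulrACA e e'.
move=> t x0 x1 x2 g0; have [d0 <-] := h _ _ _ _ g0; have [d0' <-] := h' _ _ _ _ g0.
by rewrite !eval_tpolyM mulf_neq0 // mulf_div.
Qed.

Lemma representsD f g v w : represents f v -> represents g w ->
  represents (f + g) (fun t x0 x1 x2 => v t x0 x1 x2 + w t x0 x1 x2).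
Proof.
move=> [P [D [/is_expansionE[D0 e] h]]] [P' [D' [/is_expansionE[D0' e'] h']]].
exists (P * D' + P' * D), (D * D'); split.
  rewrite is_expansionE mulf_neq0 //; split=> //.
  rewrite of_tpolyD !of_tpolyM mulrDr -e -e'; congr (_ + _); first by rewrite mulrAC.
  by rewrite -mulrA mulrC.
move=> t x0 x1 x2 g0; have [d0 <-] := h _ _ _ _ g0; have [d0' <-] := h' _ _ _ _ g0.
by rewrite eval_tpolyD !eval_tpolyM mulf_neq0 // addf_div.
Qed.

(** Numerator and denominator change places: [P] is not the zero polynomial because [f] is
    invertible as a series, and its values are nonzero because those of [v] are. *)
Lemma representsV f g v : (forall t x0 x1 x2, G t x0 x1 x2 -> v t x0 x1 x2 != 0) ->
  f * g = 1 -> represents f v -> represents g (fun t x0 x1 x2 => (v t x0 x1 x2)^-1).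
Proof.
move=> v0 fg [P [D [/is_expansionE[D0 e] h]]]; exists D, P; split.
  have e' : of_tpoly P * g = of_tpoly D by rewrite -e -mulrA fg mulr1.
  rewrite is_expansionE; split=> //; apply: contra D0 => /eqP P0.
  apply/eqP; apply: of_tpoly_inj; rewrite -e' P0.
  have -> : of_tpoly 0 = 0.
    by apply: (addrI (of_tpoly 0)); rewrite -of_tpolyD !addr0.
  by rewrite mul0r.
move=> t x0 x1 x2 g0; have [d0 e'] := h _ _ _ _ g0; rewrite -e' invf_div; split=> //.
by have := v0 _ _ _ _ g0; rewrite -e' mulf_eq0 negb_or => /andP[].
Qed.

Lemma represents1 : represents 1 (fun _ _ _ _ => 1).
Proof. by rewrite -of_tpoly1; apply: represents_tpoly => *; apply: eval_tpoly1. Qed.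

Lemma representsN f v : represents f v -> represents (- f) (fun t x0 x1 x2 => - v t x0 x1 x2).
Proof.
move=> h; rewrite -mulN1r; apply: (represents_ext (v := fun t x0 x1 x2 => (-1) * v t x0 x1 x2)).
  by move=> *; rewrite mulN1r.
apply: (representsM (v := fun _ _ _ _ => -1)) h.
rewrite -pconst1 -pconstN -(tofrac1 {poly rat}) -tofracN -of_tpolyC.
apply: represents_tpoly => *; by rewrite eval_tpolyC pevalN peval1.
Qed.

Lemma represents0 : represents 0 (fun _ _ _ _ => 0).
Proof.
rewrite -pconst0 -(tofrac0 {poly rat}) -of_tpolyC.
by apply: represents_tpoly => *; rewrite eval_tpolyC peval0.
Qed.

Lemma represents_prod (I : Type) (s : seq I) (f : I -> pser 3 ratfun)
    (v : I -> F -> F -> F -> F -> F) :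
    (forall i, represents (f i) (v i)) ->
  represents (\prod_(i <- s) f i) (fun t x0 x1 x2 => \prod_(i <- s) v i t x0 x1 x2).
Proof.
move=> h; elim: s => [|i s IH].
  rewrite big_nil; apply: represents_ext represents1 => *; by rewrite big_nil.
rewrite big_cons; apply: represents_ext (representsM (h i) IH) => *.
by rewrite big_cons.
Qed.

Lemma represents_sum (I : Type) (s : seq I) (f : I -> pser 3 ratfun)
    (v : I -> F -> F -> F -> F -> F) :
    (forall i, represents (f i) (v i)) ->
  represents (\sum_(i <- s) f i) (fun t x0 x1 x2 => \sum_(i <- s) v i t x0 x1 x2).
Proof.
move=> h; elim: s => [|i s IH].
  rewrite big_nil; apply: represents_ext represents0 => *; by rewrite big_nil.
rewrite big_cons; apply: represents_ext (representsD (h i) IH) => *.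
by rewrite big_cons.
Qed.

Lemma represents_pmono a b c :
  represents (pmono ratfun (mn3 a b c)) (fun t x0 x1 x2 => x0 ^+ a * x1 ^+ b * x2 ^+ c).
Proof. by rewrite -of_tpolyX; apply: represents_tpoly => *; apply: eval_tpolyX. Qed.

Lemma represents_pconstV c (v : F -> F) : c != 0 ->
    (forall t x0 x1 x2, G t x0 x1 x2 -> v t != 0) ->
    represents (pconst c) (fun t _ _ _ => v t) ->
  represents (pconst c^-1) (fun t _ _ _ => (v t)^-1).
Proof.
by move=> c0 v0; apply: representsV; rewrite // -pconst_mul mulfV // pconst1.
Qed.

Hypothesis G0 : forall t x0 x1 x2, G t x0 x1 x2 -> t != 0.

Lemma represents_qhalf (k : int) : represents (pconst (qhalf ^ k)) (fun t _ _ _ => t ^ k).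
Proof.
have h n : represents (pconst (qhalf ^+ n)) (fun t _ _ _ => t ^+ n).
  rewrite /qhalf -tofracXn -of_tpolyC; apply: represents_tpoly => t *.
  by rewrite eval_tpolyC /peval map_polyXn hornerXn.
case: k => n; first exact: h.
rewrite NegzE -exprnN.
apply: (represents_pconstV (v := fun t => t ^+ n.+1)) (h _); first by rewrite expf_neq0 ?qhalf_neq0.
by move=> t x0 x1 x2 /G0 t0; rewrite expf_neq0.
Qed.

Lemma represents_factor (k : int) a b c :
  represents (1 - pconst (qhalf ^ k) * pmono ratfun (mn3 a b c))
    (fun t x0 x1 x2 => 1 - t ^ k * (x0 ^+ a * x1 ^+ b * x2 ^+ c)).
Proof.
apply: (representsD (w := fun t x0 x1 x2 => - (t ^ k * (x0 ^+ a * x1 ^+ b * x2 ^+ c)))).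
  exact: represents1.
apply: (representsN (v := fun t x0 x1 x2 => t ^ k * (x0 ^+ a * x1 ^+ b * x2 ^+ c))).
exact: representsM (represents_qhalf k) (represents_pmono a b c).
Qed.

Definition nek_val (t x : F) mu nu : F :=
  (\prod_(i < size mu) \prod_(j < part mu i) (1 - t ^ (2 * arm_leg mu nu i j) * x)) *
  \prod_(i < size nu) \prod_(j < part nu i) (1 - t ^ (2 * - arm_leg nu mu i j) * x).

Lemma represents_nek a b c mu nu : represents (nek (mn3 a b c) mu nu)
  (fun t x0 x1 x2 => nek_val t (x0 ^+ a * x1 ^+ b * x2 ^+ c) mu nu).
Proof.
have h la (E : nat -> nat -> int) :
  represents (\prod_(i < size la) \prod_(j < part la i)
      (1 - pconst (qhalf ^ (2 * E i j)) * pmono ratfun (mn3 a b c)))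
    (fun t x0 x1 x2 => \prod_(i < size la) \prod_(j < part la i)
      (1 - t ^ (2 * E i j) * (x0 ^+ a * x1 ^+ b * x2 ^+ c))).
  refine (@represents_prod 'I_(size la) _ _ (fun i t x0 x1 x2 => \prod_(j < part la i)
      (1 - t ^ (2 * E i j) * (x0 ^+ a * x1 ^+ b * x2 ^+ c))) _) => i.
  refine (@represents_prod 'I_(part la i) _ _ (fun j t x0 x1 x2 =>
      (1 - t ^ (2 * E i j) * (x0 ^+ a * x1 ^+ b * x2 ^+ c))) _) => j.
  exact: represents_factor.
exact: representsM (h mu (arm_leg mu nu)) (h nu (fun i j => - arm_leg nu mu i j)).
Qed.

Definition hook_val (t : F) la : F :=
  \prod_(i < size la) \prod_(j < part la i) (t ^+ hook la i j - t ^- hook la i j) ^- 2.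

Hypothesis G1 : forall t x0 x1 x2, G t x0 x1 x2 -> forall n, t ^+ n.+1 - t ^- n.+1 != 0.

Lemma represents_hooks (R : realType) la :
  represents (pconst (skew_schur_q R la empty_intpart empty_intpart *
     skew_schur_q R (conj_intpart la) empty_intpart empty_intpart))
  (fun t _ _ _ => hook_val t la).
Proof.
rewrite skew_schur_q_conj.
have pc (I : Type) (s : seq I) (E : I -> ratfun) :
    pconst (\prod_(i <- s) E i) = \prod_(i <- s) pconst (E i) :> pser 3 ratfun.
  by apply: (big_morph (fun c => pconst c : pser 3 ratfun)); [apply: pconst_mul|apply: pconst1].
rewrite pc; refine (@represents_prod 'I_(size la) _ _ (fun i t _ _ _ => \prod_(j < part la i)
  (t ^+ hook la i j - t ^- hook la i j) ^- 2) _) => i.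
rewrite pc; refine (@represents_prod 'I_(part la i) _ _ (fun j t _ _ _ =>
  (t ^+ hook la i j - t ^- hook la i j) ^- 2) _) => j.
have [n hn] : exists n, hook la i j = n.+1.
  by exists (hook la i j).-1; rewrite prednK // hook_gt0.
rewrite hn; apply: (represents_pconstV (v := fun t => (t ^+ n.+1 - t ^- n.+1) ^+ 2)).
- rewrite expf_neq0 //; have := qhalf_expr_neq1 R n; apply: contraNneq => e.
  rewrite exprVn -exprM mulnC exprM.
  by rewrite expr2 invfM -{1}(subr0_eq e) -exprVn -exprMn mulfV ?qhalf_neq0 // expr1n subrr.
- by move=> t x0 x1 x2 /G1 h; rewrite expf_neq0.
rewrite expr2 pconst_mul; apply: (represents_ext
  (v := fun t _ _ _ => (t ^+ n.+1 - t ^- n.+1) * (t ^+ n.+1 - t ^- n.+1))).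
  by move=> *; rewrite expr2.
have h : represents (pconst (qhalf ^+ n.+1 - qhalf ^- n.+1))
    (fun t _ _ _ => t ^+ n.+1 - t ^- n.+1).
  rewrite pconstD pconstN; apply: (representsD (w := fun t _ _ _ => - t ^- n.+1)).
    exact: (represents_qhalf n.+1).
  apply: (representsN (v := fun t _ _ _ => t ^- n.+1)).
  by rewrite exprnN; apply: represents_ext (represents_qhalf _) => *; rewrite exprnN.
exact (representsM h h).
Qed.

End Represents.

(** * Evaluation of the right-hand side *)

Section ComplexExponential.

Variable R : realType.
Implicit Types (z w : R[i]).

Lemma cexpD z w : cexp (z + w) = cexp z * cexp w.
Proof.
case: z w => [a b] [c d]; rewrite /cexp /=.
rewrite expRD cosD sinD; apply/eqP; rewrite eq_complex /=; apply/andP; split; apply/eqP; ring.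
Qed.

Lemma cexp0 : cexp 0 = 1 :> R[i].
Proof. by rewrite /cexp /= expR0 cos0 sin0 mulr1 mulr0. Qed.

Lemma cexp_neq0 z : cexp z != 0.
Proof.
have : cexp (z - z) != 0 by rewrite subrr cexp0 oner_neq0.
by rewrite cexpD mulf_eq0 negb_or => /andP[].
Qed.

Lemma cexpN z : cexp (- z) = (cexp z)^-1.
Proof. by apply: (mulfI (cexp_neq0 z)); rewrite -cexpD subrr cexp0 mulfV ?cexp_neq0. Qed.

Lemma cexpX z n : cexp (z * n%:R) = cexp z ^+ n.
Proof.
elim: n => [|n IH]; first by rewrite mulr0 cexp0.
by rewrite -addn1 natrD mulrDr mulr1 cexpD IH exprD expr1.
Qed.

Lemma cexpXz z (k : int) : cexp (z * k%:~R) = cexp z ^ k.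
Proof.
case: k => n; first exact: cexpX.
by rewrite NegzE mulrNz mulrN cexpN -exprnN; congr (_^-1); apply: cexpX.
Qed.

Lemma csinhN z : csinh (- z) = - csinh z.
Proof. by rewrite /csinh opprK -mulNr opprB. Qed.

End ComplexExponential.

Definition content_sum la : int := \sum_(i < size la) \sum_(j < part la i) (j%:Z - i%:Z).

Lemma kappa_content la : kappa la = 2 * content_sum la.
Proof.
rewrite kappa_cells /content_sum mulr_sumr; apply: eq_bigr => i _.
by rewrite mulr_sumr.
Qed.

(** The mixed terms sum to the pairing of the column lengths of [mu] and [nu], which is symmetric
    and cancels; the arms and the row indices make up the contents. *)
Lemma sum_arm_leg mu nu :
  \sum_(i < size mu) \sum_(j < part mu i) arm_leg mu nu i j -
  \sum_(i < size nu) \sum_(j < part nu i) arm_leg nu mu i j =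
  content_sum mu - content_sum nu.
Proof.
pose X (la ka : intpart) : int :=
  \sum_(i < size la) \sum_(j < part la i) (part (conj_intpart ka) j)%:Z.
have XC la ka : X la ka = X ka la.
  have h la' ka' M : (part la' 0 <= M)%N -> X la' ka' = \sum_(j < M)
      (part (conj_intpart la') j)%:Z * (part (conj_intpart ka') j)%:Z.
    move=> hM; rewrite /X (big_cells_conj _ la' (fun i j => (part (conj_intpart ka') j)%:Z)).
    rewrite size_conj (big_ord_widen M (fun j => \sum_(i < part (conj_intpart la') j)
      (part (conj_intpart ka') j)%:Z)) // big_mkcond; apply: eq_bigr => j _.
    case: ltnP => h; last by rewrite [part (conj_intpart la') _]part_default ?size_conj // mul0r.
    by rewrite sumr_const card_ord mulrC -mulr_natr natz.
  rewrite (h la ka (maxn (part la 0) (part ka 0))) ?leq_maxl //.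
  rewrite (h ka la (maxn (part la 0) (part ka 0))) ?leq_maxr //.
  by apply: eq_bigr => j _; rewrite mulrC.
have E la ka : \sum_(i < size la) \sum_(j < part la i) arm_leg la ka i j =
    X la ka + content_sum la.
  rewrite /X /content_sum -big_split; apply: eq_bigr => i _ /=.
  rewrite -big_split /= /arm_leg.
  rewrite (eq_bigr (fun j : 'I_(part la i) => ((part la i)%:Z - (j : nat).+1%:Z) +
    ((part (conj_intpart ka) j)%:Z - i%:Z))); last by move=> j _; lia.
  rewrite big_split /= (reindex_inj rev_ord_inj) /= -big_split; apply: eq_bigr => j _ /=.
  by have := ltn_ord j; lia.
by rewrite !E [X nu mu]XC; lia.
Qed.

(** * Products of hyperbolic sines as Laurent polynomials times monomials *)

Section SinhRatio.

Variables (R : realType) (Rad hbar : R[i]).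
Local Notation t := (vqhalf Rad hbar).
Implicit Types (a : R[i]).

Lemma vqhalf_neq0 : t != 0. Proof. exact: cexp_neq0. Qed.

(** With [y = exp (- R a)] and [t = exp (- R hbar)], the exponential of minus the argument is
    [y t^e], and [2 sinh] is [1 / (y t^e) - y t^e]. *)
Lemma csinh_factor a (e : int) : csinh (Rad * (a + hbar * e%:~R)) =
  (2 * cexp (- (Rad * a)) * t ^ e)^-1 * (1 - t ^ (2 * e) * cexp (- (Rad * a)) ^+ 2).
Proof.
rewrite /csinh; have y0 := cexp_neq0 (- (Rad * a)).
have T0 : t ^ e != 0 by rewrite expfz_neq0 // vqhalf_neq0.
have -> : cexp (- (Rad * (a + hbar * e%:~R))) = cexp (- (Rad * a)) * t ^ e.
  by rewrite /vqhalf -cexpXz -cexpD; congr cexp; ring.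
have -> : cexp (Rad * (a + hbar * e%:~R)) = (cexp (- (Rad * a)) * t ^ e)^-1.
  by rewrite /vqhalf -cexpXz -cexpD -cexpN; congr cexp; ring.
have -> : t ^ (2 * e) = t ^ e * t ^ e by rewrite -expfzDr ?vqhalf_neq0 //; congr (_ ^ _); ring.
move: (cexp _) (t ^ e) y0 T0 => y T y0 T0.
by field; rewrite y0 T0.
Qed.

Lemma csinh_factorB a (e : int) : csinh (Rad * (a - hbar * e%:~R)) =
  (2 * cexp (- (Rad * a)) * t ^ (- e))^-1 * (1 - t ^ (2 * - e) * cexp (- (Rad * a)) ^+ 2).
Proof. by rewrite -csinh_factor mulrNz mulrN. Qed.

Lemma prod_cells_const (K : fieldType) (c u : K) la (e : nat -> nat -> int) (f : nat -> nat -> K) :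
    u != 0 ->
  \prod_(i < size la) \prod_(j < part la i) ((c * u ^ e i j)^-1 * f i j)^-1 =
  c ^+ psize la * u ^ (\sum_(i < size la) \sum_(j < part la i) e i j) /
  \prod_(i < size la) \prod_(j < part la i) f i j.
Proof.
move=> u0.
have -> : c ^+ psize la = \prod_(i < size la) \prod_(j < part la i) c.
  rewrite psize_cells -prodrXr; apply: eq_bigr => i _.
  by rewrite -prodrXr.
have hu (I : Type) (s : seq I) (E : I -> int) : u ^ (\sum_(i <- s) E i) = \prod_(i <- s) u ^ E i.
  elim: s => [|i s IH]; first by rewrite !big_nil expr0z.
  by rewrite !big_cons expfzDr // IH.
rewrite hu -prodfV -!big_split; apply: eq_bigr => i _ /=.
rewrite hu -prodfV -!big_split; apply: eq_bigr => j _ /=.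
by rewrite invfM invrK.
Qed.

Lemma sinh_ratioE a mu nu (y := cexp (- (Rad * a))) : sinh_ratio Rad hbar a mu nu =
  (2 * y) ^+ (psize mu + psize nu) * t ^ (content_sum mu - content_sum nu) /
  nek_val t (y ^+ 2) mu nu.
Proof.
rewrite /sinh_ratio /nek_val -/y.
under eq_bigr do under eq_bigr do rewrite csinh_factor.
under [X in _ * X]eq_bigr do under eq_bigr do rewrite csinh_factorB.
rewrite (prod_cells_const _ mu (arm_leg mu nu)
  (fun i j => 1 - t ^ (2 * arm_leg mu nu i j) * y ^+ 2) vqhalf_neq0).
rewrite (prod_cells_const _ nu (fun i j => - arm_leg nu mu i j)
  (fun i j => 1 - t ^ (2 * - arm_leg nu mu i j) * y ^+ 2) vqhalf_neq0).
rewrite -sum_arm_leg expfzDr ?vqhalf_neq0 // exprD invfM.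
have -> : \sum_(i < size nu) \sum_(j < part nu i) - arm_leg nu mu i j =
    - (\sum_(i < size nu) \sum_(j < part nu i) arm_leg nu mu i j).
  by rewrite -sumrN; apply: eq_bigr => i _; rewrite -sumrN.
by rewrite mulrACA; congr (_ * _); rewrite mulrACA.
Qed.

Lemma prod_cells_opp (K : fieldType) la (f : nat -> nat -> K) :
  \prod_(i < size la) \prod_(j < part la i) (- f i j)^-1 =
  (-1) ^+ psize la * \prod_(i < size la) \prod_(j < part la i) (f i j)^-1.
Proof.
rewrite psize_cells -prodrXr -big_split; apply: eq_bigr => i _ /=.
rewrite -prodrXr -big_split; apply: eq_bigr => j _ /=.
by rewrite expr1 mulN1r invrN.
Qed.

Lemma sinh_ratioN a mu nu : sinh_ratio Rad hbar (- a) nu mu =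
  (-1) ^+ (psize mu + psize nu) * sinh_ratio Rad hbar a mu nu.
Proof.
rewrite /sinh_ratio.
have e1 (k : int) : csinh (Rad * (- a + hbar * k%:~R)) = - csinh (Rad * (a - hbar * k%:~R)).
  by rewrite -csinhN; congr csinh; ring.
have e2 (k : int) : csinh (Rad * (- a - hbar * k%:~R)) = - csinh (Rad * (a + hbar * k%:~R)).
  by rewrite -csinhN; congr csinh; ring.
under eq_bigr do under eq_bigr do rewrite e1.
under [X in _ * X]eq_bigr do under eq_bigr do rewrite e2.
rewrite (prod_cells_opp nu (fun i j => csinh (Rad * (a - hbar * (arm_leg nu mu i j)%:~R)))).
rewrite (prod_cells_opp mu (fun i j => csinh (Rad * (a + hbar * (arm_leg mu nu i j)%:~R)))).
by rewrite exprD mulrACA [_ * (-1) ^+ psize mu]mulrC; congr (_ * _); rewrite mulrC.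
Qed.

Lemma sinh_ratio_diag mu : sinh_ratio Rad hbar 0 mu mu =
  (-1) ^+ psize mu * 4 ^+ psize mu * hook_val t mu.
Proof.
rewrite /sinh_ratio /hook_val -exprMn psize_cells -prodrXr -!big_split; apply: eq_bigr => i _ /=.
rewrite -prodrXr -!big_split; apply: eq_bigr => j _ /=; rewrite expr1.
have -> : (part mu i)%:Z - j.+1%:Z + (part (conj_intpart mu) j)%:Z - i.+1%:Z + 1 =
    (hook mu i j)%:Z.
  by have := ltn_ord j; rewrite /hook; have := part_conj mu i j; lia.
rewrite csinh_factor csinh_factorB mulr0 oppr0 cexp0 !mulr1 expr1n !mulr1.
set h := hook mu i j.
have T0 : t ^+ h != 0 by rewrite expf_neq0 // vqhalf_neq0.
have -> : t ^ (2 * h%:Z) = t ^+ h * t ^+ h.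
  by rewrite -exprD; have -> : 2 * h%:Z = (h + h)%N%:Z by lia.
have -> : t ^ (2 * - h%:Z) = (t ^+ h * t ^+ h)^-1.
  by rewrite -exprD (_ : 2 * - h%:Z = - (h + h)%N%:Z) -?exprnN //; lia.
rewrite -[t ^ h%:Z]/(t ^+ h) (_ : t ^ (- h%:Z) = (t ^+ h)^-1); last by rewrite -exprnN.
move: (t ^+ h) T0 => T T0.
have -> : 1 - T * T = - T * (T - T^-1) by rewrite mulrBr mulNr mulNr mulfV // opprK addrC.
have -> : 1 - (T * T)^-1 = T^-1 * (T - T^-1) by rewrite mulrBr mulVf // invfM.
(* For [D = 0] both sides are 0 by the convention that the inverse of 0 is 0. *)
move: (T - T^-1) => D; case: (eqVneq D 0) => [->|D0].
  by rewrite !mulr0 !invr0 expr0n /= invr0 !mulr0.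
by field; rewrite T0 D0.
Qed.

(** The signs from the hooks cancel those from the oddness of [sinh]. The constant 16 is 4 from a
    diagonal ratio times 2 from each of the two others. *)
Lemma sinh_ratio_adjoint a mu nu (y := cexp (- (Rad * a))) :
  sinh_ratio Rad hbar 0 mu mu * sinh_ratio Rad hbar a mu nu *
    (sinh_ratio Rad hbar (- a) nu mu * sinh_ratio Rad hbar 0 nu nu) =
  16 ^+ (psize mu + psize nu) * (y ^+ 2) ^+ (psize mu + psize nu) * 
  (t ^ (content_sum mu - content_sum nu)) ^+ 2 *
    hook_val t mu * hook_val t nu / nek_val t (y ^+ 2) mu nu ^+ 2.
Proof.
rewrite sinh_ratioN !sinh_ratio_diag sinh_ratioE -/y.
have s2 n : (-1) ^+ n * (-1) ^+ n = 1 :> R[i] by rewrite -expr2 sqrr_sign.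
have -> : (16 : R[i]) = 4 * (2 * 2) by rewrite -!natrM.
rewrite -exprVn (exprAC y 2) !exprMn !exprD.
have := s2 (psize mu); have := s2 (psize nu).
move: ((-1) ^+ psize mu) ((-1) ^+ psize nu) (nek_val _ _ _ _)^-1 => s s' n e e'.
rewrite -[RHS]mul1r -e -[RHS]mul1r -e'.
by ring.
Qed.

End SinhRatio.

(** Here [b], [p], [d], [g] are the sizes of the four partitions, [kB] and its analogues are [t] to
    their content sums, [y1] and [y2] are square roots of the fibre variables, and [w ^+ 2] is
    [Q_0]. Only monomials have to be matched. *)
Lemma summand_algebra (F : numFieldType) (b p d g : nat) (y1 y2 w kB kP kD kG : F)
    (HB HP HD HG N1 N2 N11 N12 N21 N22 A1 A2 tk T I11 I12 I21 I22 : F) :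
    y1 != 0 -> y2 != 0 -> w != 0 -> kB != 0 -> kP != 0 -> kD != 0 -> kG != 0 ->
    A1 = 16 ^+ (b + p) * (y1 ^+ 2) ^+ (b + p) * (kB * kP^-1) ^+ 2 * HB * HP / N1 ^+ 2 ->
    A2 = 16 ^+ (g + d) * (y2 ^+ 2) ^+ (g + d) * (kG * kD^-1) ^+ 2 * HG * HD / N2 ^+ 2 ->
    tk = kB ^+ 2 * kP ^+ 2 * kD ^- 2 * kG ^- 2 ->
    T = kB ^+ 2 * kP ^- 2 * kD ^- 2 * kG ^+ 2 ->
    I11 = (2 * (w * y1 * y2)) ^+ (b + d) * (kB * kD^-1) / N11 ->
    I12 = (2 * (w * y1)) ^+ (b + g) * (kB * kG^-1) / N12 ->
    I21 = (2 * (w * y2)) ^+ (p + d) * (kP * kD^-1) / N21 ->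
    I22 = (2 * w) ^+ (p + g) * (kP * kG^-1) / N22 ->
  (2 ^+ 4 * y1 ^+ 2)^-1 ^+ (b + p) * A1 * ((2 ^+ 4 * y2 ^+ 2)^-1 ^+ (d + g) * A2) *
    tk * (2 ^+ 2 * w ^+ 2) ^+ (b + p + d + g) * y1 ^+ (2 * b + d + g) *
    y2 ^+ (b + p + 2 * d) * (I11^-1 * I12^-1 * (I21^-1 * I22^-1)) =
  T * HB * HP * HG * HD * (N22 * N21 * (N12 * N11)) * (N1 ^+ 2 * N2 ^+ 2)^-1.
Proof.
move=> y10 y20 w0 b0 p0 d0 g0 -> -> -> -> -> -> -> ->.
have -> : 16 = 2 ^+ 4 :> F by rewrite -natrX.
have two : 2 != 0 :> F by rewrite pnatr_eq0.
(* The factors [1 / (2^4 Q_F)] cancel the monomials of the adjoint ratios. *)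
have c1 : (2 ^+ 4 * y1 ^+ 2)^-1 ^+ (b + p) * ((2 ^+ 4) ^+ (b + p) * (y1 ^+ 2) ^+ (b + p)) = 1.
  by rewrite -exprMn -exprMn mulVf ?expr1n // mulf_neq0 ?expf_neq0.
have c2 : (2 ^+ 4 * y2 ^+ 2)^-1 ^+ (d + g) * ((2 ^+ 4) ^+ (g + d) * (y2 ^+ 2) ^+ (g + d)) = 1.
  by rewrite addnC -exprMn -exprMn mulVf ?expr1n // mulf_neq0 ?expf_neq0.
(* The powers of [2^2 Q_0] and of the square roots of the fibre variables are exactly the monomials
   of the four bifundamental ratios. *)
have c3 : (2 ^+ 2 * w ^+ 2) ^+ (b + p + d + g) * y1 ^+ (2 * b + d + g) * y2 ^+ (b + p + 2 * d) =
    (2 * (w * y1 * y2)) ^+ (b + d) * (2 * (w * y1)) ^+ (b + g) *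
    ((2 * (w * y2)) ^+ (p + d) * (2 * w) ^+ (p + g)).
  have sq n (x : F) : (x ^+ 2) ^+ n = x ^+ n * x ^+ n by rewrite -exprM mulnC exprM expr2.
  rewrite [(_ * _ ^+ 2) ^+ _]exprMn !sq !exprMn !mul2n -!addnn !exprD.
  by ring.
move: c1 c2 c3.
set u1 := _ ^+ (b + p); set u2 := _ ^+ (b + p); set u3 := _ ^+ (b + p).
set u4 := _ ^+ (d + g); set u5 := _ ^+ (g + d); set u6 := _ ^+ (g + d).
set u7 := _ ^+ (b + p + d + g); set u8 := y1 ^+ _; set u9 := y2 ^+ _.
have n11 : (2 * (w * y1 * y2)) ^+ (b + d) != 0 by rewrite expf_neq0 ?mulf_neq0.
have n12 : (2 * (w * y1)) ^+ (b + g) != 0 by rewrite expf_neq0 ?mulf_neq0.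
have n21 : (2 * (w * y2)) ^+ (p + d) != 0 by rewrite expf_neq0 ?mulf_neq0.
have n22 : (2 * w) ^+ (p + g) != 0 by rewrite expf_neq0 ?mulf_neq0.
move: n11 n12 n21 n22.
set v11 := (2 * (w * y1 * y2)) ^+ _; set v12 := (2 * (w * y1)) ^+ _.
set v21 := (2 * (w * y2)) ^+ _; set v22 := (2 * w) ^+ _.
move=> n11 n12 n21 n22 c1 c2 c3.
clearbody u1 u2 u3 u4 u5 u6 u7 u8 u9 v11 v12 v21 v22.
rewrite !invfM !invrK.
transitivity ((u1 * (u2 * u3)) * (u4 * (u5 * u6)) * ((u7 * u8 * u9) / (v11 * v12 * (v21 * v22))) *
  ((kB * kP^-1) ^+ 2 * HB * HP * N1^-1 ^+ 2 * (kG * kD^-1) ^+ 2 * HG * HD * N2^-1 ^+ 2 *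
   (kB ^+ 2 * kP ^+ 2 * kD^-1 ^+ 2 * kG^-1 ^+ 2) *
   (kB^-1 * kD * N11 * (kB^-1 * kG * N12) * (kP^-1 * kD * N21 * (kP^-1 * kG * N22))))).
  rewrite !invfM; move: N1^-1 N2^-1 kB^-1 kP^-1 kD^-1 kG^-1 v11^-1 v12^-1 v21^-1 v22^-1 => *.
  by ring.
rewrite c1 c2 c3 mulfV ?mulf_neq0 // !mul1r.
move: N1^-1 N2^-1 => n1 n2.
by field; rewrite b0 p0 d0 g0.
Qed.

(** * Matching of both sides at generic parameters *)

Section FinalEvaluation.

Variable R : realType.

Definition instanton_val (t x0 x1 x2 : R[i]) (be pi ga de : intpart) : R[i] :=
  t ^ (kappa be - kappa pi - kappa de + kappa ga) *
  hook_val t be * hook_val t pi * hook_val t ga * hook_val t de *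
  (nek_val t x0 pi ga * nek_val t (x0 * x2) pi de *
   (nek_val t (x0 * x1) be ga * nek_val t (x0 * x1 * x2) be de)) *
  (nek_val t x1 be pi ^+ 2 * nek_val t x2 ga de ^+ 2)^-1.

Lemma big_I2 (A : comNzRingType) (f : 'I_2 -> A) : \prod_(k < 2) f k = f i1 * f i2.
Proof.
rewrite big_ord_recl big_ord1; congr (f _ * f _); exact: val_inj.
Qed.

Lemma summandE (Rad hbar a1 a2 m : R[i]) (M : quadruple) :
  summand Rad hbar a1 a2 m M =
  instanton_val (vqhalf Rad hbar) (vQ0 Rad a1 a2 m) (vQF Rad a1 a2 i1) (vQF Rad a1 a2 i2)
    (M (i1, i1)) (M (i1, i2)) (M (i2, i2)) (M (i2, i1)).
Proof.
set be := M (i1, i1); set pi := M (i1, i2); set de := M (i2, i1); set ga := M (i2, i2).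
set t := vqhalf Rad hbar.
pose y1 := vQFhalf Rad a1 a2 i1; pose y2 := vQFhalf Rad a1 a2 i2.
pose w := cexp (Rad * (a1 + a2 - m)).
have t0 : t != 0 by exact: cexp_neq0.
have q1 : vQF Rad a1 a2 i1 = y1 ^+ 2.
  by rewrite /y1 /vQF /vQFhalf -cexpX; congr cexp; ring.
have q2 : vQF Rad a1 a2 i2 = y2 ^+ 2.
  by rewrite /y2 /vQF /vQFhalf -cexpX; congr cexp; ring.
have q0 : vQ0 Rad a1 a2 m = w ^+ 2.
  by rewrite /w /vQ0 -cexpX; congr cexp; ring.
have e1 : cexp (- (Rad * (2 * a1))) = y1 by rewrite /y1 /vQFhalf /param /=; congr cexp; ring.
have e2 : cexp (- (Rad * (2 * a2))) = y2 by rewrite /y2 /vQFhalf /param /=; congr cexp; ring.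
have e11 : cexp (- (Rad * (bifundamental_weight a1 a2 i1 i1 + m))) = w * y1 * y2.
  rewrite /w /y1 /y2 /vQFhalf /param /bifundamental_weight -!cexpD /=; congr cexp.
  by rewrite !expr0; ring.
have e12 : cexp (- (Rad * (bifundamental_weight a1 a2 i1 i2 + m))) = w * y1.
  rewrite /w /y1 /vQFhalf /param /bifundamental_weight -!cexpD /=; congr cexp.
  by rewrite expr0 expr1; ring.
have e21 : cexp (- (Rad * (bifundamental_weight a1 a2 i2 i1 + m))) = w * y2.
  rewrite /w /y2 /vQFhalf /param /bifundamental_weight -!cexpD /=; congr cexp.
  by rewrite expr0 expr1; ring.
have e22 : cexp (- (Rad * (bifundamental_weight a1 a2 i2 i2 + m))) = w.
  rewrite /w /bifundamental_weight /=; congr cexp.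
  by rewrite expr1; ring.
have kE mu : t ^ kappa mu = (t ^ content_sum mu) ^+ 2.
  by rewrite kappa_content mulrC -exprz_exp -exprnP.
have kB (x y : int) : t ^ (x - y) = t ^ x * (t ^ y)^-1 by rewrite expfzDr // -invr_expz.
have k0 (k : int) : t ^ k != 0 by rewrite expfz_neq0.
rewrite /summand !big_I2 -/be -/pi -/de -/ga -/t /instanton_val q0 q1 q2.
have -> : w ^+ 2 * y1 ^+ 2 * y2 ^+ 2 = (w * y1 * y2) ^+ 2 by ring.
have -> : w ^+ 2 * y1 ^+ 2 = (w * y1) ^+ 2 by ring.
have -> : w ^+ 2 * y2 ^+ 2 = (w * y2) ^+ 2 by ring.
apply: (@summand_algebra _ _ _ _ _ y1 y2 w (t ^ content_sum be) (t ^ content_sum pi)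
  (t ^ content_sum de) (t ^ content_sum ga)); rewrite ?k0 ?cexp_neq0 //.
- rewrite /adjoint_weight /= -kB -e1.
  exact: (sinh_ratio_adjoint Rad hbar (2 * a1) be pi).
(* The weight [- (2 a2)] of the pair [de], [ga] is the weight [2 a2] of [ga], [de], the order in
   which [strip_den] contains them. *)
- rewrite /adjoint_weight /= opprK -kB -e2.
  rewrite -(sinh_ratio_adjoint Rad hbar (2 * a2) ga de) -/t; ring.
- by rewrite !kB expfzDr // !kE.
- by rewrite expfzDr // !kB !kE.
- by rewrite sinh_ratioE e11 kB.
- by rewrite sinh_ratioE e12 kB.
- by rewrite sinh_ratioE e21 kB.
- by rewrite sinh_ratioE e22 kB.
Qed.

Lemma rhs_coefE (Rad hbar a1 a2 m : R[i]) b1 b2 : rhs_coef Rad hbar a1 a2 m b1 b2 =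
  \sum_(x <- surf_seq b1 b2) instanton_val (vqhalf Rad hbar) (vQ0 Rad a1 a2 m)
    (vQF Rad a1 a2 i1) (vQF Rad a1 a2 i2) x.1.1 x.1.2 x.2.2 x.2.1.
Proof.
pose mk (x : (intpart * intpart) * (intpart * intpart)) : quadruple :=
  [ffun kl : 'I_2 * 'I_2 => let p := if kl.1 == i1 then x.1 else x.2 in
                            if kl.2 == i1 then p.1 else p.2].
rewrite /rhs_coef (fsum_list (r := [seq mk x | x <- surf_seq b1 b2]) (P := xpredT)).
- by rewrite big_map; apply: eq_bigr => x _; rewrite summandE !ffunE.
- rewrite map_inj_uniq ?uniq_surf_seq // => -[[x1 x2] [x3 x4]] [[y1 y2] [y3 y4]] e.
  have h kl : mk (x1, x2, (x3, x4)) kl = mk (y1, y2, (y3, y4)) kl by rewrite e.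
  have := h (i1, i1); have := h (i1, i2); have := h (i2, i1); have := h (i2, i2).
  by rewrite !ffunE /= => -> -> -> ->.
- move=> _ /mapP[x hx ->] _ /=; rewrite !ffunE /=.
  by move: hx; rewrite mem_surf_seq => /andP[/eqP -> /eqP ->].
- move=> M /= [h1 h2] _; rewrite andbT; apply/mapP.
  exists ((M (i1, i1), M (i1, i2)), (M (i2, i1), M (i2, i2))).
    by rewrite mem_surf_seq /= h1 h2 !eqxx.
  apply/ffunP => -[k l]; rewrite ffunE /=.
  have c (j : 'I_2) : j = i1 \/ j = i2.
    by case: j => -[|[|//]] hj; [left|right]; apply: val_inj.
  by case: (c k) => ->; case: (c l) => ->.
Qed.

(** The form of [generic_parameters] in the evaluated variables: the denominators are powers of [t],
    the hook factors and the factors of [strip_den], which involve [x1] and [x2]. *)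
Definition generic_point (t x0 x1 x2 : R[i]) : Prop :=
  [/\ t != 0, forall n, t ^+ n.+1 - t ^- n.+1 != 0,
      forall N : int, 1 - t ^ (2 * N) * x1 != 0 & forall N : int, 1 - t ^ (2 * N) * x2 != 0].

Lemma generic_parameters_point Rad hbar a1 a2 m : generic_parameters Rad hbar a1 a2 ->
  generic_point (vqhalf Rad hbar) (vQ0 Rad a1 a2 m) (vQF Rad a1 a2 i1) (vQF Rad a1 a2 i2).
Proof.
move=> [h1 h2]; set t := vqhalf Rad hbar; have t0 : t != 0 by exact: cexp_neq0.
have F k N : 1 - t ^ (2 * N) * vQF Rad a1 a2 k != 0.
  have := h2 k N; rewrite csinh_factor mulf_eq0 negb_or => /andP[_].
  by rewrite -cexpX (_ : - (Rad * (2 * param a1 a2 k)) * 2 = - (4 * Rad * param a1 a2 k)) //; ring.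
split=> // n.
have := h1 n.+1%:Z isT; rewrite -[hbar * _]add0r csinh_factor mulr0 oppr0 cexp0 expr1n mulr1.
rewrite mulf_eq0 negb_or -/t => /andP[_]; apply: contra => /eqP e.
have -> : t ^ (2 * n.+1%:Z) = t ^+ n.+1 * t ^+ n.+1.
  by rewrite -exprD (_ : 2 * n.+1%:Z = (n.+1 + n.+1)%N%:Z) //; lia.
by rewrite mulr1 -{1}[t ^+ n.+1](subrK (t ^- n.+1)) e add0r mulVf ?expf_neq0 // subrr.
Qed.

Lemma represents_instanton (dir : edge -> bool) b1 b2 :
  represents generic_point (coef_QB b1 b2 (Z_X_inst R dir)) (fun t x0 x1 x2 =>
    \sum_(x <- surf_seq b1 b2) instanton_val t x0 x1 x2 x.1.1 x.1.2 x.2.2 x.2.1).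
Proof.
have G0 t x0 x1 x2 : generic_point t x0 x1 x2 -> t != 0 by case.
have G1 t x0 x1 x2 : generic_point t x0 x1 x2 -> forall n, t ^+ n.+1 - t ^- n.+1 != 0 by case.
have nz (t y : R[i]) mu nu : (forall N : int, 1 - t ^ (2 * N) * y != 0) -> nek_val t y mu nu != 0.
  by move=> h; rewrite mulf_neq0 //; apply/prodf_neq0 => i _; apply/prodf_neq0 => j _; apply: h.
rewrite coef_Z_X_inst.
refine (@represents_sum _ _ _ _ _ (fun x t x0 x1 x2 =>
  instanton_val t x0 x1 x2 x.1.1 x.1.2 x.2.2 x.2.1) _) => x.
move: x.1.1 x.1.2 x.2.2 x.2.1 => be pi ga de.
have N a b c mu nu (v : R[i] -> R[i] -> R[i] -> R[i]) :
    (forall x0 x1 x2, x0 ^+ a * x1 ^+ b * x2 ^+ c = v x0 x1 x2) ->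
    represents generic_point (nek (mn3 a b c) mu nu)
      (fun t x0 x1 x2 => nek_val t (v x0 x1 x2) mu nu).
  move=> e; apply: represents_ext (represents_nek G0 a b c mu nu) => t x0 x1 x2 _.
  by rewrite e.
have sq f v : represents generic_point f v ->
    represents generic_point (f ^+ 2) (fun t x0 x1 x2 => v t x0 x1 x2 ^+ 2).
  move=> h; rewrite expr2; apply: represents_ext (representsM h h) => *.
  by rewrite expr2.
have den : represents generic_point (strip_den be pi ga de)
    (fun t x0 x1 x2 => nek_val t x1 be pi ^+ 2 * nek_val t x2 ga de ^+ 2).
  apply: representsM; apply: sq.
    by apply: (N _ _ _ _ _ (fun _ x1 _ => x1)) => *; rewrite !expr0 expr1 mul1r mulr1.
  by apply: (N _ _ _ _ _ (fun _ _ x2 => x2)) => *; rewrite !expr0 expr1 !mul1r.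
apply: representsM; last first.
  apply: (representsV _ (pinvP (strip_den_const be pi ga de)) den) => t x0 x1 x2 [_ _ h1 h2].
  by rewrite mulf_neq0 // expf_neq0 // nz.
apply: representsM.
  rewrite /prefactor !pconst_mul.
  do 4!(apply: representsM; last by rewrite -pconst_mul; exact: represents_hooks).
  exact: represents_qhalf.
apply: representsM; apply: representsM.
- by apply: (N _ _ _ _ _ (fun x0 _ _ => x0)) => *; rewrite !expr0 expr1 !mulr1.
- by apply: (N _ _ _ _ _ (fun x0 _ x2 => x0 * x2)) => *; rewrite !expr0 !expr1 !mulr1.
- by apply: (N _ _ _ _ _ (fun x0 x1 _ => x0 * x1)) => *; rewrite !expr0 !expr1 !mulr1.
- by apply: (N _ _ _ _ _ (fun x0 x1 x2 => x0 * x1 * x2)) => *; rewrite !expr1.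
Qed.

End FinalEvaluation.

Theorem proposition5p1 (R : realType) (dir : edge -> bool) (b1 b2 : nat) :
  exists P D : tpoly,
    is_expansion (coef_QB b1 b2 (Z_X_inst R dir)) P D /\
    forall Rad hbar a1 a2 m : R[i],
      generic_parameters Rad hbar a1 a2 ->
      let eval := eval_tpoly (vqhalf Rad hbar) (vQ0 Rad a1 a2 m)
                    (vQF Rad a1 a2 i1) (vQF Rad a1 a2 i2) in
      eval D != 0 /\ eval P / eval D = rhs_coef Rad hbar a1 a2 m b1 b2.
Proof.
have [P [D [h1 h2]]] := represents_instanton R dir b1 b2.
exists P, D; split=> // Rad hbar a1 a2 m g /=.
have [d0 e] := h2 _ _ _ _ (generic_parameters_point m g).
by rewrite rhs_coefE.
Qed.
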